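(* Let $n$ be a positive integer and let $k$ be a computable field of characteristic zero, with algebraic closure $\overline{k}$. For a finitely presented $k$-algebra $R = k\{X_1,\ldots,X_s\}/\langle f_1,\ldots,f_t\rangle$, having at most finitely many equivalence classes of irreducible $n$-dimensional representations is an algorithmically decidable property of $R$. That is, there is an algorithm which, given as input a finite presentation of $R$ (the number $s$ of generators and elements $f_1,\ldots,f_t$ of the free associative $k$-algebra $k\{X_1,\ldots,X_s\}$), terminates and correctly decides whether or not the set of equivalence classes of irreducible $n$-dimensional representations $R \to M_n(\overline{k})$ is finite (possibly empty).
   Context: A field $k$ is computable if its elements can be effectively represented so that equality is decidable and the field operations are computable. The integer $n$ and the field $k$ are fixed. $k\{X_1,\ldots,X_s\}$ denotes the free associative (noncommutative) unital $k$-algebra on $X_1,\ldots,X_s$, and $\langle f_1,\ldots,f_t\rangle$ denotes the two-sided ideal generated by $f_1,\ldots,f_t$; the algebra $R$ may be infinite dimensional over $k$. An $n$-dimensional representation of $R$ is a unital $k$-algebra homomorphism $\rho\colon R \to M_n(\overline{k})$, where $M_n(\overline{k})$ is the $k$-algebra of $n\times n$ matrices over $\overline{k}$. Two such representations $\rho,\rho'$ are equivalent if there exists $Q \in GL_n(\overline{k})$ such that $\rho'(X) = Q\rho(X)Q^{-1}$ for all $X \in R$. The representation $\rho$ is irreducible if $\overline{k}\,\rho(R) = M_n(\overline{k})$, i.e. the $\overline{k}$-linear span of the image of $\rho$ is all of $M_n(\overline{k})$. *)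

(* Defs.v *)
From HB Require Import structures.
From mathcomp Require Import all_boot all_order all_algebra generic_quotient.
From mathcomp Require Import ring_quotient.
From mathcomp Require Import boolp classical_sets functions cardinality.
From mathcomp Require Import monalg.

Set Implicit Arguments.
Unset Strict Implicit.
Unset Printing Implicit Defensive.

Import GRing.Theory.
Local Open Scope ring_scope.
Local Open Scope quotient_scope.

(* Algorithms are Kleene's mu-recursive functions: [recfun m] is the type of
   programs computing a partial function of m natural numbers. *)
Inductive recfun : nat -> Type :=
| RZero m : recfun m
| RSucc : recfun 1
| RProj m : 'I_m -> recfun m
| RComp m p : recfun p -> ('I_p -> recfun m) -> recfun m
| RPrec m : recfun m -> recfun m.+2 -> recfun m.+1
| RMu m : recfun m.+1 -> recfun m.

(* [eval c v y]: the program c halts on the input v with output y. *)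
Fixpoint eval m (c : recfun m) : m.-tuple nat -> nat -> Prop :=
  match c in recfun m return m.-tuple nat -> nat -> Prop with
  | RZero _ => fun _ y => y = 0%N
  | RSucc => fun v y => y = (thead v).+1
  | RProj _ i => fun v y => y = tnth v i
  | RComp _ p f g => fun v y =>
      exists2 w : p.-tuple nat,
        (forall i, eval (g i) v (tnth w i)) & eval f w y
  (* h i is the value after i steps of the recursion *)
  | RPrec _ f g => fun v y =>
      exists h : nat -> nat,
        [/\ eval f [tuple of behead v] (h 0%N),
            forall i, (i < thead v)%N ->
              eval g [tuple of i :: h i :: behead v] (h i.+1) &
            y = h (thead v)]
  | RMu _ f => fun v y =>
      eval f [tuple of y :: v] 0%N /\
      forall i, (i < y)%N -> exists z, eval f [tuple of i :: v] z.+1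
  end.

(* k is a computable field, every natural number being the name of an element.
   Inversion is the total one, with 0^-1 = 0. *)
Record computable_numbering (k : fieldType) (nu : nat -> k) : Prop := {
  numbering_surj : forall x, exists a, nu a = x;
  numbering_eq : exists c : recfun 2, forall a b,
    eval c [tuple a; b] (nu a == nu b);
  numbering_add : exists c : recfun 2, forall a b,
    exists2 y, eval c [tuple a; b] y & nu y = nu a + nu b;
  numbering_opp : exists c : recfun 1, forall a,
    exists2 y, eval c [tuple a] y & nu y = - nu a;
  numbering_mul : exists c : recfun 2, forall a b,
    exists2 y, eval c [tuple a; b] y & nu y = nu a * nu b;
  numbering_inv : exists c : recfun 1, forall a,
    exists2 y, eval c [tuple a] y & nu y = (nu a)^-1
}.

Definition is_algebraic_closure (k : fieldType) (K : closedFieldType)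
  (iota : {rmorphism k -> K}) : Prop := forall x : K, algebraicOver iota x.

(* The free associative unital algebra on X_0, ..., X_(s-1): the algebra of the
   free monoid of words in these letters. *)
Definition free_alg (k : fieldType) (s : nat) : Type := {malg k[{fmonom 'I_s}]}.

HB.instance Definition _ k s := GRing.Lalgebra.on (free_alg k s).

(* Stated in an abstract ring: rewriting with mulrA is slow in free_alg. *)
Fact mulr_sandwich (R : pzRingType) (a x y z b : R) :
  a * (x * y * z) * b = (a * x) * y * (z * b).
Proof. by rewrite !mulrA. Qed.

Fact mulrB_split (R : pzRingType) (x y x' y' : R) :
  x * y - x' * y' = 1 * (x - x') * y + x' * (y - y') * 1.
Proof. by rewrite mul1r mulr1 mulrBl mulrBr addrA subrK. Qed.

Section FreeAlgebra.
Variables (k : fieldType) (s : nat).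
Local Notation A := (free_alg k s).

Lemma free_alg_scalerAr (a : k) (x y : A) : a *: (x * y) = x * (a *: y).
Proof.
have cM (u : {malg k[{fmonom 'I_s}]}) : a%:MP * u = u * a%:MP.
  rewrite mul_malgC malgM_def fgmulgU malgZ_def /fgscale.
  by apply: eq_bigr => w _; rewrite mulm1 mulrC.
have := congr1 (fun z => z * (y : {malg k[_]})) (cM x).
by rewrite -[LHS]mulrA -[RHS]mulrA !mul_malgC.
Qed.

HB.instance Definition _ := GRing.Lalgebra_isAlgebra.Build k A free_alg_scalerAr.

(* The two-sided ideal generated by the list fs: the finite sums of products
   a * f * b with f in fs. *)
Definition in_gen_ideal (fs : seq A) (x : A) : Prop :=
  exists2 r : seq (A * A * A),
    forall t, t \in r -> t.1.2 \in fs & x = \sum_(t <- r) t.1.1 * t.1.2 * t.2.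

Definition gen_ideal (fs : seq A) : {pred A} := fun x => `[< in_gen_ideal fs x >].

Variable fs : seq A.
Local Notation I := (gen_ideal fs).

Lemma gen_ideal_zmod : zmod_closed I.
Proof.
split; first by apply/asboolP; exists [::]; rewrite ?big_nil.
move=> x y /asboolP[r rP ->] /asboolP[q qP ->]; apply/asboolP.
exists (r ++ [seq (- t.1.1, t.1.2, t.2) | t <- q]).
  move=> t; rewrite mem_cat => /orP[/rP //|/mapP[u /qP ? ->]] //.
rewrite big_cat big_map -sumrN; congr (_ + _).
by apply: eq_bigr => t _ /=; rewrite !mulNr.
Qed.

HB.instance Definition _ := GRing.isZmodClosed.Build A I gen_ideal_zmod.

Lemma gen_idealM a x b : x \in I -> a * x * b \in I.
Proof.
move=> /asboolP[r rP ->]; apply/asboolP.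
exists [seq (a * t.1.1, t.1.2, t.2 * b) | t <- r].
  by move=> t /mapP[u /rP ? ->].
rewrite big_map mulr_sumr mulr_suml.
by apply: eq_bigr => t _; apply: mulr_sandwich.
Qed.

(* The quotient of the free algebra by the ideal generated by fs; it is the zero
   ring when 1 lies in the ideal. *)
Definition fp_alg : Type := Quotient.quot I.

HB.instance Definition _ := GRing.Zmodule.on fp_alg.
HB.instance Definition _ := EqQuotient.on fp_alg.
HB.instance Definition _ := ZmodQuotient.on fp_alg.

Local Notation pi := (\pi_fp_alg).

Definition fp_one : fp_alg := lift_cst fp_alg 1.
Definition fp_mul := lift_op2 fp_alg *%R.
Definition fp_scale (a : k) := lift_op1 fp_alg ( *:%R a).

Lemma fp_algP (x y : A) : reflect (pi x = pi y) (x - y \in I).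
Proof. by rewrite Quotient.idealrBE; apply: eqP. Qed.

Lemma pi_fp_mul : {morph pi : x y / x * y >-> fp_mul x y}.
Proof.
move=> x y; unlock fp_mul; apply/fp_algP.
by rewrite mulrB_split rpredD // gen_idealM //; apply/fp_algP; rewrite reprK.
Qed.

Lemma pi_fp_scale a : {morph pi : x / a *: x >-> fp_scale a x}.
Proof.
move=> x; unlock fp_scale; apply/fp_algP.
rewrite -scalerBr -[_ *: _]mulr1 -mulr_algl gen_idealM //.
by apply/fp_algP; rewrite reprK.
Qed.

Lemma pi_fp_one : pi 1 = fp_one.
Proof. by unlock fp_one. Qed.

Lemma fp_mulA : associative fp_mul.
Proof.
move=> x y z; rewrite -[x]reprK -[y]reprK -[z]reprK.
by rewrite -!pi_fp_mul mulrA.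
Qed.

Lemma fp_mul1 : left_id fp_one fp_mul.
Proof. by move=> x; rewrite -[x]reprK -pi_fp_one -pi_fp_mul mul1r. Qed.

Lemma fp_mulr1 : right_id fp_one fp_mul.
Proof. by move=> x; rewrite -[x]reprK -pi_fp_one -pi_fp_mul mulr1. Qed.

Let piD : {morph pi : x y / x + y >-> x + y} := raddfD pi.

Lemma fp_mulDl : left_distributive fp_mul +%R.
Proof.
move=> x y z; rewrite -[x]reprK -[y]reprK -[z]reprK.
by rewrite -!(piD, pi_fp_mul) mulrDl.
Qed.

Lemma fp_mulDr : right_distributive fp_mul +%R.
Proof.
move=> x y z; rewrite -[x]reprK -[y]reprK -[z]reprK.
by rewrite -!(piD, pi_fp_mul) mulrDr.
Qed.

HB.instance Definition _ := GRing.Zmodule_isPzRing.Build fp_alg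
  fp_mulA fp_mul1 fp_mulr1 fp_mulDl fp_mulDr.

Lemma fp_scaleA a b x : fp_scale a (fp_scale b x) = fp_scale (a * b) x.
Proof. by rewrite -[x]reprK -!pi_fp_scale scalerA. Qed.

Lemma fp_scale1 : left_id 1 fp_scale.
Proof. by move=> x; rewrite -[x]reprK -pi_fp_scale scale1r. Qed.

Lemma fp_scaleDr : right_distributive fp_scale +%R.
Proof.
move=> a x y; rewrite -[x]reprK -[y]reprK.
by rewrite -!(piD, pi_fp_scale) scalerDr.
Qed.

Lemma fp_scaleDl x : {morph fp_scale^~ x : a b / a + b}.
Proof.
move=> a b; rewrite -[x]reprK.
by rewrite -!pi_fp_scale -piD scalerDl.
Qed.

HB.instance Definition _ := GRing.Zmodule_isLmodule.Build k fp_alg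
  fp_scaleA fp_scale1 fp_scaleDr fp_scaleDl.

Lemma fp_scaleAl a (x y : fp_alg) : a *: (x * y) = a *: x * y.
Proof.
rewrite -[x]reprK -[y]reprK.
change (fp_scale a (fp_mul (pi (repr x)) (pi (repr y))) =
  fp_mul (fp_scale a (pi (repr x))) (pi (repr y))).
by rewrite -!(pi_fp_mul, pi_fp_scale) scalerAl.
Qed.

Lemma fp_scaleAr a (x y : fp_alg) : a *: (x * y) = x * (a *: y).
Proof.
rewrite -[x]reprK -[y]reprK.
change (fp_scale a (fp_mul (pi (repr x)) (pi (repr y))) =
  fp_mul (pi (repr x)) (fp_scale a (pi (repr y)))).
by rewrite -!(pi_fp_mul, pi_fp_scale) scalerAr.
Qed.

End FreeAlgebra.

Arguments fp_alg {k s} fs.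

Section Representations.
Variables (k : fieldType) (K : closedFieldType) (iota : {rmorphism k -> K}).
Variables (s : nat) (fs : seq (free_alg k s)) (n : nat).

(* Unital k-algebra homomorphisms, k acting on 'M[K]_n through iota; the library
   type of algebra morphisms does not apply, because fp_alg may be zero. *)
Record representation : Type := Representation {
  rep_fun :> {rmorphism fp_alg fs -> 'M[K]_n};
  rep_scalable : forall (a : k) x, rep_fun (a *: x) = iota a *: rep_fun x
}.

Definition rep_equiv (rho rho' : representation) : Prop :=
  exists2 Q : 'M[K]_n, Q \in unitmx &
    forall x, rho' x = Q *m rho x *m invmx Q.

Definition rep_irreducible (rho : representation) : Prop :=
  forall M : 'M[K]_n, exists r : seq (K * fp_alg fs),
    M = \sum_(t <- r) t.1 *: rho t.2.

Definition rep_class (rho : representation) : set representation :=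
  [set rho' | rep_equiv rho rho'].

Definition irreducible_classes : set (set representation) :=
  [set rep_class rho | rho in [set rho | rep_irreducible rho]].

End Representations.

Arguments irreducible_classes {k K} iota {s} fs n.

(* Input data: a noncommutative polynomial is a list of monomials, each given by
   the name of its coefficient and the word of the indices of its letters. *)
Definition poly_data s := seq (nat * seq 'I_s).

Definition decode_poly (k : fieldType) (nu : nat -> k) s (p : poly_data s) :
  free_alg k s :=
  \sum_(t <- p) << nu t.1 *g FMonom t.2 >>.

Arguments decode_poly {k} nu {s} p.

(* [CodeSeq.code : seq nat -> nat] is an explicit bijection. *)
Definition code_poly s (p : poly_data s) : nat :=
  CodeSeq.code
    [seq CodeSeq.code [:: t.1; CodeSeq.code (map val t.2)]
    | t : nat * seq 'I_s <- p].

Definition code_presentation s (ps : seq (poly_data s)) : nat :=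
  CodeSeq.code [:: s; CodeSeq.code (map (@code_poly s) ps)].

(* Main.v *)
(* The matrices of an irreducible representation rho admit n^2 words W of length
   less than n^2 whose values span M_n, and the coordinates in this basis of the
   products of a generator and a basis word determine rho up to conjugation.
   Hence there are finitely many classes if and only if, for each of the finitely
   many choices of words and indices, one distinguished variable takes finitely
   many values on the solutions of an explicit finite system of commutative
   polynomial equations over k.

   That last property is decided by two semi-algorithms.  Finiteness is certified
   by an equational derivation of p(T) = 0 with p monic in the distinguished
   variable T.  Infinitude is certified by a triangular tower of monic equations
   over k[T] localized at one polynomial, from which the system is derivable: it
   can be solved for all but finitely many T in K.  If there is no certificate of
   the first kind, a maximal consistent extension of the system (Zorn's lemma)
   gives a domain with a solution where T is transcendental over k; adjoining the
   variables one at a time turns this generic solution into a tower. *)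

Require Import Defs.
From HB Require Import structures.
From mathcomp Require Import all_boot all_order all_algebra.
From mathcomp Require Import generic_quotient ring_quotient ring monalg.
From mathcomp Require Import boolp classical_sets functions cardinality.

Set Implicit Arguments.
Unset Strict Implicit.
Unset Printing Implicit Defensive.

Import GRing.Theory.

(** * Recursive functions *)

(** No algebraic algorithm is ever shown to terminate. Derivability from finitely many equations is
    enumerable by its very form, so the algorithmic side reduces to closure properties of recursive
    functions, and the algebra is free to be classical: it only has to show, with choice and Zorn's
    lemma, that one of the two certificates exists. Factorization in [k[T]], which a computable
    field may fail to provide, is avoided: division is replaced by pseudo-division, and all the
    inverses required are collected in a single polynomial in T. Monic equations serve on both
    sides. The monic polynomials in T form a multiplicative set, so a set of equations that is
    maximal among those deriving none of them generates a prime ideal. Monic equations of positive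
    degree also stay solvable under every specialization of their coefficients. Unsolvable systems
    are no separate case: they derive 1 = 0, a monic equation of degree 0 in T. *)

Definition recursive m (f : m.-tuple nat -> nat) : Prop :=
  exists c : recfun m, forall v, eval c v (f v).

Lemma eq_recursive m (f g : m.-tuple nat -> nat) :
  f =1 g -> recursive f -> recursive g.
Proof. by move=> fg [c Hc]; exists c => v; rewrite -fg. Qed.

Lemma recursive_comp m p (f : p.-tuple nat -> nat)
    (g : 'I_p -> m.-tuple nat -> nat) :
  recursive f -> (forall i, recursive (g i)) ->
  recursive (fun v => f [tuple g i v | i < p]).
Proof.
move=> [c Hc] /fin_all_exists [d Hd]; exists (RComp c d) => v /=.
by exists [tuple g i v | i < p] => // i; rewrite tnth_mktuple.
Qed.

Lemma recursive_proj m (i : 'I_m) : recursive (fun v => tnth v i).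
Proof. by exists (RProj i). Qed.

Definition recursive1 (f : nat -> nat) :=
  recursive (fun v : 1.-tuple nat => f (tnth v ord0)).

Definition recursive2 (f : nat -> nat -> nat) :=
  recursive (fun v : 2.-tuple nat => f (tnth v ord0) (tnth v (lift ord0 ord0))).

Lemma recursive1_comp m f (e : m.-tuple nat -> nat) :
  recursive1 f -> recursive e -> recursive (fun v => f (e v)).
Proof.
move=> Hf He; apply: eq_recursive (recursive_comp (g := fun=> e) Hf _) => // v.
by rewrite tnth_mktuple.
Qed.

Lemma recursive2_comp m f (e1 e2 : m.-tuple nat -> nat) :
  recursive2 f -> recursive e1 -> recursive e2 ->
  recursive (fun v => f (e1 v) (e2 v)).
Proof.
move=> Hf H1 H2.
apply: eq_recursive
  (recursive_comp (g := fun i : 'I_2 => if i == ord0 then e1 else e2) Hf _).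
  by move=> v; rewrite !tnth_mktuple.
by move=> i; case: ifP.
Qed.

Lemma recursive_const m k : recursive (fun _ : m.-tuple nat => k).
Proof.
elim: k => [|k IH]; first by exists (RZero m).
apply: (recursive1_comp (f := S)) IH.
by exists RSucc => v /=; rewrite (tnth_nth 0) -[thead v]/(tnth v ord0) (tnth_nth 0).
Qed.

Lemma recursive1_succ : recursive1 S.
Proof. by exists RSucc. Qed.

Lemma behead_tuple_cons m (i : nat) (v : m.-tuple nat) :
  [tuple of behead [tuple of i :: v]] = v.
Proof. exact: val_inj. Qed.

(** [RPrec] recurses on the head of its argument, so the bound [e v] is prepended to the parameters
    [v]; in the step function the parameters come after the counter and the accumulator. *)
Lemma recursive_iteri m (b : m.-tuple nat -> nat)
    (g : nat -> nat -> m.-tuple nat -> nat) (e : m.-tuple nat -> nat) :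
  recursive b -> recursive e ->
  recursive (fun v : m.+2.-tuple nat =>
    g (tnth v ord0) (tnth v (lift ord0 ord0)) [tuple tnth v (lift ord0
      (lift ord0 i)) | i < m]) ->
  recursive (fun v => iteri (e v) (fun i h => g i h v) (b v)).
Proof.
move=> [cb Hb] [ce He] [cg Hg].
pose c := RPrec cb cg.
have Hc (v : m.+1.-tuple nat) :
    eval c v (iteri (thead v) (fun i h => g i h [tuple of behead v])
      (b [tuple of behead v])).
  exists (fun k => iteri k (fun i h => g i h [tuple of behead v]) (b [tuple of behead v])).
  split=> // i _.
  set w := [tuple of _ :: _ :: _].
  have := Hg w; congr (eval _ _ _) => /=.
  rewrite (tnth_nth 0) [tnth w (lift _ _)](tnth_nth 0) /=; congr (g _ _ _).
  by apply: eq_from_tnth => j; rewrite tnth_mktuple !(tnth_nth 0) /=.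
pose args v : m.+1.-tuple nat := [tuple of e v :: v].
have Hc' : recursive (fun v : m.+1.-tuple nat =>
    iteri (thead v) (fun i h => g i h [tuple of behead v]) (b [tuple of behead v])).
  by exists c.
have := recursive_comp (g := fun (i : 'I_m.+1) v => tnth (args v) i) Hc' _.
move=> H; apply: eq_recursive (H _).
  move=> v; have -> : [tuple tnth (args v) i | i < m.+1] = args v.
    by apply: eq_from_tnth => j; rewrite tnth_mktuple.
  by rewrite behead_tuple_cons.
move=> i; case: (unliftP ord0 i) => [j ->|->].
  by apply: eq_recursive (recursive_proj j) => v; rewrite tnthS.
by exists ce => v; rewrite tnth0.
Qed.

Lemma recursive_mu m (f : nat -> m.-tuple nat -> nat) (g : m.-tuple nat -> nat) :
  recursive (fun v : m.+1.-tuple nat => f (tnth v ord0) [tuple of behead v]) ->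
  (forall v, f (g v) v = 0) -> (forall v i, i < g v -> f i v != 0) ->
  recursive g.
Proof.
move=> [c Hc] fg0 fg1; exists (RMu c) => v /=; split.
  by have := Hc [tuple of g v :: v]; rewrite tnth0 behead_tuple_cons fg0.
move=> i /fg1 Hi; exists (f i v).-1; rewrite prednK ?lt0n //.
by have := Hc [tuple of i :: v]; rewrite tnth0 behead_tuple_cons.
Qed.

Lemma recursive2_iteri (b : nat -> nat) (g : nat -> nat -> nat -> nat) :
  recursive1 b ->
  recursive (fun v : 3.-tuple nat =>
    g (tnth v ord0) (tnth v (lift ord0 ord0)) (tnth v (lift ord0 (lift ord0 ord0)))) ->
  recursive2 (fun k a => iteri k (fun i h => g i h a) (b a)).
Proof.
move=> Hb Hg.
apply: (@recursive_iteri 2 (fun v => b (tnth v (lift ord0 ord0)))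
  (fun i h v => g i h (tnth v (lift ord0 ord0))) (fun v => tnth v ord0)).
- exact: recursive1_comp (recursive_proj _).
- exact: recursive_proj.
- pose t3 (v : 4.-tuple nat) (i : 'I_3) : nat :=
    nth 0 [:: tnth v ord0; tnth v (lift ord0 ord0);
      tnth v (lift ord0 (lift ord0 (lift ord0 ord0)))] i.
  apply: eq_recursive (@recursive_comp 4 3 _ (fun i v => t3 v i) Hg _).
    by move=> v; rewrite !tnth_mktuple.
  by case=> [[|[|[|//]]]] lt_i3; rewrite /t3 /=; apply: recursive_proj.
Qed.

Lemma recursive2_swap f : recursive2 f -> recursive2 (fun a b => f b a).
Proof. by move=> Hf; apply: recursive2_comp Hf (recursive_proj _) (recursive_proj _). Qed.

Lemma recursive2_add : recursive2 addn.
Proof.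
apply: eq_recursive (recursive2_iteri (b := id) (g := fun _ h _ => h.+1) _ _).
- by move=> v; elim: (tnth v ord0) => //= k ->.
- exact: recursive_proj.
- exact: recursive1_comp recursive1_succ (recursive_proj _).
Qed.

Lemma recursive2_mul : recursive2 muln.
Proof.
apply: eq_recursive (recursive2_iteri (b := fun=> 0) (g := fun _ h a => a + h) _ _).
- by move=> v; elim: (tnth v ord0) => //= k ->.
- exact: recursive_const.
- exact: recursive2_comp recursive2_add (recursive_proj _) (recursive_proj _).
Qed.

Lemma recursive2_sub : recursive2 subn.
Proof.
have H : recursive1 predn.
  apply: eq_recursive (recursive2_comp (e1 := fun v : 1.-tuple nat => tnth v ord0)
    (e2 := fun=> 0)
    (recursive2_iteri (b := fun=> 0) (g := fun i _ _ => i) _ _) _ _).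
  - by move=> v; case: (tnth v ord0).
  - exact: recursive_const.
  - exact: recursive_proj.
  - exact: recursive_proj.
  - exact: recursive_const.
apply: (@recursive2_swap (fun b a => a - b)).
apply: eq_recursive (recursive2_iteri (b := id) (g := fun _ h _ => h.-1) _ _).
- by move=> v; elim: (tnth v ord0) => [|k /= ->]; rewrite ?subn0 ?subnS.
- exact: recursive_proj.
- exact: recursive1_comp H (recursive_proj _).
Qed.

Lemma recursive1_exp2 : recursive1 (expn 2).
Proof.
apply: eq_recursive (recursive2_comp (e1 := fun v : 1.-tuple nat => tnth v ord0)
  (e2 := fun=> 0)
  (recursive2_iteri (b := fun=> 1) (g := fun _ h _ => 2 * h) _ _) _ _).
- by move=> v; elim: (tnth v ord0) => //= k ->; rewrite expnS.
- exact: recursive_const.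
- by apply: recursive2_comp recursive2_mul (recursive_const _ _) (recursive_proj _).
- exact: recursive_proj.
- exact: recursive_const.
Qed.

Lemma recursive2_leq : recursive2 (fun a b => a <= b).
Proof.
apply: eq_recursive (recursive2_comp (e1 := fun=> 1) (e2 := fun v : 2.-tuple nat =>
  tnth v ord0 - tnth v (lift ord0 ord0)) recursive2_sub
    (recursive_const _ _) recursive2_sub).
by move=> v; rewrite /leq; case: (tnth v ord0 - _).
Qed.

Lemma recursive2_bigsum (f : nat -> nat -> nat) :
  recursive2 f -> recursive2 (fun k a => \sum_(i < k) f i a).
Proof.
move=> Hf.
apply: eq_recursive (recursive2_iteri (b := fun=> 0) (g := fun i h a => h + f i a) _ _).
- by move=> v; elim: (tnth v ord0) => [|k /= ->]; rewrite ?big_ord0 ?big_ord_recr.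
- exact: recursive_const.
- apply: recursive2_comp recursive2_add (recursive_proj _) _.
  exact: recursive2_comp Hf (recursive_proj _) (recursive_proj _).
Qed.

(** Quotients and valuations are computed as the number of indices below them, counted in a range
    [k] known to be long enough; this replaces a bounded search by a sum. *)
Lemma sum_ord_lt k q : \sum_(i < k) (i < q) = minn k q.
Proof.
elim: k => [|k IH]; first by rewrite big_ord0 min0n.
rewrite big_ord_recr /= IH; case: (ltnP k q) => h.
  by rewrite (minn_idPl h) addn1.
by rewrite (minn_idPr (leqW h)) addn0.
Qed.

(** The quotient is the number of [j < a] with [j.+1 * 2 ^ i <= a]. The auxiliary sum takes three
    arguments because [a] is both the range and a parameter. *)
Lemma recursive2_divn_exp2 : recursive2 (fun a i => a %/ 2 ^ i).
Proof.
pose g a i := \sum_(j < a) (j.+1 * 2 ^ i <= a).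
have : recursive2 g.
  have H : recursive (fun v : 3.-tuple nat => \sum_(j < tnth v ord0)
     (j.+1 * 2 ^ (tnth v (lift ord0 ord0)) <= (tnth v (lift ord0 (lift ord0 ord0))))).
    apply: eq_recursive (@recursive_iteri 3 (fun=> 0) (fun j h v => h +
      (j.+1 * 2 ^ (tnth v (lift ord0 ord0)) <= (tnth v (lift ord0 (lift ord0 ord0)))))
        (fun v => tnth v ord0) _ _ _).
    - by move=> v; elim: (tnth v ord0) => [|k /= ->]; rewrite ?big_ord0 ?big_ord_recr.
    - exact: recursive_const.
    - exact: recursive_proj.
    - apply: recursive2_comp recursive2_add (recursive_proj _) _.
      apply: (recursive2_comp (f := fun a b => a <= b) recursive2_leq).
        apply: recursive2_comp recursive2_mul _ _.
          exact: recursive1_comp recursive1_succ (recursive_proj _).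
        apply: recursive1_comp recursive1_exp2 _.
        apply: eq_recursive (recursive_proj (lift ord0 (lift ord0 (lift ord0 ord0)))) => v.
        by rewrite tnth_mktuple.
      apply: eq_recursive (recursive_proj (lift ord0 (lift ord0 (lift ord0
        (lift ord0 ord0))))) => v.
      by rewrite tnth_mktuple.
  pose t3 (v : 2.-tuple nat) (i : 'I_3) : nat :=
    nth 0 [:: tnth v ord0; tnth v (lift ord0 ord0); tnth v ord0] i.
  apply: eq_recursive (@recursive_comp 2 3 _ (fun i v => t3 v i) H _).
    by move=> v; rewrite !tnth_mktuple /t3 /=.
  by case=> [[|[|[|//]]]] lt_i3; rewrite /t3 /=; apply: recursive_proj.
apply: eq_recursive => v; move: (tnth v ord0) (tnth v _) => a i; rewrite /g.
under eq_bigr => j _ do rewrite -leq_divRL ?expn_gt0 //.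
rewrite sum_ord_lt; apply/minn_idPr; exact: leq_div.
Qed.

(* [pr a b = code (a :: l)] when [code l = b], so that the head and the tail of
   a coded list are obtained by [pr1] and [pr2]. *)
Definition pr a b := 2 ^ a * b.*2.+1.
Definition pr1 c := logn 2 c.
Definition pr2 c := (c %/ 2 ^ logn 2 c)./2.

Lemma pr_gt0 a b : 0 < pr a b.
Proof. by rewrite muln_gt0 expn_gt0. Qed.

Lemma pr1K a b : pr1 (pr a b) = a.
Proof.
rewrite /pr1 /pr lognM ?expn_gt0 // pfactorK // [logn 2 _.+1](_ : _ = 0) ?addn0 //.
by rewrite lognE /= dvdn2 /= odd_double.
Qed.

Lemma pr2K a b : pr2 (pr a b) = b.
Proof.
rewrite /pr2; have := pr1K a b; rewrite /pr1 => ->.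
by rewrite /pr mulKn ?expn_gt0 //= uphalf_double.
Qed.

Lemma prK c : 0 < c -> pr (pr1 c) (pr2 c) = c.
Proof.
move=> c_gt0; have [q Hq Ec] := @pfactor_coprime 2 c isT c_gt0.
rewrite /pr /pr1 /pr2; set a := logn 2 c in Ec *.
rewrite Ec mulnK ?expn_gt0 // mulnC; congr (_ * _).
by rewrite -[RHS]odd_double_half; move: Hq; rewrite coprime2n => ->.
Qed.

Lemma ltn_pr1 a b : a < pr a b.
Proof. by rewrite -[a.+1]muln1 leq_mul // ltn_expl. Qed.

Lemma ltn_pr2 a b : b < pr a b.
Proof. by rewrite -[b.+1]mul1n leq_mul ?expn_gt0 // ltnS -addnn leq_addr. Qed.

Lemma recursive2_pr : recursive2 pr.
Proof.
apply: recursive2_comp recursive2_mul _ _.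
  exact: recursive1_comp recursive1_exp2 (recursive_proj _).
apply: recursive1_comp recursive1_succ _.
have h : recursive (fun v : 2.-tuple nat => 2 * tnth v (lift ord0 ord0)).
  exact: recursive2_comp recursive2_mul (recursive_const _ _) (recursive_proj _).
by apply: eq_recursive h => v; rewrite mul2n.
Qed.

(** The 2-adic valuation of [c > 0] is the number of [i < c] such that [2 ^ i.+1] divides [c];
    divisibility is tested by multiplying the quotient back. *)
Lemma recursive1_pr1 : recursive1 pr1.
Proof.
pose f i c : nat := (c <= (c %/ 2 ^ i.+1) * 2 ^ i.+1).
have Hf : recursive2 f.
  apply: (recursive2_comp (f := fun a b => a <= b) recursive2_leq (recursive_proj _)).
  apply: recursive2_comp recursive2_mul _ _.
    apply: (recursive2_comp (f := fun a i => a %/ 2 ^ i)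
      recursive2_divn_exp2 (recursive_proj _)).
    exact: recursive1_comp recursive1_succ (recursive_proj _).
  apply: recursive1_comp recursive1_exp2 _.
  exact: recursive1_comp recursive1_succ (recursive_proj _).
have := recursive2_comp (recursive2_bigsum Hf) (recursive_proj ord0) (recursive_proj
  (@ord0 0)).
apply: eq_recursive => v; move: (tnth v ord0) => c; rewrite /f /pr1.
case: (posnP c) => [->|c_gt0]; first by rewrite big_ord0.
transitivity (\sum_(i < c) (i < logn 2 c)).
  apply: eq_bigr => i _; rewrite -pfactor_dvdn //; congr nat_of_bool.
  by rewrite dvdn_eq eqn_leq leq_trunc_div.
by rewrite sum_ord_lt; apply/minn_idPr/ltnW/(leq_trans (ltn_logl _ c_gt0)).
Qed.

Lemma recursive1_pr2 : recursive1 pr2.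
Proof.
have H : recursive1 (fun c => c %/ 2 ^ pr1 c).
  apply: (recursive2_comp (f := fun a i => a %/ 2 ^ i)
    recursive2_divn_exp2 (recursive_proj _)).
  exact: recursive1_comp recursive1_pr1 (recursive_proj _).
have := recursive2_comp (f := fun a i => a %/ 2 ^ i) recursive2_divn_exp2 H
  (recursive_const _ 1).
by apply: eq_recursive => v; rewrite divn2.
Qed.

(** * Computability on coded types *)

(** Bijections rather than injections: every number is a code, so searches range over all of [nat],
    and [dec] followed by [enc] is the identity, so passing to codes requires no program. *)
Class coded (T : Type) := Coded {
  enc : T -> nat;
  dec : nat -> T;
  encK : cancel enc dec;
  decK : cancel dec enc
}.

Lemma enc_inj (T : Type) {cT : coded T} : injective (enc : T -> nat).
Proof. exact: can_inj encK. Qed.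

#[global] Instance coded_nat : coded nat :=
  @Coded nat id id (fun _ => erefl) (fun _ => erefl).

Section CodedPair.
Context (A B : Type) {cA : coded A} {cB : coded B}.
(** [pr] is a bijection onto the positive numbers only, hence the predecessor here and the successor
    in the decoding. *)
Definition enc_pair (p : A * B) : nat := (pr (enc p.1) (enc p.2)).-1.
Definition dec_pair (c : nat) : A * B := (dec (pr1 c.+1), dec (pr2 c.+1)).
Lemma enc_pairK : cancel enc_pair dec_pair.
Proof.
by case=> a b; rewrite /dec_pair /enc_pair prednK ?pr_gt0 // pr1K pr2K !encK.
Qed.
Lemma dec_pairK : cancel dec_pair enc_pair.
Proof. by move=> c; rewrite /dec_pair /enc_pair !decK prK. Qed.
End CodedPair.

#[global] Instance coded_pair A B {cA : coded A} {cB : coded B} : coded (A * B) :=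
  Coded (@enc_pairK A B cA cB) (@dec_pairK A B cA cB).

Section CodedSeq.
Context (A : Type) {cA : coded A}.
Definition enc_seq (l : seq A) : nat := CodeSeq.code (map enc l).
Definition dec_seq (c : nat) : seq A := map dec (CodeSeq.decode c).
Lemma enc_seqK : cancel enc_seq dec_seq.
Proof. by move=> l; rewrite /dec_seq CodeSeq.codeK mapK //; apply: encK. Qed.
Lemma dec_seqK : cancel dec_seq enc_seq.
Proof. by move=> c; rewrite /enc_seq (mapK decK) CodeSeq.decodeK. Qed.
End CodedSeq.

#[global] Instance coded_seq A {cA : coded A} : coded (seq A) :=
  Coded (@enc_seqK A cA) (@dec_seqK A cA).

Definition computable A B {cA : coded A} {cB : coded B} (f : A -> B) : Prop :=
  recursive1 (fun c => enc (f (dec c))).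

Definition computable2 A B C {cA : coded A} {cB : coded B} {cC : coded C}
    (f : A -> B -> C) : Prop :=
  computable (fun p : A * B => f p.1 p.2).

Definition computable3 A B C D {cA : coded A} {cB : coded B} {cC : coded C}
    {cD : coded D} (f : A -> B -> C -> D) : Prop :=
  computable (fun p : A * (B * C) => f p.1 p.2.1 p.2.2).

Section Computable.
Context (A B C : Type) {cA : coded A} {cB : coded B} {cC : coded C}.

Lemma eq_computable (f g : A -> B) : f =1 g -> computable f -> computable g.
Proof. by move=> fg; apply: eq_recursive => v; rewrite fg. Qed.

Lemma computable_id : computable (fun a : A => a).
Proof. by apply: eq_recursive (recursive_proj ord0) => v; rewrite decK. Qed.

Lemma computable_const (b : B) : computable (fun _ : A => b).
Proof. exact: recursive_const. Qed.

Lemma computable_comp (g : B -> C) (f : A -> B) :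
  computable g -> computable f -> computable (fun a => g (f a)).
Proof.
rewrite /computable => Hg Hf; have := recursive1_comp Hg Hf.
by apply: eq_recursive => v; rewrite encK.
Qed.

Lemma computable_pair (f : A -> B) (g : A -> C) :
  computable f -> computable g -> computable (fun a => (f a, g a)).
Proof.
move=> Hf Hg.
have H := recursive2_comp recursive2_sub (recursive2_comp recursive2_pr Hf Hg)
  (recursive_const _ 1).
by apply: eq_recursive H => v; rewrite subn1.
Qed.

Lemma computable_fst (f : A -> B * C) : computable f -> computable (fun a => (f a).1).
Proof.
move=> Hf; apply: eq_recursive
  (recursive1_comp recursive1_pr1 (recursive1_comp recursive1_succ Hf)) => v.
by rewrite -[in RHS](encK (f _)) /= /dec_pair /= decK.
Qed.

Lemma computable_snd (f : A -> B * C) : computable f -> computable (fun a => (f a).2).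
Proof.
move=> Hf; apply: eq_recursive
  (recursive1_comp recursive1_pr2 (recursive1_comp recursive1_succ Hf)) => v.
by rewrite -[in RHS](encK (f _)) /= /dec_pair /= decK.
Qed.

Lemma computable_enc (f : A -> B) : computable f -> computable (fun a => enc (f a)).
Proof. by []. Qed.

Lemma computable_dec (f : A -> nat) : computable f -> computable (fun a => dec (f a) : B).
Proof. by move=> Hf; apply: eq_recursive Hf => v; rewrite decK. Qed.

Lemma computable_rec1 (g : nat -> nat) (f : A -> nat) :
  recursive1 g -> computable f -> computable (fun a => g (f a)).
Proof. exact: recursive1_comp. Qed.

Lemma computable_rec2 (g : nat -> nat -> nat) (f1 f2 : A -> nat) :
  recursive2 g -> computable f1 -> computable f2 ->
  computable (fun a => g (f1 a) (f2 a)).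
Proof. exact: recursive2_comp. Qed.

End Computable.

Lemma computable_comp2 A B C D {cA : coded A} {cB : coded B} {cC : coded C}
    {cD : coded D} (g : B -> C -> D) (f1 : A -> B) (f2 : A -> C) :
  computable2 g -> computable f1 -> computable f2 ->
  computable (fun a => g (f1 a) (f2 a)).
Proof. by move=> Hg H1 H2; apply: (computable_comp Hg (computable_pair H1 H2)). Qed.

Lemma computable_comp3 A B C D E {cA : coded A} {cB : coded B} {cC : coded C}
    {cD : coded D} {cE : coded E} (g : B -> C -> D -> E)
    (f1 : A -> B) (f2 : A -> C) (f3 : A -> D) :
  computable3 g -> computable f1 -> computable f2 -> computable f3 ->
  computable (fun a => g (f1 a) (f2 a) (f3 a)).
Proof.
move=> Hg H1 H2 H3.
exact: (computable_comp Hg (computable_pair H1 (computable_pair H2 H3))).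
Qed.

Section ComputableNat.
Context (A : Type) {cA : coded A}.
Implicit Types f g : A -> nat.

Lemma computable_succ f : computable f -> computable (fun a => (f a).+1).
Proof. exact: recursive1_comp recursive1_succ. Qed.

Lemma computable_add f g :
  computable f -> computable g -> computable (fun a => f a + g a).
Proof. exact: recursive2_comp recursive2_add. Qed.

Lemma computable_mul f g :
  computable f -> computable g -> computable (fun a => f a * g a).
Proof. exact: recursive2_comp recursive2_mul. Qed.

Lemma computable_sub f g :
  computable f -> computable g -> computable (fun a => f a - g a).
Proof. exact: recursive2_comp recursive2_sub. Qed.

Lemma computable_double f : computable f -> computable (fun a => (f a).*2).
Proof.
move=> Hf; apply: eq_computable (computable_add Hf Hf) => a.
by rewrite addnn.
Qed.

End ComputableNat.

Definition decidable_pred A {cA : coded A} (R : A -> bool) : Prop :=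
  computable (fun a => nat_of_bool (R a)).

Section DecidablePred.
Context (A : Type) {cA : coded A}.
Implicit Types R Q : A -> bool.

Lemma eq_decidable R Q : R =1 Q -> decidable_pred R -> decidable_pred Q.
Proof. by move=> RQ; apply: eq_computable => a; rewrite RQ. Qed.

Lemma decidable_leq (f g : A -> nat) :
  computable f -> computable g -> decidable_pred (fun a => f a <= g a).
Proof. exact: (recursive2_comp (f := fun a b => a <= b) recursive2_leq). Qed.

Lemma decidable_and R Q :
  decidable_pred R -> decidable_pred Q -> decidable_pred (fun a => R a && Q a).
Proof.
by move=> HR HQ; apply: eq_computable (computable_mul HR HQ) => a; rewrite mulnb.
Qed.

Lemma decidable_not R : decidable_pred R -> decidable_pred (fun a => ~~ R a).
Proof.
move=> HR; apply: eq_computable (computable_sub (computable_const 1) HR) => a.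
by case: (R a).
Qed.

Lemma decidable_or R Q :
  decidable_pred R -> decidable_pred Q -> decidable_pred (fun a => R a || Q a).
Proof.
move=> HR HQ; apply: eq_decidable (decidable_not (decidable_and (decidable_not HR)
  (decidable_not HQ))) => a.
by rewrite -negb_or negbK.
Qed.

Lemma decidable_eq (T : eqType) {cT : coded T} (f g : A -> T) :
  computable f -> computable g -> decidable_pred (fun a => f a == g a).
Proof.
move=> Hf Hg.
apply: eq_decidable (decidable_and (decidable_leq (computable_enc Hf) (computable_enc Hg))
   (decidable_leq (computable_enc Hg) (computable_enc Hf))) => a.
by rewrite -eqn_leq (inj_eq (@enc_inj T cT)).
Qed.

Lemma decidable_comp (B : Type) {cB : coded B} (R : B -> bool) (f : A -> B) :
  decidable_pred R -> computable f -> decidable_pred (fun a => R (f a)).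
Proof. exact: (computable_comp (g := fun b => nat_of_bool (R b))). Qed.

Lemma computable_if (T : Type) {cT : coded T} R (f g : A -> T) :
  decidable_pred R -> computable f -> computable g ->
  computable (fun a => if R a then f a else g a).
Proof.
move=> HR Hf Hg.
have H := computable_add (computable_mul HR (computable_enc Hf))
   (computable_mul (computable_sub (computable_const 1) HR) (computable_enc Hg)).
apply: eq_computable (computable_dec (B := T) H) => a.
by case: (R a); rewrite ?mul1n ?mul0n ?addn0 ?add0n encK.
Qed.

End DecidablePred.

Lemma computable_iteri A T {cA : coded A} {cT : coded T} (e : A -> nat)
    (g : A -> nat -> T -> T) (b : A -> T) :
  computable e -> computable3 g -> computable b ->
  computable (fun a => iteri (e a) (g a) (b a)).
Proof.
rewrite /computable3 /computable => He Hg Hb.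
pose gn (i h c : nat) : nat := @enc T cT (g (@dec A cA c) i (@dec T cT h)).
have H : recursive (fun v : 3.-tuple nat =>
    gn (tnth v ord0) (tnth v (lift ord0 ord0)) (tnth v (lift ord0 (lift ord0 ord0)))).
  pose q x y := (pr x y).-1.
  pose p (v : 3.-tuple nat) := q (tnth v (lift ord0 (lift ord0 ord0)))
    (q (tnth v ord0) (tnth v (lift ord0 ord0))).
  have Hp : recursive p.
    have K m (x y : m.-tuple nat -> nat) : recursive x -> recursive y ->
        recursive (fun v => q (x v) (y v)).
      move=> Hx Hy; apply: eq_recursive (recursive2_comp recursive2_sub
        (recursive2_comp recursive2_pr Hx Hy) (recursive_const _ 1)) => v.
      by rewrite subn1.
    by apply: (K 3); [|apply: (K 3)]; exact: recursive_proj.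
  apply: eq_recursive (recursive1_comp Hg Hp) => v; rewrite /gn /p /q /=.
  by rewrite /dec_pair /= !prednK ?pr_gt0 // !pr1K !pr2K /= !prednK ?pr_gt0 // !pr1K !pr2K.
have := recursive2_comp (recursive2_iteri Hb H) He (recursive_proj ord0).
apply: eq_recursive => v; rewrite [enc (e _)]/enc /=.
by elim: (e _) => //= i ->; rewrite /gn encK.
Qed.

Lemma computable_cons A B {cA : coded A} {cB : coded B} (f : A -> B) (l : A -> seq B) :
  computable f -> computable l -> computable (fun a => f a :: l a).
Proof. rewrite /computable => Hf Hl; exact: recursive2_comp recursive2_pr Hf Hl. Qed.

(** A hook, redefined when closure properties for lists and for terms become available. The tactic
    [cpt] proves computability by following the syntax of a function. *)
Ltac cpt_ext := fail.

Ltac cpt_step :=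
  match goal with
  | _ => assumption
  | |- computable (fun a => a) => apply computable_id
  | |- computable (fun _ => ?c) => apply computable_const
  | |- computable (fun a => (@?f a, @?g a)) => apply (computable_pair (f := f) (g := g))
  | |- computable (fun a => (@?f a).1) => apply (computable_fst (f := f))
  | |- computable (fun a => (@?f a).2) => apply (computable_snd (f := f))
  | |- computable (fun a => (@?f a).+1) => apply (computable_succ (f := f))
  | |- computable (fun a => (@?f a + @?g a)%N) => apply (computable_add (f := f) (g := g))
  | |- computable (fun a => (@?f a * @?g a)%N) => apply (computable_mul (f := f) (g := g))
  | |- computable (fun a => (@?f a - @?g a)%N) => apply (computable_sub (f := f) (g := g))
  | |- computable (fun a => (@?f a).*2) => apply (computable_double (f := f))
  | |- computable (fun a => @?f a :: @?g a) => apply (computable_cons (f := f) (l := g))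
  | |- computable (fun a => enc (@?f a)) => apply (computable_enc (f := f))
  | _ => cpt_ext
  | H : computable ?f |- computable (fun a => ?f (@?e a)) =>
      apply (computable_comp (g := f) (f := e) H)
  | H : computable2 ?f |- computable (fun a => ?f (@?e1 a) (@?e2 a)) =>
      apply (computable_comp2 (g := f) (f1 := e1) (f2 := e2) H)
  | H : computable3 ?f |- computable (fun a => ?f (@?e1 a) (@?e2 a) (@?e3 a)) =>
      apply (computable_comp3 (g := f) (f1 := e1) (f2 := e2) (f3 := e3) H)
  | |- @computable ?A ?B ?cA ?cB ?f =>
      lazymatch f with
      | (fun _ => _) => fail
      | _ => change (@computable A B cA cB (fun a => f a))
      end
  end.

Ltac cpt := rewrite ?/computable2 ?/computable3; solve [repeat cpt_step].

Section CodedTail.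
Context (A : Type) {cA : coded A}.
Implicit Types l : seq A.

(** Recursion is available on numbers only, so lists are traversed through their codes, a tail being
    obtained by iterating [pr2]. *)
Definition coded_drop i c := iteri i (fun _ => pr2) c.

Lemma coded_dropE i l : coded_drop i (enc l) = enc (drop i l).
Proof.
elim: i => [|i IH] /=; first by rewrite drop0.
rewrite /coded_drop /= -/(coded_drop i _) IH -addn1 addnC -drop_drop drop1.
by case: (drop i l) => [|x s] //=; apply: pr2K.
Qed.

Lemma nth_coded l i : nth (dec 0) l i = dec (pr1 (coded_drop i (enc l))).
Proof.
rewrite coded_dropE -[i in LHS]addn0 -nth_drop.
by case: (drop i l) => [|x s] //=; rewrite [pr1 _]pr1K encK.
Qed.

Lemma leq_size_enc l : size l <= enc l.
Proof. by elim: l => //= x l IH; apply: leq_trans (ltn_pr2 _ _). Qed.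

(** The code of a list bounds its size and nonempty lists have positive codes, so the nonempty tails
    among the first [enc l] ones are counted. *)
Lemma size_coded l : size l = iteri (enc l) (fun i h => h + (0 < coded_drop i (enc l))) 0.
Proof.
have E k : iteri k (fun i h => h + (0 < coded_drop i (enc l))) 0 = minn k (size l).
  rewrite -sum_ord_lt; elim: k => [|k IH]; rewrite ?big_ord0 // big_ord_recr /= IH.
  congr (_ + nat_of_bool _); rewrite coded_dropE -(subn_gt0 k) -size_drop.
  by case: (drop k l) => // x s; rewrite pr_gt0.
by rewrite E; apply/esym/minn_idPr/leq_size_enc.
Qed.

End CodedTail.

(** A fold starts from the last element while the iteration counts up from 0; step [i] therefore
    consumes the element at position [size l - i.+1]. *)
Lemma foldr_iteri B T (x0 : B) (g : B -> T -> T) b l :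
  foldr g b l = iteri (size l) (fun i h => g (nth x0 l (size l - i.+1)) h) b.
Proof.
elim: l => //= x l ->; rewrite subnn /=; congr (g _ _).
suff K j : j <= size l -> iteri j (fun i h => g (nth x0 l (size l - i.+1)) h) b =
    iteri j (fun i h => g (nth x0 (x :: l) ((size l).+1 - i.+1)) h) b by exact: K.
by elim: j => //= j IH lt_j; rewrite (IH (ltnW lt_j)) (subSn lt_j).
Qed.

Lemma computable_coded_drop A {cA : coded A} (e c : A -> nat) :
  computable e -> computable c -> computable (fun a => coded_drop (e a) (c a)).
Proof.
move=> He Hc; apply: (computable_iteri (g := fun _ _ => pr2) He _ Hc).
by apply: (computable_rec1 recursive1_pr2); cpt.
Qed.

Lemma computable_size A B {cA : coded A} {cB : coded B} (l : A -> seq B) :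
  computable l -> computable (fun a => size (l a)).
Proof.
move=> Hl; apply: (eq_computable (fun a => esym (size_coded (l a)))).
apply: (computable_iteri (g := fun a i h => h + (0 < coded_drop i (enc (l a))))
  (b := fun=> 0)); [cpt| |cpt].
apply: computable_add; first by cpt.
apply: (@decidable_leq _ _ (fun=> 1) (fun p => coded_drop p.2.1 (enc (l p.1))));
  first by cpt.
by apply: computable_coded_drop; cpt.
Qed.

Lemma computable_nth A B {cA : coded A} {cB : coded B} x0
    (l : A -> seq B) (i : A -> nat) :
  computable l -> computable i -> computable (fun a => nth x0 (l a) (i a)).
Proof.
move=> Hl Hi.
have H : computable (fun a => nth (dec 0) (l a) (i a)).
  apply: (eq_computable (fun a => esym (nth_coded (l a) (i a)))).
  apply: computable_dec; apply: (computable_rec1 recursive1_pr1).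
  by apply: computable_coded_drop; cpt.
have := computable_if (decidable_leq (computable_succ Hi) (computable_size Hl)) H
  (computable_const x0).
apply: eq_computable => a; case: ltnP => h; first exact: set_nth_default.
by rewrite nth_default.
Qed.

Lemma computable_foldr A B T {cA : coded A} {cB : coded B} {cT : coded T}
    (g : A -> B -> T -> T) (b : A -> T) (l : A -> seq B) :
  computable3 g -> computable b -> computable l ->
  computable (fun a => foldr (g a) (b a) (l a)).
Proof.
move=> Hg Hb Hl.
apply: (eq_computable (fun a => esym (foldr_iteri (dec 0) (g a) (b a) (l a)))).
apply: (computable_iteri (g := fun a i h => g a (nth (dec 0) (l a) (size
  (l a) - i.+1)) h)) => //.
  exact: computable_size.
have Hl' : computable (fun p : A * (nat * T) => l p.1) by cpt.
apply: (computable_comp3 Hg); [cpt| |cpt].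
apply: computable_nth => //; apply: computable_sub; last by cpt.
exact: computable_size.
Qed.

Lemma computable_map A B T {cA : coded A} {cB : coded B} {cT : coded T}
    (f : A -> B -> T) (l : A -> seq B) :
  computable2 f -> computable l -> computable (fun a => map (f a) (l a)).
Proof.
move=> Hf Hl.
by apply: (computable_foldr (g := fun a x h => f a x :: h) (b := fun=> [::])); cpt.
Qed.

Lemma computable_cat A B {cA : coded A} {cB : coded B} (l1 l2 : A -> seq B) :
  computable l1 -> computable l2 -> computable (fun a => l1 a ++ l2 a).
Proof.
move=> H1 H2; have E a : foldr cons (l2 a) (l1 a) = l1 a ++ l2 a.
  by elim: (l1 a) => //= x s ->.
apply: (eq_computable E).
by apply: (computable_foldr (g := fun a x h => x :: h)); cpt.
Qed.

Lemma computable_iota A {cA : coded A} (e k : A -> nat) :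
  computable e -> computable k -> computable (fun a => iota (e a) (k a)).
Proof.
move=> He Hk.
have E m n : iota m n = iteri n (fun i h => (m + n - i.+1) :: h) [::].
  suff K j : j <= n -> iota (m + n - j) j = iteri j (fun i h => (m + n - i.+1) :: h) [::].
    by rewrite -K // addnK.
  elim: j => //= j IH lt_j; rewrite -IH ?(ltnW lt_j) //; congr (_ :: _).
  by rewrite -subSn // (leq_trans lt_j) // leq_addl.
apply: (eq_computable (fun a => esym (E (e a) (k a)))).
by apply: (computable_iteri (g := fun a i h => (e a + k a - i.+1) :: h) (b := fun=>
  [::])); cpt.
Qed.

Lemma decidable_all A B {cA : coded A} {cB : coded B}
    (R : A -> B -> bool) (l : A -> seq B) :
  decidable_pred (fun p : A * B => R p.1 p.2) -> computable l ->
  decidable_pred (fun a => all (R a) (l a)).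
Proof.
move=> HR Hl; have HR' : computable2 (fun a x => nat_of_bool (R a x)) by [].
have H : computable (fun a => foldr (fun x h => R a x * h) 1 (l a)).
  apply: (computable_foldr (g := fun a x h => R a x * h) (b := fun=> 1)); [|cpt|cpt].
  apply: computable_mul; last by cpt.
  by apply: (computable_comp2 HR'); cpt.
apply: eq_computable H => a; elim: (l a) => //= x s ->.
by rewrite mulnb.
Qed.

Lemma computable_flatten A B {cA : coded A} {cB : coded B} (l : A -> seq (seq B)) :
  computable l -> computable (fun a => flatten (l a)).
Proof.
move=> Hl; apply: (computable_foldr (g := fun _ x h => x ++ h) (b := fun=> [::]));
  [|cpt|cpt].
by apply: computable_cat; cpt.
Qed.

Lemma decidable_mem A {cA : coded A} (B : eqType) {cB : coded B}
    (f : A -> B) (l : A -> seq B) :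
  computable f -> computable l -> decidable_pred (fun a => f a \in l a).
Proof.
move=> Hf Hl.
have H : decidable_pred (fun a => ~~ all (fun x => f a != x) (l a)).
  by apply/decidable_not/decidable_all => //; apply/decidable_not/decidable_eq; cpt.
apply: eq_decidable H => a; rewrite -has_predC -has_pred1.
by apply: eq_has => x /=; rewrite negbK eq_sym.
Qed.

Ltac cpt_seq :=
  match goal with
  | |- computable (fun a => @?f a ++ @?g a) => apply (computable_cat (l1 := f) (l2 := g))
  | |- computable (fun a => size (@?f a)) => apply (computable_size (l := f))
  | |- computable (fun a => nth ?x (@?f a) (@?g a)) =>
      apply (computable_nth x (l := f) (i := g))
  | |- computable (fun a => iota (@?f a) (@?g a)) => apply (computable_iota (e := f)
    (k := g))
  | |- computable (fun a => flatten (@?f a)) => apply (computable_flatten (l := f))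
  end.

Ltac cpt_ext ::= cpt_seq.

(** * Recursively enumerable predicates *)

Definition re A {cA : coded A} (P : A -> Prop) : Prop :=
  exists2 R : A -> nat -> bool, decidable_pred (fun p : A * nat => R p.1 p.2) &
    forall a, P a <-> exists y, R a y.

Lemma eq_re A {cA : coded A} (P Q : A -> Prop) :
  (forall a, P a <-> Q a) -> re P -> re Q.
Proof. by move=> PQ [R HR PR]; exists R => // a; rewrite -PQ. Qed.

Lemma re_dec A {cA : coded A} (R : A -> bool) : decidable_pred R -> re (fun a => R a).
Proof.
move=> HR; exists (fun a _ => R a); first by apply: decidable_comp HR _; cpt.
by move=> a; split=> [|[]//]; exists 0.
Qed.

Lemma re_eq A B {cA : coded A} {cB : coded B} (f g : A -> B) :
  computable f -> computable g -> re (fun a => f a = g a).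
Proof.
move=> Hf Hg; apply: eq_re (re_dec (decidable_eq (computable_enc Hf) (computable_enc Hg))).
by move=> a; split=> [/eqP H|->]; rewrite ?eqxx //; apply: enc_inj H.
Qed.

Lemma re_comp A B {cA : coded A} {cB : coded B} (P : B -> Prop) (f : A -> B) :
  re P -> computable f -> re (fun a => P (f a)).
Proof.
move=> [R HR PR] Hf; exists (fun a => R (f a)) => //.
apply: (decidable_comp (f := fun p : A * nat => (f p.1, p.2)) HR); cpt.
Qed.

Lemma re_comp2 A B C {cA : coded A} {cB : coded B} {cC : coded C}
    (P : B -> C -> Prop) (f : A -> B) (g : A -> C) :
  re (fun p : B * C => P p.1 p.2) -> computable f -> computable g ->
  re (fun a => P (f a) (g a)).
Proof.
move=> HP Hf Hg.
by apply: (re_comp (f := fun a => (f a, g a)) HP); cpt.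
Qed.

Lemma re_and A {cA : coded A} (P Q : A -> Prop) :
  re P -> re Q -> re (fun a => P a /\ Q a).
Proof.
move=> [R HR PR] [S HS QS].
exists (fun a y => R a (dec y : nat * nat).1 && S a (dec y : nat * nat).2).
  have D : computable (fun p : A * nat => dec p.2 : nat * nat).
    by apply: computable_dec; cpt.
  apply: decidable_and.
    by apply: (decidable_comp (f := fun p : A * nat => (p.1,
      (dec p.2 : nat * nat).1)) HR); cpt.
  by apply: (decidable_comp (f := fun p : A * nat => (p.1, (dec p.2 : nat * nat).2)) HS);
    cpt.
move=> a; rewrite PR QS; split=> [[[y Ry] [z Sz]]|[y /andP[Ry Sy]]].
  by exists (enc (y, z)); rewrite encK Ry.
by split; eexists; eassumption.
Qed.

Lemma re_or A {cA : coded A} (P Q : A -> Prop) :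
  re P -> re Q -> re (fun a => P a \/ Q a).
Proof.
move=> [R HR PR] [S HS QS]; exists (fun a y => R a y || S a y); first exact: decidable_or.
move=> a; rewrite PR QS; split=> [[[y Ry]|[y Sy]]|[y /orP[Ry|Sy]]].
- by exists y; rewrite Ry.
- by exists y; rewrite Sy orbT.
- by left; exists y.
- by right; exists y.
Qed.

Lemma re_ex A B {cA : coded A} {cB : coded B} (Q : A -> B -> Prop) :
  re (fun p : A * B => Q p.1 p.2) -> re (fun a => exists b, Q a b).
Proof.
move=> [R HR QR].
exists (fun a y => R (a, (dec y : B * nat).1) (dec y : B * nat).2).
  have D : computable (fun p : A * nat => dec p.2 : B * nat).
    by apply: computable_dec; cpt.
  by apply: (decidable_comp (f := fun p : A * nat =>
    ((p.1, (dec p.2 : B * nat).1), (dec p.2 : B * nat).2)) HR); cpt.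
move=> a; split=> [[b /(QR (a, b))[y Ry]]|[y Ry]].
  by exists (enc (b, y)); rewrite encK.
by exists (dec y : B * nat).1; apply/(QR (a, _)); exists (dec y : B * nat).2.
Qed.

(** The witnesses for all [i < e a] are gathered in one list, whose code is a single witness for the
    bounded quantification. *)
Lemma re_ball A {cA : coded A} (Q : A -> nat -> Prop) (e : A -> nat) :
  re (fun p : A * nat => Q p.1 p.2) -> computable e ->
  re (fun a => forall i, i < e a -> Q a i).
Proof.
move=> [R HR QR] He.
exists (fun a y => all (fun i => R (a, i) (nth 0 (dec y : seq nat) i)) (iota 0 (e a))).
  apply: (@decidable_all _ _ _ _ (fun (p : A * nat) i => R (p.1, i) (nth 0
    (dec p.2 : seq nat) i))); last by cpt.
  have D : computable (fun p : A * nat * nat => dec p.1.2 : seq nat).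
    by apply: computable_dec; cpt.
  by apply: (decidable_comp (f := fun p : A * nat * nat =>
    ((p.1.1, p.2), nth 0 (dec p.1.2 : seq nat) p.2)) HR); cpt.
move=> a; split=> [H|[y /allP H] i lt_ie]; last first.
  by apply/(QR (a, i)); eexists; apply: H; rewrite mem_iota.
have /choice[f Hf] i : exists y, i < e a -> R (a, i) y.
  case: (ltnP i (e a)) => [/H/(QR (a, i))[y Ry]|_]; last by exists 0.
  by exists y.
exists (enc (mkseq f (e a))); rewrite encK; apply/allP => i.
by rewrite mem_iota => /= lt_i; rewrite nth_mkseq //; apply: Hf.
Qed.

(** Post's theorem. The search for a witness of either side always stops, and since the two sides
    exclude each other, testing which one the least witness serves gives the answer. *)
Theorem re_coRe_decidable A {cA : coded A} (P : A -> Prop) :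
  re P -> re (fun a => ~ P a) ->
  exists2 b : A -> bool, decidable_pred b & forall a, b a <-> P a.
Proof.
move=> [R HR PR] [S HS PS].
have tot a : exists y, R a y || S a y.
  by case: (EM (P a)) => [/PR|/PS] [y Hy]; exists y; rewrite Hy ?orbT.
pose m a := ex_minn (tot a).
have Hm : computable m.
  pose RS := fun p : A * nat => ~~ (R p.1 p.2 || S p.1 p.2).
  have HRS : decidable_pred RS by apply/decidable_not/decidable_or.
  rewrite /computable.
  apply: (@recursive_mu 1 (fun y v => RS (dec (tnth v ord0) : A, y))).
  - move: HRS; rewrite /decidable_pred /computable => HRS.
    have H : recursive (fun v : 2.-tuple nat => (pr (tnth v (lift ord0 ord0))
      (tnth v ord0)).-1).
      apply: eq_recursive (recursive2_comp recursive2_sub (recursive2_comp recursive2_pr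
        (recursive_proj _) (recursive_proj _)) (recursive_const _ 1)) => v.
      by rewrite subn1.
    apply: eq_recursive (recursive1_comp HRS H) => v.
    rewrite /= /dec_pair prednK ?pr_gt0 // pr1K pr2K /=; congr (nat_of_bool (RS (dec _,
      _))).
    by rewrite !(tnth_nth 0) /= nth_behead.
  - by move=> v; rewrite /RS /m; case: ex_minnP => y ->.
  - move=> v i; rewrite /RS /m; case: ex_minnP => y _ ymin /= lt_iy.
    by rewrite eqb0 negbK; apply: contraTN lt_iy => /ymin; rewrite -leqNgt.
exists (fun a => R a (m a)).
  by apply: (decidable_comp (f := fun a => (a, m a)) HR); cpt.
move=> a; split=> [H|/[dup] Pa /PR[y Ry]]; first by apply/PR; exists (m a).
rewrite /m; case: ex_minnP => z /orP[//|Sz] _.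
by case: (iffRL (PS a)); first by exists z.
Qed.

(** * Inductively generated predicates *)

Section LeastFixpoint.
Context (A T : Type) {cA : coded A} {cT : coded T}.
Variables (R0 : A -> T -> Prop) (R2 : A -> T -> T -> T -> Prop).

(** Every rule has no premise or exactly two. This common form of derivability and of term formation
    lets a single enumerability proof serve both. *)
Inductive lfp (a : A) : T -> Prop :=
| lfp0 x : R0 a x -> lfp a x
| lfp2 x y z : lfp a x -> lfp a y -> R2 a x y z -> lfp a z.

Local Notation nthT := (nth (@dec T cT 0)).

(** A derivation is a list with its conclusion at the head, in which each entry is justified by
    later entries. Concatenating two derivations only shifts these indices. *)
Definition lfp_step a (l : seq T) i : Prop :=
  R0 a (nthT l i) \/ exists p : nat * nat,
    [&& i < p.1, i < p.2, p.1 < size l & p.2 < size l] /\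
    R2 a (nthT l p.1) (nthT l p.2) (nthT l i).

Lemma lfp_stepP a x :
  lfp a x <-> exists l, (0 < size l /\ nthT l 0 = x) /\
                        forall i, i < size l -> lfp_step a l i.
Proof.
split=> [|[l [[l_gt0 <-] Hl]]]; last first.
  suff K k i : i < size l -> size l - i <= k -> lfp a (nthT l i) by exact: K l_gt0
    (leqnn _).
  elim: k i => [|k IH] i lt_il; first by rewrite leqn0 subn_eq0 leqNgt lt_il.
  move=> le_k; case: (Hl _ lt_il) => [/lfp0 //|[[u v] /= [/and4P[iu iv ul vl]]]].
  by apply: lfp2; apply: IH => //; rewrite -ltnS (leq_trans _ le_k) // ltn_sub2l.
elim=> {x} [x Hx|x y z _ [l1 [[l1_gt0 <-] H1]] _ [l2 [[l2_gt0 <-] H2]] Hz].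
  by exists [:: x]; split=> // -[|//] _; left.
exists (z :: l1 ++ l2); split=> //=; rewrite size_cat.
case=> [_|i]; last rewrite ltnS => lt_i.
  right; exists (1, (size l1).+1) => /=; split.
    by rewrite size_cat !ltnS addn_gt0 l1_gt0 /= -{1}[size l1]addn0 ltn_add2l.
  by rewrite !nth_cat l1_gt0 ltnn subnn.
have E1 j : j < size l1 -> nthT (z :: l1 ++ l2) j.+1 = nthT l1 j by move=> /= h;
  rewrite nth_cat h.
have E2 j : nthT (z :: l1 ++ l2) (size l1 + j).+1 = nthT l2 j.
  by rewrite /= nth_cat ltnNge leq_addr /= addKn.
case: (ltnP i (size l1)) => [h|h].
  case: (H1 i h) => [?|[[u v] /= [/and4P[iu iv ul vl] ?]]]; first by left; rewrite E1.
  right; exists (u.+1, v.+1); rewrite /fst /snd !E1 //; split=> //.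
  by rewrite /= size_cat !ltnS iu iv !ltn_addr.
rewrite -(subnKC h) in lt_i *; move: (i - _) lt_i => {h}i; rewrite ltn_add2l => h.
case: (H2 i h) => [?|[[u v] /= [/and4P[iu iv ul vl] ?]]]; first by left; rewrite E2.
right; exists ((size l1 + u).+1, (size l1 + v).+1); rewrite /fst /snd !E2 //; split=> //.
by rewrite /= size_cat !ltnS !ltn_add2l iu iv ul.
Qed.

Lemma re_lfp :
  re (fun p : A * T => R0 p.1 p.2) ->
  re (fun p : A * (T * (T * T)) => R2 p.1 p.2.1 p.2.2.1 p.2.2.2) ->
  re (fun p : A * T => lfp p.1 p.2).
Proof.
move=> H0 H2; apply: (eq_re (fun p => iff_sym (lfp_stepP p.1 p.2))).
apply: re_ex; apply: re_and.
  apply: re_and; last by apply: re_eq; cpt.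
  by apply: re_dec; apply: decidable_leq; cpt.
apply: re_ball; last by cpt.
apply: re_or; first by apply: (re_comp2 H0); cpt.
apply: re_ex; apply: re_and.
  by apply: re_dec; do !apply: decidable_and; apply: decidable_leq; cpt.
apply: (re_comp (f := fun q : (A * T * seq T * nat) * (nat * nat) => (q.1.1.1.1,
  (nthT q.1.1.2 q.2.1, (nthT q.1.1.2 q.2.2, nthT q.1.1.2 q.1.2)))) H2); cpt.
Qed.

End LeastFixpoint.

(** * Equational derivations between ring terms *)

(** A constant is represented by a name of an element of the field, so that terms are finite data.
    There is no opposite; subtraction uses a name of -1. *)
Inductive term := TV of nat | TC of nat | TA of term & term | TM of term & term.

(** The residue modulo 4 records the constructor and the quotient its arguments; with the
    decremented pair code, every number is reached. *)
Fixpoint enc_term (t : term) : nat :=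
  match t with
  | TV x => 4 * x
  | TC a => 4 * a + 1
  | TA t u => 4 * (pr (enc_term t) (enc_term u)).-1 + 2
  | TM t u => 4 * (pr (enc_term t) (enc_term u)).-1 + 3
  end.

Fixpoint dec_term_rec (fuel c : nat) : term :=
  if fuel isn't fuel'.+1 then TV 0 else
  let q := c %/ 4 in
  let d1 := dec_term_rec fuel' (pr1 q.+1) in
  let d2 := dec_term_rec fuel' (pr2 q.+1) in
  match c %% 4 with
  | 0 => TV q
  | 1 => TC q
  | 2 => TA d1 d2
  | _ => TM d1 d2
  end.

Definition dec_term c := dec_term_rec c.+1 c.

Lemma dec_term_recK fuel c : c < fuel -> enc_term (dec_term_rec fuel c) = c.
Proof.
elim: fuel c => // fuel IH c lt_c /=.
have lt_q i : 0 < c %% 4 -> i <= c %/ 4 -> i < fuel.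
  move=> r_gt0 le_i; rewrite -ltnS (leq_trans _ lt_c) // ltnS (divn_eq c 4).
  by rewrite -[i.+1]addn1 leq_add // (leq_trans le_i) // leq_pmulr.
have E1 : pr1 (c %/ 4).+1 <= c %/ 4.
  by rewrite -ltnS -{2}(prK (ltn0Sn (c %/ 4))) ltn_pr1.
have E2 : pr2 (c %/ 4).+1 <= c %/ 4.
  by rewrite -ltnS -{2}(prK (ltn0Sn (c %/ 4))) ltn_pr2.
have lt4 := ltn_pmod c (isT : 0 < 4).
rewrite [RHS](divn_eq c 4) mulnC.
move: lt_q lt4; case: (c %% 4) => [|[|[|[|//]]]] lt_q _ /=; rewrite ?addn0 //;
  by rewrite !IH ?lt_q // prK.
Qed.

Lemma dec_termK : cancel dec_term enc_term.
Proof. by move=> c; apply: dec_term_recK. Qed.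

Lemma dec_term_rec_enc t fuel : enc_term t < fuel -> dec_term_rec fuel (enc_term t) = t.
Proof.
have mod4 q r : r < 4 -> (4 * q + r) %% 4 = r.
  by move=> h; rewrite mulnC modnMDl modn_small.
have div4 q r : r < 4 -> (4 * q + r) %/ 4 = q.
  by move=> h; rewrite mulnC divnMDl // divn_small // addn0.
have lt4 q r fuel' e : 4 * q.-1 + r < fuel'.+1 -> 0 < r -> e < q -> e < fuel'.
  case: q => // q; rewrite !ltnS /= => le_f r_gt0 le_e.
  rewrite (leq_trans _ le_f) // -[e.+1]addn1 leq_add // (leq_trans le_e) //.
  exact: leq_pmull.
elim: t fuel => [x|a|t1 IH1 t2 IH2|t1 IH1 t2 IH2] [//|fuel]; rewrite [enc_term _]/=.
- by move=> _ /=; rewrite -[4 * x]addn0 mod4 // div4.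
- by move=> _ /=; rewrite mod4 // div4.
- move: (enc_term t1) (enc_term t2) IH1 IH2 => e1 e2 IH1 IH2.
  set q := pr e1 e2 => lt_f; rewrite /= mod4 // div4 // prednK ?pr_gt0 // /q pr1K pr2K.
  by rewrite IH1 ?IH2 //; apply: lt4 lt_f _ _ => //; [apply: ltn_pr2 | apply: ltn_pr1].
- move: (enc_term t1) (enc_term t2) IH1 IH2 => e1 e2 IH1 IH2.
  set q := pr e1 e2 => lt_f; rewrite /= mod4 // div4 // prednK ?pr_gt0 // /q pr1K pr2K.
  by rewrite IH1 ?IH2 //; apply: lt4 lt_f _ _ => //; [apply: ltn_pr2 | apply: ltn_pr1].
Qed.

Lemma enc_termK : cancel enc_term dec_term.
Proof. by move=> t; apply: dec_term_rec_enc. Qed.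

#[global] Instance coded_term : coded term := Coded enc_termK dec_termK.

HB.instance Definition _ := Countable.copy term (can_type enc_termK).

Section ComputableTerm.
Context (A : Type) {cA : coded A}.

Lemma computable_TV (f : A -> nat) : computable f -> computable (fun a => TV (f a)).
Proof. exact: (computable_mul (f := fun=> 4) (computable_const 4)). Qed.

Lemma computable_TC (f : A -> nat) : computable f -> computable (fun a => TC (f a)).
Proof.
move=> Hf; exact: (computable_add (f := fun a => 4 * f a) (g := fun=> 1)
  (computable_mul (f := fun=> 4) (computable_const 4) Hf) (computable_const 1)).
Qed.

Lemma computable_pr_pred (f g : A -> term) r : computable f -> computable g ->
  computable (fun a => 4 * (pr (enc_term (f a)) (enc_term (g a))).-1 + r).
Proof.
move=> Hf Hg.
apply: (computable_add (g := fun=> r)); last exact: computable_const.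
apply: (computable_mul (f := fun=> 4)); first exact: computable_const.
exact: (computable_enc (computable_pair Hf Hg)).
Qed.

Lemma computable_TA (f g : A -> term) :
  computable f -> computable g -> computable (fun a => TA (f a) (g a)).
Proof. exact: computable_pr_pred. Qed.

Lemma computable_TM (f g : A -> term) :
  computable f -> computable g -> computable (fun a => TM (f a) (g a)).
Proof. exact: computable_pr_pred. Qed.

End ComputableTerm.

Ltac cpt_term :=
  match goal with
  | |- computable (fun a => TV (@?f a)) => apply (computable_TV (f := f))
  | |- computable (fun a => TC (@?f a)) => apply (computable_TC (f := f))
  | |- computable (fun a => TA (@?f a) (@?g a)) => apply (computable_TA (f := f) (g := g))
  | |- computable (fun a => TM (@?f a) (@?g a)) => apply (computable_TM (f := f) (g := g))
  end.

Ltac cpt_ext ::= first [cpt_seq | cpt_term].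

Local Open Scope ring_scope.
Local Open Scope quotient_scope.

Section Derivation.
Variables (k : fieldType) (nu : nat -> k) (name : k -> nat).
Hypothesis nameK : cancel name nu.

(** [name] will come from choice and need not be computable. This is harmless: the programs contain
    only the three fixed numbers naming 0, 1 and -1, while all other names are found by search. *)
Definition Tconst (x : k) := TC (name x).
Definition Tsub (t u : term) := TA t (TM (Tconst (-1)) u).

(** Reflexivity and the axioms of commutative rings at given terms; as a finite list, they make
    being an instance a decidable membership. *)
Definition ring_identities (t u w : term) : seq (term * term) :=
  [:: (t, t); (TA t u, TA u t); (TA t (TA u w), TA (TA t u) w);
      (TA (Tconst 0) t, t); (Tsub t t, Tconst 0);
      (TM t u, TM u t); (TM t (TM u w), TM (TM t u) w); (TM (Tconst 1) t, t);
      (TM t (TA u w), TA (TM t u) (TM t w))].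

(** [S] holds the terms assumed to be zero. The last two cases are the addition and multiplication
    tables of the field, where the result may bear any of its names. *)
Definition der_start (S : term -> Prop) (p : term * term) : Prop :=
  [\/ S p.1 /\ p.2 = Tconst 0,
      exists w : term * (term * term), p \in ring_identities w.1 w.2.1 w.2.2,
      exists c : nat * (nat * nat), nu c.1 + nu c.2.1 == nu c.2.2 /\
        p = (TA (TC c.1) (TC c.2.1), TC c.2.2) |
      exists c : nat * (nat * nat), nu c.1 * nu c.2.1 == nu c.2.2 /\
        p = (TM (TC c.1) (TC c.2.1), TC c.2.2)].

(* The first rule, together with reflexivity, gives symmetry and transitivity. *)
Definition der_step (S : term -> Prop) (p q r : term * term) : Prop :=
  [\/ p.1 = q.1 /\ r = (p.2, q.2), r = (TA p.1 q.1, TA p.2 q.2) |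
      r = (TM p.1 q.1, TM p.2 q.2)].

Definition der S t u := lfp der_start der_step S (t, u).

Section Rules.
Variable S : term -> Prop.

Lemma der_ax t : S t -> der S t (Tconst 0).
Proof. by move=> St; apply/lfp0/Or41. Qed.

Lemma der_identity t u w p : p \in ring_identities t u w -> der S p.1 p.2.
Proof. by move=> Hp; apply/lfp0/Or42; exists (t, (u, w)); case: p Hp. Qed.

Lemma der_refl t : der S t t.
Proof. by apply: (@der_identity t t t (t, t)); rewrite inE eqxx. Qed.

Lemma der_euclid t u w : der S t u -> der S t w -> der S u w.
Proof. by move=> tu tw; apply: (lfp2 tu tw); apply: Or31. Qed.

Lemma der_sym t u : der S t u -> der S u t.
Proof. by move=> tu; apply: der_euclid tu (der_refl t). Qed.

Lemma der_trans t u w : der S t u -> der S u w -> der S t w.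
Proof. by move=> /der_sym; apply: der_euclid. Qed.

Lemma der_TA t t' u u' : der S t t' -> der S u u' -> der S (TA t u) (TA t' u').
Proof. by move=> tt uu; apply: (lfp2 tt uu); apply: Or32. Qed.

Lemma der_TM t t' u u' : der S t t' -> der S u u' -> der S (TM t u) (TM t' u').
Proof. by move=> tt uu; apply: (lfp2 tt uu); apply: Or33. Qed.

Lemma der_addC a b : der S (TA (TC a) (TC b)) (Tconst (nu a + nu b)).
Proof. by apply/lfp0/Or43; exists (a, (b, name (nu a + nu b))); rewrite nameK. Qed.

Lemma der_mulC a b : der S (TM (TC a) (TC b)) (Tconst (nu a * nu b)).
Proof. by apply/lfp0/Or44; exists (a, (b, name (nu a * nu b))); rewrite nameK. Qed.

(** Different numbers may name one element. No rule identifies them directly, but the addition table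
    contains [0 + nu a = nu b]. *)
Lemma der_TC a b : nu a = nu b -> der S (TC a) (TC b).
Proof.
move=> ab; have H : der S (TA (Tconst 0) (TC a)) (TC b).
  by apply/lfp0/Or43; exists (name 0, (a, b)); rewrite nameK add0r ab.
apply: der_euclid H.
by apply: (@der_identity (TC a) (TC a) (TC a) (TA (Tconst 0) (TC a), TC a));
  rewrite !inE eqxx !orbT.
Qed.

End Rules.

Lemma der_ind2 (S : term -> Prop) (P : term -> term -> Prop) :
  (forall t, S t -> P t (Tconst 0)) ->
  (forall t u w p, p \in ring_identities t u w -> P p.1 p.2) ->
  (forall a b c, nu a + nu b = nu c -> P (TA (TC a) (TC b)) (TC c)) ->
  (forall a b c, nu a * nu b = nu c -> P (TM (TC a) (TC b)) (TC c)) ->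
  (forall t u w, der S t u -> P t u -> der S t w -> P t w -> P u w) ->
  (forall t t' u u', der S t t' -> P t t' -> der S u u' -> P u u' ->
     P (TA t u) (TA t' u') /\ P (TM t u) (TM t' u')) ->
  forall t u, der S t u -> P t u.
Proof.
move=> Hax Hid Hadd Hmul Heuc Hcong t u.
rewrite /der -[t in P t]/(t, u).1 -[u in P _ u]/(t, u).2.
elim=> {t u} [p|[t u] [t' u'] r /= H1 IH1 H2 IH2].
  case=> [[Sp ->]|[[t [u w]]]|[[a [b c]] [/eqP E ->]]|[[a [b c]] [/eqP E ->]]].
  - exact: Hax.
  - exact: Hid.
  - exact: Hadd.
  - exact: Hmul.
case=> /= [[E ->]|->|->] /=.
- by subst t'; apply: Heuc IH1 _ IH2.
- by have [] := Hcong _ _ _ _ H1 IH1 H2 IH2.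
- by have [] := Hcong _ _ _ _ H1 IH1 H2 IH2.
Qed.

Lemma der_sub (S S' : term -> Prop) t u :
  (forall w, S w -> S' w) -> der S t u -> der S' t u.
Proof.
move=> SS'; move: t u; apply: der_ind2 => [t St|t u w p Hp|*|*|*|*].
- exact/der_ax/SS'.
- exact: der_identity Hp.
- by apply: der_trans (der_addC _ _ _) _; apply: der_TC; rewrite nameK.
- by apply: der_trans (der_mulC _ _ _) _; apply: der_TC; rewrite nameK.
- by apply: der_euclid; eassumption.
- by split; [apply: der_TA | apply: der_TM].
Qed.

Lemma re_der : computable_numbering nu ->
  re (fun p : seq term * (term * term) => der (fun t => t \in p.1) p.2.1 p.2.2).
Proof.
case=> _ [ceq Heq] [cadd Hadd] _ [cmul Hmul] _.
(* The given programs return some name of the result; the equality program then compares it with the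
   name proposed in the table. *)
have D op : (exists c : recfun 2, forall a b, exists2 y, eval c [tuple a; b] y & nu y = op
  (nu a) (nu b)) ->
    re (fun p : nat * (nat * nat) => op (nu p.1) (nu p.2.1) == nu p.2.2).
  case=> c Hc.
  have /choice[f Hf] (p : nat * nat) : exists y, eval c [tuple p.1; p.2] y /\ nu y = op
    (nu p.1) (nu p.2).
    by have [y] := Hc p.1 p.2; exists y.
  have T2 (v : 2.-tuple nat) : v = [tuple tnth v ord0; tnth v (lift ord0 ord0)].
    by apply: eq_from_tnth => -[[|[|//]]] h; rewrite !(tnth_nth 0%N).
  have Rf : recursive2 (fun a b => f (a, b)).
    by exists c => v; have [] := Hf (tnth v ord0, tnth v (lift ord0 ord0));
      rewrite /= -(T2 v).
  have Re : recursive2 (fun a b => nu a == nu b).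
    by exists ceq => v; have := Heq (tnth v ord0) (tnth v (lift ord0 ord0));
      rewrite -(T2 v).
  have H : decidable_pred (fun p : nat * (nat * nat) => nu (f (p.1, p.2.1)) == nu p.2.2).
    apply: (computable_rec2 (g := fun a b => nu a == nu b) Re); last by cpt.
    by apply: (computable_rec2 (g := fun a b => f (a, b)) Rf); cpt.
  by apply: eq_re (re_dec H) => p; have [_ ->] := Hf (p.1, p.2.1).
(* The parameter of [lfp] has to be coded, so the set of zero terms is passed as a list. *)
have E (p : seq term * (term * term)) :
    lfp (fun l : seq term => der_start (fun t => t \in l))
        (fun l => der_step (fun t => t \in l)) p.1 p.2 <->
    der (fun t => t \in p.1) p.2.1 p.2.2.
  case: p => l [t u] /=; rewrite /der; split; elim=> [x|x y z _ IHx _ IHy].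
  - exact: lfp0.
  - exact: lfp2.
  - by move=> h; apply: lfp0.
  - by move=> h; apply: lfp2 IHx IHy h.
apply: eq_re E _; apply: re_lfp.
  apply: (@eq_re _ _ (fun p : seq term * (term * term) =>
    (p.2.1 \in p.1 /\ p.2.2 = Tconst 0) \/
    (exists w : term * (term * term), p.2 \in ring_identities w.1 w.2.1 w.2.2) \/
    (exists c : nat * (nat * nat), nu c.1 + nu c.2.1 == nu c.2.2 /\
      p.2 = (TA (TC c.1) (TC c.2.1), TC c.2.2)) \/
    (exists c : nat * (nat * nat), nu c.1 * nu c.2.1 == nu c.2.2 /\
      p.2 = (TM (TC c.1) (TC c.2.1), TC c.2.2)))).
    move=> p; split=> [[?|[?|[?|?]]]|[?|?|?|?]].
    - exact: Or41.
    - exact: Or42.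
    - exact: Or43.
    - exact: Or44.
    - by left.
    - by right; left.
    - by do 2!right; left.
    - by do 3!right.
  apply: re_or; [|apply: re_or; [|apply: re_or]].
  - by apply: re_and; [apply: re_dec; apply: decidable_mem; cpt | apply: re_eq; cpt].
  - apply: re_ex; apply: re_dec; apply: decidable_mem; first by cpt.
    by rewrite /ring_identities /Tsub /Tconst; cpt.
  - apply: re_ex; apply: re_and; last by apply: re_eq; cpt.
    by apply: (re_comp (f := fun q : (seq term * (term * term)) * (nat * (nat * nat)) =>
      q.2) (D +%R (ex_intro _ cadd Hadd))); cpt.
  - apply: re_ex; apply: re_and; last by apply: re_eq; cpt.
    by apply: (re_comp (f := fun q : (seq term * (term * term)) * (nat * (nat * nat)) =>
      q.2) (D *%R (ex_intro _ cmul Hmul))); cpt.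
apply: (@eq_re _ _ (fun p : seq term * ((term * term) * ((term * term) * (term * term))) =>
  (p.2.1.1 = p.2.2.1.1 /\ p.2.2.2 = (p.2.1.2, p.2.2.1.2)) \/
  p.2.2.2 = (TA p.2.1.1 p.2.2.1.1, TA p.2.1.2 p.2.2.1.2) \/
  p.2.2.2 = (TM p.2.1.1 p.2.2.1.1, TM p.2.1.2 p.2.2.1.2))).
  move=> p; split=> [[?|[?|?]]|[?|?|?]].
  - exact: Or31.
  - exact: Or32.
  - exact: Or33.
  - by left.
  - by right; left.
  - by do 2!right.
apply: re_or; [|apply: re_or]; try apply: re_and; by apply: re_eq; cpt.
Qed.

Fixpoint ev (R : pzRingType) (c : nat -> R) (v : nat -> R) (t : term) : R :=
  match t with
  | TV x => v x
  | TC a => c a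
  | TA t u => ev c v t + ev c v u
  | TM t u => ev c v t * ev c v u
  end.

Section Soundness.
Variables (R : comPzRingType) (f : {rmorphism k -> R}) (v : nat -> R).
Local Notation evf := (ev (f \o nu) v).

Lemma ev_const x : evf (Tconst x) = f x.
Proof. by rewrite /= nameK. Qed.

Lemma ev_sub t u : evf (Tsub t u) = evf t - evf u.
Proof. by rewrite /= nameK rmorphN1 mulN1r. Qed.

Lemma der_sound (S : term -> Prop) t u :
  (forall w, S w -> evf w = 0) -> der S t u -> evf t = evf u.
Proof.
move=> S0; move: t u; apply: der_ind2.
- by move=> t St; rewrite ev_const rmorph0 S0.
- move=> t u w p; rewrite !inE.
  do 8?[case/orP]; move=> /eqP -> {p};
    rewrite [LHS]/= [RHS]/= ?nameK ?rmorph0 ?rmorph1 ?rmorphN1 //.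
  + exact: addrC.
  + exact: addrA.
  + exact: add0r.
  + by rewrite mulN1r subrr.
  + exact: mulrC.
  + exact: mulrA.
  + exact: mul1r.
  + exact: mulrDr.
- by move=> a b c /= <-; rewrite rmorphD.
- by move=> a b c /= <-; rewrite rmorphM.
- by move=> t u w _ -> _ ->.
- by move=> t t' u u' _ E _ E'; rewrite /= E E'.
Qed.

End Soundness.

(** * The ring of terms modulo derivable equality *)

Section TermRing.
Variable S : term -> Prop.

Definition derb (t u : term) : bool := `[< der S t u >].

Lemma derb_refl : reflexive derb.
Proof. by move=> t; apply/asboolP/der_refl. Qed.
Lemma derb_sym : symmetric derb.
Proof. by move=> t u; apply/asboolP/asboolP; apply: der_sym. Qed.
Lemma derb_trans : transitive derb.
Proof. by move=> t u w /asboolP ut /asboolP tw; apply/asboolP/(der_trans ut). Qed.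

Canonical derb_equiv := EquivRel derb derb_refl derb_sym derb_trans.

(** This is the polynomial algebra over the field in countably many variables modulo the ideal
    generated by [S]; it may be the zero ring. *)
Definition term_ring : Type := {eq_quot derb_equiv}.
HB.instance Definition _ := Choice.on term_ring.
HB.instance Definition _ := EqQuotient.on term_ring.

Definition cls (t : term) : term_ring := \pi_term_ring t.

Lemma cls_eq t u : cls t = cls u <-> der S t u.
Proof. by split=> [/eqP|H]; last apply/eqP; rewrite eqmodE => *; apply/asboolP. Qed.

Lemma clsP (x : term_ring) : exists t, x = cls t.
Proof. by exists (repr x); rewrite /cls reprK. Qed.

Definition tr_add (x y : term_ring) := cls (TA (repr x) (repr y)).
Definition tr_mul (x y : term_ring) := cls (TM (repr x) (repr y)).
Definition tr_opp (x : term_ring) := cls (TM (Tconst (-1)) (repr x)).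

Lemma der_repr t : der S (repr (cls t)) t.
Proof. by apply/cls_eq; rewrite /cls reprK. Qed.

Lemma cls_add t u : tr_add (cls t) (cls u) = cls (TA t u).
Proof. by apply/cls_eq/der_TA; apply: der_repr. Qed.
Lemma cls_mul t u : tr_mul (cls t) (cls u) = cls (TM t u).
Proof. by apply/cls_eq/der_TM; apply: der_repr. Qed.
Lemma cls_opp t : tr_opp (cls t) = cls (TM (Tconst (-1)) t).
Proof. by apply/cls_eq/der_TM; [apply: der_refl | apply: der_repr]. Qed.

Lemma cls_identity t u w p : p \in ring_identities t u w -> cls p.1 = cls p.2.
Proof. by move=> /der_identity H; apply/cls_eq. Qed.

Ltac tr_identity t u w :=
  rewrite ?cls_opp ?(cls_add, cls_mul);
  match goal with |- cls ?a = cls ?b =>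
    apply: (@cls_identity t u w (a, b)); rewrite !inE eqxx ?orbT //
  end.

Lemma tr_addC : commutative tr_add.
Proof. by move=> x y; have [[t ->] [u ->]] := (clsP x, clsP y); tr_identity t u t. Qed.
Lemma tr_addA : associative tr_add.
Proof.
move=> x y z; have [[[t ->] [u ->]] [w ->]] := (clsP x, clsP y, clsP z).
by tr_identity t u w.
Qed.
Lemma tr_add0 : left_id (cls (Tconst 0)) tr_add.
Proof. by move=> x; have [t ->] := clsP x; tr_identity t t t. Qed.
Lemma tr_addN : left_inverse (cls (Tconst 0)) tr_opp tr_add.
Proof. by move=> x; have [t ->] := clsP x; rewrite tr_addC; tr_identity t t t. Qed.

HB.instance Definition _ := GRing.isZmodule.Build term_ring tr_addA tr_addC tr_add0 tr_addN.

Lemma tr_mulC : commutative tr_mul.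
Proof. by move=> x y; have [[t ->] [u ->]] := (clsP x, clsP y); tr_identity t u t. Qed.
Lemma tr_mulA : associative tr_mul.
Proof.
move=> x y z; have [[[t ->] [u ->]] [w ->]] := (clsP x, clsP y, clsP z).
by tr_identity t u w.
Qed.
Lemma tr_mul1 : left_id (cls (Tconst 1)) tr_mul.
Proof. by move=> x; have [t ->] := clsP x; tr_identity t t t. Qed.
Lemma tr_mulDl : left_distributive tr_mul +%R.
Proof.
move=> x y z; have [[[t ->] [u ->]] [w ->]] := (clsP x, clsP y, clsP z).
rewrite [in LHS]tr_mulC [tr_mul (cls t) _]tr_mulC [tr_mul (cls u) _]tr_mulC.
by rewrite /GRing.add /=; tr_identity w t u.
Qed.

HB.instance Definition _ := GRing.Zmodule_isComPzRing.Build term_ring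
  tr_mulA tr_mulC tr_mul1 tr_mulDl.

Definition tr_const (x : k) : term_ring := cls (Tconst x).

Lemma tr_const_add : {morph tr_const : x y / x + y}.
Proof.
move=> x y; rewrite [RHS]cls_add; apply/cls_eq/der_sym.
by apply: der_trans (der_addC _ _ _) _; apply: der_TC; rewrite !nameK.
Qed.
Lemma tr_const_mul : {morph tr_const : x y / x * y}.
Proof.
move=> x y; rewrite [RHS]cls_mul; apply/cls_eq/der_sym.
by apply: der_trans (der_mulC _ _ _) _; apply: der_TC; rewrite !nameK.
Qed.

Lemma tr_const_zmod : zmod_morphism tr_const.
Proof.
move=> x y; apply: (addIr (tr_const y)).
by rewrite -tr_const_add !subrK.
Qed.
Lemma tr_const_monoid : monoid_morphism tr_const.
Proof. by split=> //; apply: tr_const_mul. Qed.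

(** The classes of the variables form the tautological point of the quotient, at which a term takes
    its own class as value. *)
Lemma ev_cls t : ev (tr_const \o nu) (cls \o TV) t = cls t.
Proof.
elim: t => [x|a|t IHt u IHu|t IHt u IHu] //=.
- by apply/cls_eq/der_TC; rewrite nameK.
- by rewrite IHt IHu [LHS]cls_add.
- by rewrite IHt IHu [LHS]cls_mul.
Qed.

End TermRing.

End Derivation.

(** * Certificates for systems of equations *)

Fixpoint term_over (X : seq nat) (t : term) : bool :=
  match t with
  | TV x => x \in X
  | TC _ => true
  | TA t u | TM t u => term_over X t && term_over X u
  end.

(** Enumerability suffices for certificates and follows from [lfp], which spares a recursion on
    codes of terms. *)
Lemma re_over : re (fun p : seq nat * term => term_over p.1 p.2).
Proof.
pose R0 (X : seq nat) t := exists x, (x \in X /\ t = TV x) \/ t = TC x.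
pose R2 (X : seq nat) t u w := w = TA t u \/ w = TM t u.
have E (p : seq nat * term) : lfp R0 R2 p.1 p.2 <-> term_over p.1 p.2.
  case: p => X t /=; split.
    elim=> [u [x [[xX ->]|->]]|t1 t2 u _ o1 _ o2 [->|->]] //=; exact/andP.
  elim: t => [x xX|a _|t IHt u IHu /andP[/IHt ot /IHu ou]|t IHt u IHu /andP[/IHt ot /IHu ou]].
  - by apply: lfp0; exists x; left.
  - by apply: lfp0; exists a; right.
  - by apply: (lfp2 ot ou); left.
  - by apply: (lfp2 ot ou); right.
apply: eq_re E _; apply: re_lfp.
  apply: re_ex; apply: re_or; last by apply: re_eq; cpt.
  by apply: re_and; [apply: re_dec; apply: decidable_mem; cpt | apply: re_eq; cpt].
by apply: re_or; apply: re_eq; cpt.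
Qed.

Lemma ev_over (R : pzRingType) (c : nat -> R) v w X t :
  {in X, v =1 w} -> term_over X t -> ev c v t = ev c w t.
Proof.
move=> vw; elim: t => [x|a|t IHt u IHu|t IHt u IHu] //=; first exact: vw.
  by case/andP => /IHt -> /IHu ->.
by case/andP => /IHt -> /IHu ->.
Qed.

Lemma term_over_sub X Y t : {subset X <= Y} -> term_over X t -> term_over Y t.
Proof.
move=> XY; elim: t => [x|a|t IHt u IHu|t IHt u IHu] //=; first exact: XY.
  by case/andP => /IHt -> /IHu ->.
by case/andP => /IHt -> /IHu ->.
Qed.

Section Certificates.
Variables (k : fieldType) (nu : nat -> k) (name : k -> nat).
Hypothesis nameK : cancel name nu.

Local Notation der := (der nu name).
Local Notation Tconst := (Tconst name).

(** Horner form: [cs] lists the coefficients below the leading 1 in ascending order, so the degree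
    is [size cs] and the empty list gives the constant 1. *)
Definition monic_term (y : nat) (cs : seq term) : term :=
  foldr (fun c t => TA c (TM (TV y) t)) (Tconst 1) cs.

Lemma computable_monic_term A {cA : coded A} (y : A -> nat) (cs : A -> seq term) :
  computable y -> computable cs -> computable (fun a => monic_term (y a) (cs a)).
Proof.
move=> Hy Hcs; apply: (computable_foldr (g := fun a c t => TA c (TM (TV (y a)) t))
  (b := fun=> Tconst 1)); cpt.
Qed.

Lemma term_over_monic X y cs :
  y \in X -> all (term_over X) cs -> term_over X (monic_term y cs).
Proof. by move=> yX; elim: cs => //= c cs IH /andP[-> /IH ->]; rewrite yX. Qed.

Lemma ev_monic_term (R : comNzRingType) (f : {rmorphism k -> R}) v y cs :
  ev (f \o nu) v (monic_term y cs) =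
  (Poly (rcons [seq ev (f \o nu) v c | c <- cs] 1)).[v y].
Proof.
rewrite horner_Poly; elim: cs => /= [|c cs ->]; first by rewrite nameK rmorph1 mul0r add0r.
by rewrite addrC mulrC.
Qed.

(** With [hs] empty the certificate is a derivation of 1 = 0, which covers unsolvable systems. *)
Definition finite_certificate (S : seq term) : Prop :=
  exists hs : seq nat, der (fun t => t \in S) (monic_term 0 (map TC hs)) (Tconst 0).

(* The variable 0 is free and the variable [H] is the inverse of a monic
   polynomial in it; a step [(y, cs)] makes [y] a root of the monic polynomial
   with coefficients [cs], terms in the variables of the later steps of the list. *)
Definition tower : Type := (nat * seq nat) * seq (nat * seq term).

Definition tower_vars (H : nat) (st : seq (nat * seq term)) : seq nat :=
  map fst st ++ [:: H; 0%N].

(** Positive degree provides a root at each step, and freshness of the variable ensures that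
    choosing this root leaves the equations of the later entries satisfied. *)
Fixpoint tower_wf (H : nat) (st : seq (nat * seq term)) : bool :=
  if st is p :: st' then
    [&& p.1 \notin tower_vars H st', (0 < size p.2)%N,
        all (term_over (tower_vars H st')) p.2 & tower_wf H st']
  else H != 0%N.

Definition tower_axioms (th : tower) : seq term :=
  TA (TM (monic_term 0 (map TC th.1.2)) (TV th.1.1)) (Tconst (-1))
  :: [seq monic_term p.1 p.2 | p <- th.2].

Definition infinite_certificate (S : seq term) : Prop :=
  exists th : tower, tower_wf th.1.1 th.2 /\
    forall t, t \in S -> der (fun u => u \in tower_axioms th) t (Tconst 0).

Section Enumerability.
Hypothesis nu_computable : computable_numbering nu.

Lemma computable_map_TC A {cA : coded A} (l : A -> seq nat) :
  computable l -> computable (fun a => map TC (l a)).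
Proof. by move=> Hl; apply: (computable_map (f := fun _ x => TC x)); cpt. Qed.

Lemma re_finite_certificate : re finite_certificate.
Proof.
apply: re_ex; apply: (re_comp (f := fun p : seq term * seq nat =>
  (p.1, (monic_term 0 (map TC p.2), Tconst 0))) (re_der name nu_computable)).
apply: computable_pair; first by cpt.
apply: computable_pair; last by cpt.
by apply: computable_monic_term; [|apply: computable_map_TC]; cpt.
Qed.

Lemma computable_drop A B {cA : coded A} {cB : coded B} (e : A -> nat) (l : A -> seq B) :
  computable e -> computable l -> computable (fun a => drop (e a) (l a)).
Proof.
move=> He Hl.
have D : computable (fun a => dec (coded_drop (e a) (enc (l a))) : seq B).
  exact/computable_dec/computable_coded_drop/computable_enc.
by apply: eq_computable D => a; rewrite coded_dropE encK.
Qed.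

Lemma computable_tower_vars A {cA : coded A} (H : A -> nat) (st : A -> seq
  (nat * seq term)) :
  computable H -> computable st -> computable (fun a => tower_vars (H a) (st a)).
Proof.
move=> HH Hst; apply: computable_cat; last by cpt.
by apply: (computable_map (f := fun _ p => p.1)); cpt.
Qed.

Local Notation d0 := (dec 0 : nat * seq term).

(** The recursion is unrolled into bounded quantifiers, to which [re_ball] applies. *)
Lemma tower_wfE H st : tower_wf H st <->
  H != 0%N /\ forall i, (i < size st)%N ->
    [/\ (nth d0 st i).1 \notin tower_vars H (drop i.+1 st),
        (0 < size (nth d0 st i).2)%N &
        forall j, (j < size (nth d0 st i).2)%N ->
          term_over (tower_vars H (drop i.+1 st)) (nth (dec 0) (nth d0 st i).2 j)].
Proof.
elim: st => [|p st IH]; first by split=> [|[]].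
split=> [/= /and4P[py p2 /allP po /IH[H0 Hst]]|[H0 Hst]].
  split=> // -[_|i /Hst //]; rewrite /= drop0; split=> // j lt_j.
  exact/po/mem_nth.
have [/= h1 h2 h3] := Hst 0%N isT; rewrite drop0 in h1 h3.
rewrite h1 h2 /=; apply/andP; split; first exact/(all_nthP (dec 0)).
by apply/IH; split=> // i /(Hst i.+1).
Qed.

Lemma re_tower_wf : re (fun th : tower => tower_wf th.1.1 th.2).
Proof.
apply: eq_re (fun th => iff_sym (tower_wfE th.1.1 th.2)) _.
apply: re_and.
  by apply/re_dec/decidable_not/decidable_eq; cpt.
apply: re_ball; last by cpt.
apply: (@eq_re _ _ (fun p : tower * nat =>
  ((nth d0 p.1.2 p.2).1 \notin tower_vars p.1.1.1 (drop p.2.+1 p.1.2) /\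
   (0 < size (nth d0 p.1.2 p.2).2)%N) /\
  forall j, (j < size (nth d0 p.1.2 p.2).2)%N ->
    term_over (tower_vars p.1.1.1 (drop p.2.+1 p.1.2)) (nth (dec 0)
      (nth d0 p.1.2 p.2).2 j))).
  by move=> p; split=> [[[]]|[]].
have tv : computable (fun p : tower * nat => tower_vars p.1.1.1 (drop p.2.+1 p.1.2)).
  by apply: computable_tower_vars; [|apply: computable_drop]; rewrite /tower; cpt.
apply: re_and; first apply: re_and.
- by apply/re_dec/decidable_not/decidable_mem => //; rewrite /tower; cpt.
- by apply/re_dec/(decidable_leq (f := fun=> 1%N)); rewrite /tower; cpt.
apply: re_ball; last by rewrite /tower; cpt.
apply: (re_comp2 (P := fun X t => term_over X t)
  (f := fun p : tower * nat * nat => tower_vars p.1.1.1.1 (drop p.1.2.+1 p.1.1.2)) re_over).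
  by apply: (computable_comp (f := fun p : tower * nat * nat => p.1) tv); cpt.
by rewrite /tower; cpt.
Qed.

Lemma re_infinite_certificate : re infinite_certificate.
Proof.
have cax : computable tower_axioms.
  rewrite /tower_axioms /tower.
  apply: (computable_cons (f := fun th : tower => TA (TM (monic_term 0 (map TC th.1.2))
    (TV th.1.1)) (Tconst (-1)))
     (l := fun th : tower => [seq monic_term p.1 p.2 | p <- th.2])).
    apply: computable_TA; last by cpt.
    apply: computable_TM; last by rewrite /tower; cpt.
    by apply: computable_monic_term; [|apply: computable_map_TC]; rewrite /tower; cpt.
  apply: (computable_map (f := fun _ p => monic_term p.1 p.2)); last by rewrite /tower; cpt.
  by apply: computable_monic_term; rewrite /tower; cpt.
apply: (@eq_re _ _ (fun S => exists th : tower, tower_wf th.1.1 th.2 /\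
  forall i, (i < size S)%N ->
    der (fun u => u \in tower_axioms th) (nth (dec 0) S i) (Tconst 0))).
  move=> S; split=> [] [th [wf H]]; exists th; split=> //.
    by move=> t tS; rewrite -(nth_index (dec 0) tS); apply: H; rewrite index_mem.
  by move=> i lt_i; apply/H/mem_nth.
apply: re_ex; apply: re_and.
  by apply: (re_comp (f := fun p : seq term * tower => p.2) re_tower_wf); cpt.
apply: re_ball; last by cpt.
apply: (re_comp (f := fun p : seq term * tower * nat =>
  (tower_axioms p.1.2, (nth (dec 0) p.1.1 p.2, Tconst 0))) (re_der name nu_computable)).
by rewrite /tower; cpt.
Qed.

End Enumerability.

(** * Soundness of the certificates over an algebraically closed field *)

Section CertificateSoundness.
Variables (K : closedFieldType) (f : {rmorphism k -> K}).
Local Notation evK := (ev (f \o nu)).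

Definition solutions (S : seq term) : set (nat -> K) :=
  [set v | forall t, t \in S -> evK v t = 0].

Definition values0 (S : seq term) : set K :=
  [set v 0%N | v in solutions S].

Lemma finite_roots (p : {poly K}) : p != 0 -> finite_set [set x | root p x].
Proof.
move=> p0; have [rs Hrs] := closed_field_poly_normal p.
apply: (sub_finite_set (B := [set` rs])); last exact: finite_seq.
move=> x /=; rewrite {1}Hrs rootZ ?lead_coef_eq0 // root_prod_XsubC.
by [].
Qed.

Lemma infinite_closed_field : infinite_set [set: K]%classic.
Proof.
move=> /finite_seqP[rs Hrs].
pose p : {poly K} := \prod_(z <- rs) ('X - z%:P) + 1.
have sp : (1 < size p)%N.
  have rs0 : (0 < size rs)%N.
    have : [set: K]%classic 0 by [].
    by rewrite Hrs /=; case: (rs).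
  by rewrite size_addl ?size_prod_XsubC // size_poly1.
have [|x] := closed_rootP p _; first by rewrite gtn_eqF.
have : [set: K]%classic x by [].
rewrite Hrs /= => xrs; rewrite /root hornerD hornerC.
have /rootP -> : root (\prod_(z <- rs) ('X - z%:P)) x by rewrite root_prod_XsubC.
by rewrite add0r oner_eq0.
Qed.

Lemma monic_poly_rcons (s : seq K) :
  size (Poly (rcons s 1)) = (size s).+1 /\ Poly (rcons s 1) != 0.
Proof.
have E : size (Poly (rcons s 1)) = (size s).+1.
  by rewrite (@PolyK _ 0) ?size_rcons // last_rcons oner_eq0.
by split=> //; rewrite -size_poly_eq0 E.
Qed.

Lemma finite_certificate_sound S : finite_certificate S -> finite_set (values0 S).
Proof.
case=> hs Hder.
pose p := Poly (rcons [seq f (nu a) | a <- hs] 1).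
apply: (sub_finite_set (B := [set x | root p x])).
  move=> _ [v Sv <-] /=; apply/rootP.
  have := der_sound nameK Sv Hder; rewrite ev_monic_term ev_const // rmorph0.
  by rewrite -map_comp.
by apply: finite_roots; case: (monic_poly_rcons [seq f (nu a) | a <- hs]).
Qed.

(** The variable [H] takes the inverse of the value of the polynomial at [x]; then the steps are
    solved from the end of the list, each by a root in [K]. The valuation is changed at a fresh
    variable only, so [ev_over] preserves the equations already solved. *)
Lemma tower_solvable (th : tower) (x : K) : tower_wf th.1.1 th.2 ->
  (Poly (rcons [seq f (nu a) | a <- th.1.2] 1)).[x] != 0 ->
  exists2 v, solutions (tower_axioms th) v & v 0%N = x.
Proof.
case: th => [[H hs] st] /=; set h := Poly _ => wf hx.
have [H0 E] : H != 0%N /\ tower_vars H [::] = [:: H; 0%N].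
  by split=> //; elim: st wf => //= p st IH /and4P[].
suff [v [v0 vH vst]] : exists v, [/\ v 0%N = x, v H = h.[x]^-1 &
    forall p, p \in st -> evK v (monic_term p.1 p.2) = 0].
  exists v => // t; rewrite inE => /predU1P[->|/mapP[p pst ->]]; last exact: vst.
  rewrite /= ev_monic_term v0 vH nameK rmorphN1 -map_comp /= -/h.
  by rewrite mulfV ?subrr.
elim: st wf => [|p st IH] /=.
  by move=> _; exists (fun y => if y == H then h.[x]^-1 else x); rewrite eqxx eq_sym
    (negPf H0).
case/and4P => py p2 po wf; have [v [v0 vH vst]] := IH wf.
pose q := Poly (rcons [seq evK v c | c <- p.2] 1).
have [sq _] := monic_poly_rcons [seq evK v c | c <- p.2].
have [|z qz] := closed_rootP q _; first by rewrite sq size_map eqSS -lt0n.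
pose w y := if y == p.1 then z else v y.
have vw : {in tower_vars H st, w =1 v}.
  by move=> y yst; rewrite /w; case: eqP yst py => [->|//] ->.
have st_wf : forall r, r \in st -> term_over (tower_vars H st) (monic_term r.1 r.2).
  elim: (st) wf => //= r s IHs /and4P[ry r2 ro rwf] r'; rewrite inE => /predU1P[->|].
    apply: term_over_monic; first by rewrite /tower_vars /= inE eqxx.
    by apply: sub_all ro => t; apply: term_over_sub => y;
      rewrite /tower_vars /= inE orbC => ->.
  by move=> /(IHs rwf); apply: term_over_sub => y; rewrite /tower_vars /= inE orbC => ->.
exists w; split.
- by rewrite vw // mem_cat !inE eqxx !orbT.
- by rewrite vw // mem_cat !inE eqxx !orbT.
move=> r; rewrite inE => /predU1P[->|rst]; last by rewrite (ev_over _ vw) ?vst ?st_wf.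
rewrite ev_monic_term; have -> : [seq evK w c | c <- p.2] = [seq evK v c | c <- p.2].
  by apply/eq_in_map => c /(allP po); apply: ev_over vw.
by rewrite {1}/w eqxx; apply/rootP.
Qed.

(** Each element of [K] is a root of the inverted polynomial or a value of the variable 0 at a
    solution. The roots are finitely many and [K] is infinite. *)
Lemma infinite_certificate_sound S : infinite_certificate S -> ~ finite_set (values0 S).
Proof.
case=> th [wf Hder] fin; apply: infinite_closed_field.
pose h := Poly (rcons [seq f (nu a) | a <- th.1.2] 1).
have [_ h0] := monic_poly_rcons [seq f (nu a) | a <- th.1.2].
have := finite_roots h0; rewrite -/h => fr.
suff -> : [set: K]%classic =
  ([set x | root h x] `|` values0 S)%classic by rewrite finite_setU.
apply/seteqP; split=> // x _ /=.
case: (boolP (root h x)) => [?|hx]; [by left | right].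
have [v Sv vx] := tower_solvable wf hx.
exists v => // t tS; have := der_sound nameK Sv (Hder t tS).
by rewrite ev_const // rmorph0.
Qed.

End CertificateSoundness.

End Certificates.

(** * A generic point of a system with no finiteness certificate *)

Section GenericPoint.
Variables (k : fieldType) (nu : nat -> k) (name : k -> nat).
Hypothesis nameK : cancel name nu.

Local Notation der := (der nu name).
Local Notation Tconst := (Tconst name).

(** The term ring is repackaged as a ring with [1 != 0], known only through its evaluation and its
    equality. *)
Lemma term_ring_nontrivial (M : term -> Prop) : ~ der M (Tconst 1) (Tconst 0) ->
  exists (L : comNzRingType) (f : {rmorphism k -> L}) (x : nat -> L) (pi : term -> L),
    [/\ forall t, ev (f \o nu) x t = pi t,
        forall t u, pi t = pi u <-> der M t u &
        forall z, exists t, z = pi t].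
Proof.
move=> n10; have h10 : (1 : term_ring nu name M) != 0.
  by apply/eqP => /cls_eq.
pose L : comNzRingType := HB.pack (term_ring nu name M)
  (GRing.PzSemiRing_isNonZero.Build (term_ring nu name M) h10).
pose f : {rmorphism k -> L} := HB.pack (tr_const nu name M : k -> L)
  (GRing.isZmodMorphism.Build k L (tr_const nu name M) (tr_const_zmod nameK M))
  (GRing.isMonoidMorphism.Build k L (tr_const nu name M) (tr_const_monoid nameK M)).
exists L, f, (cls nu name M \o TV), (cls nu name M).
by split; [apply: (ev_cls nameK M) | apply: cls_eq | apply: clsP].
Qed.

(** Completeness of equational logic: the term ring is a model in which exactly the derivable
    equations hold. If it is zero, 1 = 0 is derivable and every equation follows. *)
Lemma der_complete (M : term -> Prop) t :
  (forall (C : comNzRingType) (f : {rmorphism k -> C}) (v : nat -> C),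
    (forall u, M u -> ev (f \o nu) v u = 0) -> ev (f \o nu) v t = 0) ->
  der M t (Tconst 0).
Proof.
move=> H; case: (EM (der M (Tconst 1) (Tconst 0))) => [triv|/term_ring_nontrivial].
  apply/(cls_eq nu name M); have /(cls_eq nu name M) E := triv.
  rewrite -[LHS](@mul1r (term_ring nu name M)).
  by rewrite (E : (1 : term_ring nu name M) = 0) mul0r.
case=> L [f [x [pi [evE piE _]]]]; apply/piE; rewrite -!evE ev_const // rmorph0.
apply: H => u Mu; rewrite evE -(rmorph0 f) -(ev_const nameK f x) evE.
exact/piE/der_ax.
Qed.

(** Deriving with one more axiom [s] amounts to computing modulo the principal ideal of [s]; the
    multiplier is built along the derivation. *)
Lemma der_deduction (M : term -> Prop) s t u :
  der (fun w => M w \/ w = s) t u ->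
  exists w : term_ring nu name M, cls nu name M t = cls nu name M u + w * cls nu name M s.
Proof.
have cong (R : comPzRingType) (a a' b b' c x y : R) : a = a' + x * c -> b = b' + y * c ->
    a + b = a' + b' + (x + y) * c /\
    a * b = a' * b' + (a' * y + x * b' + x * y * c) * c.
  by move=> -> ->; split; ring.
have eqv t' u' : der M t' u' -> exists w : term_ring nu name M,
  cls nu name M t' = cls nu name M u' + w * cls nu name M s.
  by move=> /(cls_eq nu name M) ->; exists 0; rewrite mul0r addr0.
move: t u; apply: der_ind2.
- move=> t [Mt|->]; first exact/eqv/der_ax.
  by exists 1; rewrite mul1r -[cls _ _ _ (Tconst 0)]/(0 : term_ring nu name M) add0r.
- by move=> t u w p Hp; apply: eqv; apply: der_identity Hp.
- by move=> a b c E; apply: eqv; apply: der_trans (der_addC nameK _ _ _) _; apply: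
  (der_TC nameK); rewrite nameK.
- by move=> a b c E; apply: eqv; apply: der_trans (der_mulC nameK _ _ _) _; apply:
  (der_TC nameK); rewrite nameK.
- move=> t u w _ [x E1] _ [y E2]; exists (y - x).
  by rewrite mulrBl addrA -E2 E1 addrK.
- move=> t t' u u' _ [x E1] _ [y E2].
  have [EA EM] := cong _ _ _ _ _ _ _ _ E1 E2.
  split; [exists (x + y) | exists
    (cls nu name M t' * y + x * cls nu name M u' + x * y * cls nu name M s)].
    by move: EA; rewrite -!(cls_add nu name M).
  by move: EM; rewrite -!(cls_mul nu name M).
Qed.

(** A derivation uses finitely many axioms, and those taken from the union of a chain all lie in one
    member. The empty set is allowed because the chain may be empty. *)
Lemma der_chain (S : term -> Prop) (F : set (set term)) t u :
  total_on F subset ->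
  der (fun w => S w \/ (\bigcup_(X in F) X)%classic w) t u ->
  exists2 X : set term, F X \/ X = set0 & der (fun w => S w \/ X w) t u.
Proof.
move=> totF; move: t u.
have sub (X Y : set term) t u : (X `<=` Y)%classic ->
    der (fun w => S w \/ X w) t u -> der (fun w => S w \/ Y w) t u.
  by move=> XY; apply: der_sub => // w [?|/XY]; [left | right].
have merge t u t' u' :
    (exists2 X : set term, F X \/ X = set0 & der (fun w => S w \/ X w) t u) ->
    (exists2 X : set term, F X \/ X = set0 & der (fun w => S w \/ X w) t' u') ->
    exists2 X : set term, F X \/ X = set0 &
      der (fun w => S w \/ X w) t u /\ der (fun w => S w \/ X w) t' u'.
  move=> [X [FX|->] HX] [Y [FY|->] HY].
  - have [XY|YX] := totF _ _ FX FY.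
      by exists Y; [left | split=> //; apply: sub HX].
    by exists X; [left | split=> //; apply: sub HY].
  - by exists X; [left | split=> //; apply: sub HY].
  - by exists Y; [left | split=> //; apply: sub HX].
  - by exists set0; [right | split].
have eqv t u : (forall X : term -> Prop, der X t u) ->
    exists2 X : set term, F X \/ X = set0 & der (fun w => S w \/ X w) t u.
  by move=> H; exists set0; [right|].
apply: der_ind2.
- move=> t [St|[X FX Xt]].
    by exists set0; [right | apply: der_ax; left].
  by exists X; [left | apply: der_ax; right].
- by move=> t u w p Hp; apply: eqv => X; apply: der_identity Hp.
- by move=> a b c E; apply: eqv => X; apply: der_trans (der_addC nameK _ _ _) _; apply:
  (der_TC nameK); rewrite nameK.
- by move=> a b c E; apply: eqv => X; apply: der_trans (der_mulC nameK _ _ _) _; apply: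
  (der_TC nameK); rewrite nameK.
- move=> t u w _ H1 _ H2; have [X FX [D1 D2]] := merge _ _ _ _ H1 H2.
  by exists X => //; apply: der_euclid D2.
- move=> t t' u u' _ H1 _ H2; have [X FX [D1 D2]] := merge _ _ _ _ H1 H2.
  by split; exists X => //; [apply: der_TA | apply: der_TM].
Qed.

Lemma monic_rcons (R : nzRingType) (p : {poly R}) : p \is monic ->
  exists s, p = Poly (rcons s 1).
Proof.
move=> /monicP lp; exists (take (size p).-1 p).
have p_gt0 : (0 < size p)%N.
  by rewrite size_poly_gt0; apply/eqP => p0; move: lp; rewrite p0 lead_coef0 => /eqP;
    rewrite eq_sym oner_eq0.
rewrite -[in LHS](polyseqK p); congr Poly.
rewrite -{1}(cat_take_drop (size p).-1 p) -cats1; congr (_ ++ _).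
by rewrite (drop_nth 0) ?prednK // drop_oversize ?prednK // -[_`__]/(lead_coef p) lp.
Qed.

Lemma map_Poly (R R' : nzRingType) (f : {rmorphism R -> R'}) (s : seq R) :
  map_poly f (Poly s) = Poly (map f s).
Proof.
elim: s => [|c s IH] /=; first by rewrite rmorph0.
by rewrite !cons_poly_def rmorphD rmorphM /= map_polyX map_polyC IH.
Qed.

Lemma ev_monic_names (R : comNzRingType) (f : {rmorphism k -> R}) (v : nat -> R) hs :
  ev (f \o nu) v (monic_term name 0 (map TC hs)) =
  (map_poly f (Poly (rcons (map nu hs) 1))).[v 0%N].
Proof.
rewrite ev_monic_term // map_Poly map_rcons rmorph1 -!map_comp.
by [].
Qed.

(** An ideal maximal among those avoiding a multiplicative set is prime. Each nonzero element of the
    quotient divides the value of a monic polynomial at the variable 0; if two such elements had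
    product 0, the product of their monic polynomials would vanish there. *)
Lemma generic_point (S : seq term) : ~ finite_certificate nu name S ->
  exists (L : comNzRingType) (f : {rmorphism k -> L}) (x : nat -> L),
    [/\ forall a b : L, a * b = 0 -> a = 0 \/ b = 0,
        forall t, t \in S -> ev (f \o nu) x t = 0 &
        forall p : {poly k}, p \is monic -> (map_poly f p).[x 0%N] != 0].
Proof.
move=> nofin.
pose mon hs := monic_term name 0 (map TC hs).
pose with_S (X : set term) w := w \in S \/ X w.
pose P (X : set term) := forall hs, ~ der (with_S X) (mon hs) (Tconst 0).
have [F FP totF|X [PX maxX]] := @Zorn_bigcup term P.
  move=> hs /(der_chain totF)[Y [/FP PY|->]]; first exact: PY.
  (* With no axiom taken from the chain, the derivation is itself a finiteness certificate. *)
  by move=> H; apply: nofin; exists hs; apply: der_sub H => // w [].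
pose M := with_S X.
have [|L [f [x [pi [evE piE piS]]]]] := @term_ring_nontrivial M.
  (* The empty list of coefficients stands for the polynomial 1, so the term ring is not zero. *)
  exact: (PX [::]).
have pi0 : pi (Tconst 0) = 0 by rewrite -evE ev_const // rmorph0.
have piM t u : pi (TM t u) = pi t * pi u by rewrite -!evE.
have piA t u : pi (TA t u) = pi t + pi u by rewrite -!evE.
have trans p : p \is monic -> (map_poly f p).[x 0%N] != 0.
  move=> /monic_rcons[s ->]; apply/eqP => E.
  apply: (PX (map name s)); apply/piE; rewrite pi0 -evE ev_monic_names.
  by rewrite -map_comp (eq_map nameK) map_id.
exists L, f, x; split=> //; last first.
  by move=> t tS; rewrite evE -pi0; apply/piE/der_ax; left.
(* By maximality, adding [a] as an axiom makes some monic equation derivable; the deduction lemma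
   turns this into divisibility by [a]. *)
have mult a : a != 0 -> exists2 p : {poly k}, p \is monic & exists w,
  (map_poly f p).[x 0%N] = w * a.
  have [t ->] := piS a => t0.
  have Xt : ~ X t by move=> Xt; case/eqP: t0; rewrite -pi0; apply/piE/der_ax; right.
  have /maxX PXt : (X `<` (X `|` [set t]))%classic.
    by split=> [u|/(_ t) H]; [left | apply/Xt/H; right].
  have {PXt} [hs Hhs] : exists hs, der (with_S (X `|` [set t])%classic) (mon hs) (Tconst 0).
    by apply: contra_notP PXt => H hs Hhs; apply: H; exists hs.
  have {Hhs} : der (fun w => M w \/ w = t) (mon hs) (Tconst 0).
    by apply: der_sub Hhs => // w [wS|[Xw|->]]; [left; left | left; right | right].
  case/der_deduction=> z; have [w ->] := clsP z => E.
  exists (Poly (rcons (map nu hs) 1)).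
    by rewrite monicE lead_coefE
      (@PolyK _ 0) ?size_rcons ?last_rcons ?oner_eq0 // nth_rcons ltnn eqxx.
  exists (pi w); rewrite -ev_monic_names evE -piM -[RHS]add0r -pi0 -piA.
  apply/piE/(cls_eq nu name M); rewrite E -!cls_add -!cls_mul.
  by [].
move=> a b ab0; case: (eqVneq a 0) => [|/mult[p mp [w Ew]]]; first by left.
case: (eqVneq b 0) => [|/mult[q mq [z Ez]]]; first by right.
have := trans _ (rpredM mp mq).
by rewrite rmorphM hornerM Ew Ez mulrACA ab0 mulr0 eqxx.
Qed.

End GenericPoint.

(** * Construction of a tower from a generic point *)

(** The subring becomes a ring type of its own, over which polynomials in the next variable can be
    formed. *)
Record subring_of (L : comNzRingType) (S : subringClosed L) : Type :=
  SubringOf { subring_val :> L; _ : subring_val \in S }.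

Section SubringOf.
Variables (L : comNzRingType) (S : subringClosed L).
HB.instance Definition _ := [isSub for @subring_val L S].
HB.instance Definition _ := [Choice of subring_of S by <:].
HB.instance Definition _ := [SubChoice_isSubComNzRing of subring_of S by <:].
End SubringOf.

Section ValueRing.
Variables (k : fieldType) (nu : nat -> k) (name : k -> nat).
Hypothesis nameK : cancel name nu.
Variables (L : comNzRingType) (f : {rmorphism k -> L}) (x : nat -> L) (X : seq nat).
Local Notation evL := (ev (f \o nu) x).

Definition is_value : {pred L} := fun z => `[< exists t, term_over X t /\ z = evL t >].

Lemma is_value_subring : subring_closed is_value.
Proof.
split; first by apply/asboolP; exists (Tconst name 1); rewrite ev_const ?rmorph1.
- move=> a b /asboolP[t [ot ->]] /asboolP[u [ou ->]]; apply/asboolP.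
  by exists (Tsub name t u); rewrite ev_sub //= ot ou.
- move=> a b /asboolP[t [ot ->]] /asboolP[u [ou ->]]; apply/asboolP.
  by exists (TM t u); rewrite /= ot ou.
Qed.

(* The subring of L of values of the terms over X, with its homomorphisms into
   the models of the zero relations between these terms. *)
Lemma value_ring : exists (V : comNzRingType) (j : {rmorphism V -> L}) (to : term -> V)
    (tm : V -> term),
  [/\ injective j,
      forall t, term_over X t -> j (to t) = evL t,
      forall z, term_over X (tm z) /\ evL (tm z) = j z &
      forall (C : comNzRingType) (g : {rmorphism k -> C}) (v : nat -> C),
        (forall t, term_over X t -> evL t = 0 -> ev (g \o nu) v t = 0) ->
        exists phi : {rmorphism V -> C},
          (forall t, term_over X t -> phi (to t) = ev (g \o nu) v t) /\
          (forall z, phi z = ev (g \o nu) v (tm z))].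
Proof.
pose S : subringClosed L := HB.pack is_value
  (GRing.isSubringClosed.Build L is_value is_value_subring).
pose V : comNzRingType := subring_of S.
pose j : {rmorphism V -> L} := val.
have ofP (z : V) : exists t, term_over X t /\ evL t = j z.
  by case: z => z /= /asboolP[t [ot ->]]; exists t.
have toP t : exists z : V, term_over X t -> j z = evL t.
  case: (boolP (term_over X t)) => [ot|_]; last by exists 0.
  have tS : evL t \in S by apply/asboolP; exists t.
  by exists (SubringOf tS).
have [of_ ofE] := choice ofP; have [to toE] := choice toP.
have jinj : injective j by apply: val_inj.
exists V, j, to, of_; split=> // C g v zero.
have zeroE t u : term_over X t -> term_over X u -> evL t = evL u ->
    ev (g \o nu) v t = ev (g \o nu) v u.
  move=> ot ou E; apply/eqP; rewrite -subr_eq0 -(ev_sub nameK); apply/eqP/zero.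
    by rewrite /= ot ou.
  by rewrite ev_sub // E subrr.
pose phi (z : V) : C := ev (g \o nu) v (of_ z).
have phiE t z : term_over X t -> evL t = j z -> phi z = ev (g \o nu) v t.
  by move=> ot E; apply: zeroE => //; have [] := ofE z => // _ ->.
have phi_zmod : zmod_morphism phi.
  move=> a b; have [[oa Ea] [ob Eb]] := (ofE a, ofE b).
  rewrite -(ev_sub nameK); apply: phiE; first by rewrite /= oa ob.
  by rewrite ev_sub // Ea Eb rmorphB.
have phi_monoid : monoid_morphism phi.
  split=> [|a b].
    by rewrite (phiE (Tconst name 1)) ?ev_const ?rmorph1.
  have [[oa Ea] [ob Eb]] := (ofE a, ofE b).
  rewrite -[RHS]/(ev (g \o nu) v (TM (of_ a) (of_ b))); apply: phiE.
    by rewrite /= oa ob.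
  by rewrite rmorphM -Ea -Eb.
pose phiM : {rmorphism V -> C} := HB.pack phi
  (GRing.isZmodMorphism.Build V C phi phi_zmod)
  (GRing.isMonoidMorphism.Build V C phi phi_monoid).
exists phiM; split=> // t ot; apply: phiE => //; exact/esym/toE.
Qed.

End ValueRing.

(** * Algebraic elements over a domain, without fractions *)

Definition no_zero_divisors (R : comNzRingType) : Prop :=
  forall a b : R, a * b = 0 -> a = 0 \/ b = 0.

Section AlgebraicElement.
Variables (V L : comNzRingType) (E : {rmorphism {poly V} -> L}).
Hypotheses (domV : no_zero_divisors V) (domL : no_zero_divisors L).
Hypothesis Einj : forall c : V, E c%:P = 0 -> c = 0.

Lemma domain_mulf_neq0 (R : comNzRingType) (a b : R) :
  no_zero_divisors R -> a != 0 -> b != 0 -> a * b != 0.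
Proof. by move=> dom a0 b0; apply/eqP => /dom[] /eqP; apply/negP. Qed.

Lemma domain_exp_neq0 (a : V) m : a != 0 -> a ^+ m != 0.
Proof.
move=> a0; elim: m => [|m IH]; rewrite ?expr0 ?oner_eq0 // exprS.
exact: domain_mulf_neq0.
Qed.

Lemma size_domain_scale (a : V) (p : {poly V}) : a != 0 -> size (a *: p) = size p.
Proof.
move=> a0; case: (eqVneq p 0) => [->|p0]; first by rewrite scaler0.
rewrite -mul_polyC size_proper_mul ?size_polyC ?a0 //.
by rewrite lead_coefC; apply: domain_mulf_neq0 => //; rewrite lead_coef_eq0.
Qed.

Lemma E_scale (a : V) p : E (a *: p) = E a%:P * E p.
Proof. by rewrite -mul_polyC rmorphM. Qed.

Lemma E_polyC_neq0 (c : V) : c != 0 -> E c%:P != 0.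
Proof. by move=> c0; apply/eqP => /Einj /eqP; apply/negP. Qed.

(** The leading coefficient of [q] need not be invertible in [V]; a power of it is multiplied into
    [p] instead. *)
Lemma pseudo_division (p q : {poly V}) : q != 0 ->
  exists (s : nat) (Q S : {poly V}),
    lead_coef q ^+ s *: p = Q * q + S /\ (size S < size q)%N.
Proof.
move=> q0; exists (Pdiv.CommonRing.rscalp p q), (Pdiv.CommonRing.rdivp p q).
exists (Pdiv.CommonRing.rmodp p q); split; first exact: Pdiv.ComRing.rdivp_eq.
exact: Pdiv.CommonRing.ltn_rmodpN0.
Qed.

Lemma minimal_annihilator : (exists2 q : {poly V}, q != 0 & E q = 0) ->
  exists q : {poly V}, [/\ q != 0, E q = 0 &
    forall p, p != 0 -> E p = 0 -> (size q <= size p)%N].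
Proof.
move=> [q0 q0_neq0 Eq0].
pose P m := `[< exists q : {poly V}, [/\ q != 0, E q = 0 & size q = m] >].
have exP : exists m, P m by exists (size q0); apply/asboolP; exists q0.
case: (ex_minnP exP) => m /asboolP[q [qn Eq <-]] qmin.
by exists q; split=> // p pn Ep; apply: qmin; apply/asboolP; exists p.
Qed.

Section Minimal.
Variable q : {poly V}.
Hypotheses (q_neq0 : q != 0) (Eq0 : E q = 0).
Hypothesis qmin : forall p, p != 0 -> E p = 0 -> (size q <= size p)%N.

Lemma size_minimal_annihilator : (1 < size q)%N.
Proof.
rewrite ltnNge; apply/negP => /size1_polyC Eqc.
move: Eq0 q_neq0; rewrite Eqc => /Einj ->.
by rewrite polyC0 eqxx.
Qed.

(** The pseudo-remainder also annihilates, and it is too short to be nonzero. This replaces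
    divisibility by the minimal polynomial. *)
Lemma annihilator_pseudo_dvd p : E p = 0 ->
  exists (s : nat) (Q : {poly V}), lead_coef q ^+ s *: p = Q * q.
Proof.
move=> Ep; have [s [Q [S [eqS ltS]]]] := pseudo_division p q_neq0.
exists s, Q; suff -> : Q * q = Q * q + S by [].
suff -> : S = 0 by rewrite addr0.
apply/eqP; apply: contraTT ltS => S0; rewrite -leqNgt qmin //.
have := congr1 E eqS; rewrite E_scale Ep mulr0 rmorphD rmorphM Eq0 mulr0 add0r.
by move=> <-.
Qed.

(** A fraction-free Bezout identity: inverting [r] makes the value of [b] invertible. Among the
    combinations of [b] and [q] not annihilated by [E], take a shortest one, [R]; it is shorter than
    [q]. If it had positive degree, pseudo-dividing [q] by it would leave an annihilated remainder,
    so the quotient would be annihilated too, although it is shorter than [q]. *)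
Lemma pseudo_inverse b : E b != 0 ->
  exists (r : V) (u w : {poly V}), r != 0 /\ r%:P = u * b + w * q.
Proof.
move=> Eb.
pose P m := `[< exists (R u w : {poly V}),
  [/\ R = u * b + w * q, E R != 0 & size R = m] >].
have exP : exists m, P m.
  by exists (size b); apply/asboolP; exists b, 1, 0; rewrite mul1r mul0r addr0.
case: (ex_minnP exP) => m /asboolP[R [u [w [defR ER <-]]]] Rmin {exP}.
have {}Rmin S u' w' : S = u' * b + w' * q -> (size S < size R)%N -> E S = 0.
  move=> defS; apply: contraTeq => ES; rewrite -leqNgt Rmin //.
  by apply/asboolP; exists S, u', w'.
have R0 : R != 0 by apply: contraNneq ER => ->; rewrite rmorph0.
have lR0 : lead_coef R != 0 by rewrite lead_coef_eq0.
have lq0 : lead_coef q != 0 by rewrite lead_coef_eq0.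
have ltRq : (size R < size q)%N.
  rewrite ltnNge; apply/negP => le_qR.
  have [s [Q [S [eqS ltS]]]] := pseudo_division R q_neq0.
  have ES : E S = 0.
    apply: (Rmin S (lead_coef q ^+ s *: u) (lead_coef q ^+ s *: w - Q)).
      rewrite -!scalerAl mulrBl addrA -!scalerAl -scalerDr -defR eqS.
      by rewrite addrC addKr.
    exact: leq_trans ltS le_qR.
  have := congr1 E eqS; rewrite E_scale rmorphD rmorphM Eq0 mulr0 ES addr0 => /eqP.
  by apply/negP/domain_mulf_neq0 => //; apply/E_polyC_neq0/domain_exp_neq0.
have [s [Q [S [eqS ltS]]]] := pseudo_division q R0.
case: (ltnP 1 (size R)) => [R1|]; last first.
  move=> /size1_polyC defRc; exists R`_0, u, w; rewrite -defRc; split=> //.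
  by apply: contraNneq R0 => c0; rewrite defRc c0 polyC0.
have ES : E S = 0.
  apply: (Rmin S (- Q * u) ((lead_coef R ^+ s)%:P - Q * w)) => //.
  rewrite mulrBl mul_polyC eqS {1}defR !mulNr !mulrDr !mulrA.
  by ring.
have Q0 : Q != 0.
  apply/eqP => Q0; have := congr1 (fun p : {poly V} => size p) eqS.
  rewrite Q0 mul0r add0r size_domain_scale ?domain_exp_neq0 // => E1.
  by have := ltn_trans ltS ltRq; rewrite E1 ltnn.
have EQ : E Q = 0.
  have := congr1 E eqS; rewrite E_scale Eq0 mulr0 rmorphD rmorphM ES addr0 =>
    /esym/domL[//|] /eqP.
  by rewrite (negPf ER).
have sQR : size (Q * R) = (size Q + size R).-1.
  by rewrite size_proper_mul // domain_mulf_neq0 // lead_coef_eq0.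
have le_RQR : (size R <= size (Q * R)%R)%N.
  rewrite sQR; move: Q0; rewrite -size_poly_gt0; case: (size Q) => // d _.
  by rewrite addSn /= leq_addl.
have := congr1 (fun p : {poly V} => size p) eqS.
rewrite size_domain_scale ?domain_exp_neq0 // size_polyDl ?(leq_trans ltS) // sQR.
move=> sq; have := qmin Q0 EQ; rewrite sq.
move: R1; case: (size R) => [|[|d]] // _.
by rewrite addnS /= addnS ltnNge leq_addr.
Qed.

End Minimal.
End AlgebraicElement.

Lemma polyseq_rcons (R : nzRingType) (p : {poly R}) : p != 0 ->
  polyseq p = rcons (take (size p).-1 p) (lead_coef p).
Proof.
rewrite -size_poly_gt0 => p_gt0.
rewrite -{1}(cat_take_drop (size p).-1 p) -cats1; congr (_ ++ _).
by rewrite (drop_nth 0) ?prednK // drop_oversize ?prednK.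
Qed.

Lemma polyC_mul_Poly (R : comNzRingType) (c : R) (s : seq R) :
  c%:P * Poly s = Poly [seq c * a | a <- s].
Proof.
elim: s => [|a s IH] /=; first by rewrite mulr0.
by rewrite !cons_poly_def mulrDr mulrA IH polyCM.
Qed.

(** * Induction on the variables of the tower *)

Section TowerConstruction.
Variables (k : fieldType) (nu : nat -> k) (name : k -> nat).
Hypothesis nameK : cancel name nu.
Variables (L : comNzRingType) (f : {rmorphism k -> L}) (x : nat -> L).
Hypothesis domL : no_zero_divisors L.
Hypothesis x0_transcendental :
  forall p : {poly k}, p \is monic -> (map_poly f p).[x 0%N] != 0.
Variable H : nat.
Hypothesis H_neq0 : H != 0%N.

Local Notation evL := (ev (f \o nu) x).
Local Notation Tconst := (Tconst name).

Definition models (C : comNzRingType) (g : {rmorphism k -> C}) (v : nat -> C)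
    (th : tower) : Prop :=
  forall u, u \in tower_axioms name th -> ev (g \o nu) v u = 0.

(** The induction invariant. Besides satisfying all relations of the generic point over [Y], every
    model must invert a prescribed [b]: the next variable needs this to make its equation monic.
    Models range over all nonzero commutative rings so that completeness applies at the end. *)
Definition good_tower (Y : seq nat) (b : term) (hs : seq nat)
    (st : seq (nat * seq term)) : Prop :=
  [/\ tower_wf H st, map fst st = Y,
      forall (C : comNzRingType) (g : {rmorphism k -> C}) v, models g v ((H, hs), st) ->
        forall t, term_over (Y ++ [:: 0%N]) t -> evL t = 0 -> ev (g \o nu) v t = 0 &
      exists b', term_over (tower_vars H st) b' /\
        forall (C : comNzRingType) (g : {rmorphism k -> C}) v, models g v ((H, hs), st) ->
          ev (g \o nu) v b * ev (g \o nu) v b' = 1].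

Lemma term_poly0 t : term_over [:: 0%N] t -> exists p : {poly k},
  forall (C : comNzRingType) (g : {rmorphism k -> C}) v,
    ev (g \o nu) v t = (map_poly g p).[v 0%N].
Proof.
elim: t => [z|a|t IHt u IHu|t IHt u IHu] /=.
- by rewrite inE => /eqP ->; exists 'X => C g v; rewrite map_polyX hornerX.
- by move=> _; exists (nu a)%:P => C g v; rewrite map_polyC hornerC.
- case/andP => /IHt[p Hp] /IHu[q Hq]; exists (p + q) => C g v.
  by rewrite Hp Hq rmorphD hornerD.
- case/andP => /IHt[p Hp] /IHu[q Hq]; exists (p * q) => C g v.
  by rewrite Hp Hq rmorphM hornerM.
Qed.

Lemma map_poly_x0_eq0 (p : {poly k}) : (map_poly f p).[x 0%N] = 0 -> p = 0.
Proof.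
move=> E; apply/eqP; apply: contra_eqT E => p0.
have lp0 : lead_coef p != 0 by rewrite lead_coef_eq0.
have : ((lead_coef p)^-1 *: p) \is monic by rewrite monicE lead_coefZ mulVf.
move/x0_transcendental; rewrite map_polyZ hornerZ.
by apply: contraNN => /eqP ->; rewrite mulr0.
Qed.

(** Only here is anything localized: [b] is a nonzero polynomial in the free variable, and [H]
    inverts its monic multiple. Relations in that variable alone are trivial because it is
    transcendental. *)
Lemma good_tower_nil b : term_over [:: 0%N] b -> evL b != 0 ->
  exists hs, good_tower [::] b hs [::].
Proof.
move=> /term_poly0[p Hp]; rewrite Hp => p0.
have {}p0 : p != 0 by apply: contraNneq p0 => ->; rewrite rmorph0 horner0.
have lp0 : lead_coef p != 0 by rewrite lead_coef_eq0.
have [s Es] : exists s, (lead_coef p)^-1 *: p = Poly (rcons s 1).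
  by apply: monic_rcons; rewrite monicE lead_coefZ mulVf.
exists (map name s); split=> //.
  move=> C g v _ t /term_poly0[q Hq]; rewrite !Hq => /map_poly_x0_eq0 ->.
  by rewrite rmorph0 horner0.
exists (TM (Tconst (lead_coef p)^-1) (TV H)); split.
  by rewrite /= inE eqxx.
move=> C g v mod; have := mod _ (mem_head _ _).
rewrite /= !nameK rmorphN1 (ev_monic_names nameK) -map_comp (eq_map nameK) map_id -Es.
rewrite map_polyZ hornerZ -Hp => /eqP; rewrite subr_eq0 => /eqP E.
by rewrite -[RHS]E; ring.
Qed.

Section Step.
Variables (Y : seq nat) (y : nat).
Hypotheses (y_new : y \notin Y ++ [:: H; 0%N]).
Hypothesis IH : forall b, term_over (Y ++ [:: 0%N]) b -> evL b != 0 ->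
  exists hs st, good_tower Y b hs st.
Variables (V : comNzRingType) (j : {rmorphism V -> L}) (to : term -> V) (tm : V -> term).
Hypothesis j_inj : injective j.
Hypothesis toE : forall t, term_over (Y ++ [:: 0%N]) t -> j (to t) = evL t.
Hypothesis tmE : forall z, term_over (Y ++ [:: 0%N]) (tm z) /\ evL (tm z) = j z.
Hypothesis specialize : forall (C : comNzRingType) (g : {rmorphism k -> C}) (v : nat -> C),
  (forall t, term_over (Y ++ [:: 0%N]) t -> evL t = 0 -> ev (g \o nu) v t = 0) ->
  exists phi : {rmorphism V -> C},
    (forall t, term_over (Y ++ [:: 0%N]) t -> phi (to t) = ev (g \o nu) v t) /\
    (forall z, phi z = ev (g \o nu) v (tm z)).

Lemma sub_tower_vars st : map fst st = Y ->
  {subset Y ++ [:: 0%N] <= tower_vars H st}.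
Proof.
by move=> EY z; rewrite /tower_vars EY !mem_cat !inE => /orP[->|->]; rewrite ?orbT.
Qed.

(** One polynomial in the new variable represents the term both at the generic point and in every
    specialization of [V]. *)
Lemma term_polyP t : term_over ((y :: Y) ++ [:: 0%N]) t -> exists p : {poly V},
  evL t = (map_poly j p).[x y] /\
  forall (C : comNzRingType) (g : {rmorphism k -> C}) v (phi : {rmorphism V -> C}),
    (forall t, term_over (Y ++ [:: 0%N]) t -> phi (to t) = ev (g \o nu) v t) ->
    ev (g \o nu) v t = (map_poly phi p).[v y].
Proof.
elim: t => [z|a|t IHt u IHu|t IHt u IHu].
- rewrite [term_over _ _]/= inE; case: eqP => [->|_] /= oz.
    exists 'X; rewrite map_polyX hornerX; split=> // C g v phi _.
    by rewrite map_polyX hornerX.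
  exists (to (TV z))%:P; rewrite map_polyC hornerC [RHS]toE //; split=> // C g v phi Hphi.
  by rewrite map_polyC hornerC [RHS]Hphi.
- move=> _; exists (to (TC a))%:P; rewrite map_polyC hornerC [RHS]toE //.
  split=> // C g v phi Hphi.
  by rewrite map_polyC hornerC [RHS]Hphi.
- case/andP => /IHt[p [Ep Hp]] /IHu[q [Eq Hq]]; exists (p + q).
  rewrite rmorphD hornerD -Ep -Eq; split=> // C g v phi Hphi.
  by rewrite rmorphD hornerD -(Hp _ _ _ _ Hphi) -(Hq _ _ _ _ Hphi).
- case/andP => /IHt[p [Ep Hp]] /IHu[q [Eq Hq]]; exists (p * q).
  rewrite rmorphM hornerM -Ep -Eq; split=> // C g v phi Hphi.
  by rewrite rmorphM hornerM -(Hp _ _ _ _ Hphi) -(Hq _ _ _ _ Hphi).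
Qed.

Lemma poly_term (p : {poly V}) : exists t, term_over ((y :: Y) ++ [:: 0%N]) t /\
  forall (C : comNzRingType) (g : {rmorphism k -> C}) v (phi : {rmorphism V -> C}),
    (forall z, phi z = ev (g \o nu) v (tm z)) ->
    ev (g \o nu) v t = (map_poly phi p).[v y].
Proof.
elim/poly_ind: p => [|p c [t [ot Ht]]].
  exists (Tconst 0); split=> // C g v phi _.
  by rewrite ev_const // !rmorph0 horner0.
exists (TA (TM t (TV y)) (tm c)); split.
  have [oc _] := tmE c; rewrite [term_over _ _]/= -/(term_over _ _).
  rewrite -[y :: _]/((y :: Y) ++ [:: 0%N]) ot inE eqxx /=.
  by apply: term_over_sub oc => z; rewrite inE orbC => ->.
move=> C g v phi Hphi.
by rewrite rmorphD rmorphM /= map_polyX map_polyC hornerD hornerMX hornerC /= Hphi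
  (Ht _ _ _ _ Hphi).
Qed.

(** The induction hypothesis is applied to the product of [lead_coef q] and [r], so one prescribed
    element inverts both. Dividing [q] by its leading coefficient then gives the monic equation of
    [y]. *)
Lemma extend_tower (q : {poly V}) (r : V) : (1 < size q)%N -> r != 0 ->
  no_zero_divisors V ->
  exists hs st, [/\ tower_wf H st, map fst st = y :: Y &
    exists c, term_over (tower_vars H st) c /\
    forall (C : comNzRingType) (g : {rmorphism k -> C}) v, models g v ((H, hs), st) ->
    exists phi : {rmorphism V -> C},
     [/\ forall t, term_over (Y ++ [:: 0%N]) t -> phi (to t) = ev (g \o nu) v t,
         forall z, phi z = ev (g \o nu) v (tm z),
         (map_poly phi q).[v y] = 0 &
         phi (lead_coef q) * phi r * ev (g \o nu) v c = 1]].
Proof.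
move=> sq r0 domV; have q0 : q != 0 by rewrite -size_poly_gt0 ltnW.
have a0 : lead_coef q != 0 by rewrite lead_coef_eq0.
set a := lead_coef q in a0 *.
have [oa Ea] := tmE a; have [or Er] := tmE r.
have [||hs [st [wf EY zero [b' [ob' inv]]]]] := IH (b := TM (tm a) (tm r)).
- by rewrite /= oa or.
- rewrite [evL _]/= Ea Er -rmorphM; apply: contraNneq (domain_mulf_neq0 domV a0 r0).
  by rewrite -(rmorph0 j) => /j_inj ->.
(* In every model [r * b'] is the inverse of the leading coefficient, so these are the lower
   coefficients of the monic multiple of [q]. *)
pose cs := [seq TM (TM (tm c) (tm r)) b' | c <- take (size q).-1 q].
exists hs, ((y, cs) :: st); split=> /=; last 1 first.
- exists b'; split.
    by apply: term_over_sub ob' => z; rewrite /tower_vars /= inE orbC => ->.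
  move=> C g v mod.
  have mod' : models g v ((H, hs), st).
    by move=> u; rewrite inE => /predU1P[->|ust]; apply: mod; rewrite !inE ?eqxx ?ust ?orbT.
  have [phi [Hto Htm]] := specialize (zero _ _ _ mod').
  have E1 : phi a * phi r * ev (g \o nu) v b' = 1.
    by rewrite -(inv _ _ _ mod') /= !Htm.
  exists phi; split=> //.
  have := mod (monic_term name y cs); rewrite !inE eqxx orbT => /(_ isT).
  rewrite ev_monic_term // => E0.
  suff -> : map_poly phi q = (phi a)%:P * Poly (rcons [seq ev (g \o nu) v c | c <- cs] 1).
    by rewrite hornerM E0 mulr0.
  rewrite polyC_mul_Poly -[in LHS](polyseqK q) map_Poly polyseq_rcons // !map_rcons mulr1.
  congr (Poly (rcons _ _)); rewrite /cs -!map_comp; apply: eq_map => c /=.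
  by rewrite -!Htm -[LHS]mulr1 -E1; ring.
- have EV : tower_vars H st = Y ++ [:: H; 0%N] by rewrite /tower_vars EY.
  rewrite EV y_new wf /cs size_map size_takel ?leq_pred //.
  rewrite -ltnS prednK ?(ltnW sq) // sq /= andbT.
  apply/allP => _ /mapP[c _ ->] /=; rewrite -EV ob' andbT.
  have [oc _] := tmE c; have sub := sub_tower_vars EY.
  by rewrite (term_over_sub sub oc) (term_over_sub sub or).
- by rewrite EY.
Qed.

(** If the value of [y] is algebraic over [V], a minimal annihilator gives its equation and the
    Bezout identity inverts [b]. If it is transcendental, [y] satisfies no relation that must be
    preserved, and it may be specialized to a root of any polynomial; one is chosen at whose roots
    [b] is a unit. *)
Lemma good_tower_step b : term_over ((y :: Y) ++ [:: 0%N]) b -> evL b != 0 ->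
  exists hs st, good_tower (y :: Y) b hs st.
Proof.
have domV : no_zero_divisors V.
  move=> c d cd0; have := congr1 j cd0; rewrite rmorphM rmorph0 => /domL.
  by rewrite -(rmorph0 j) => -[] /j_inj; [left | right].
pose E : {rmorphism {poly V} -> L} := horner_eval (x y) \o map_poly j.
have EE p : E p = (map_poly j p).[x y] by [].
have Einj c : E c%:P = 0 -> c = 0.
  by rewrite EE map_polyC hornerC -(rmorph0 j) => /j_inj.
move=> ob b0; have [pb [Epb Hpb]] := term_polyP ob.
have {}b0 : E pb != 0 by rewrite EE -Epb.
case: (EM (exists2 q : {poly V}, q != 0 & E q = 0)) => [|trans].
  case/minimal_annihilator => q [q0 Eq qmin].
  have sq := size_minimal_annihilator Einj q0 Eq.
  have [r [u [w [r0 defr]]]] := pseudo_inverse domV domL Einj q0 Eq qmin b0.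
  have [hs [st [wf EY [c [oc Hc]]]]] := extend_tower sq r0 domV.
  exists hs, st; split=> //.
    move=> C g v /Hc[phi [Hto Htm qv inv]] t /term_polyP[p [Ep Hp]].
    rewrite Ep -EE => /(annihilator_pseudo_dvd q0 Eq qmin)[s [Q eqQ]].
    rewrite (Hp _ _ _ _ Hto).
    have := congr1 (fun p => (map_poly phi p).[v y]) eqQ.
    rewrite /= rmorphM hornerM qv mulr0 -mul_polyC rmorphM /= map_polyC hornerM hornerC.
    have Ea : phi (lead_coef q ^+ s) = phi (lead_coef q) ^+ s by apply: rmorphXn.
    move=> E0; have {E0} : phi (lead_coef q ^+ s) * (map_poly phi p).[v y] = 0 by exact: E0.
    (* The inverse of the leading coefficient, provided by the tower, cancels the power introduced
       by pseudo-division. *)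
    rewrite Ea => /(congr1 (fun z => (phi r * ev (g \o nu) v c) ^+ s * z)).
    rewrite mulr0 mulrA -exprMn.
    have -> : phi r * ev (g \o nu) v c * phi (lead_coef q) = 1 by rewrite -inv; ring.
    by rewrite expr1n mul1r.
  have [tu [otu Htu]] := poly_term u.
  have sub : {subset (y :: Y) ++ [:: 0%N] <= tower_vars H st}.
    by move=> z; rewrite /tower_vars EY !mem_cat !inE => /orP[->|->]; rewrite ?orbT.
  (* Modulo [q] the Bezout identity reads [r = u * b], and [lead_coef q * r * c = 1]. *)
  exists (TM (TM tu (tm (lead_coef q))) c); split.
    rewrite /= oc (term_over_sub sub otu) andbT.
    have [oa _] := tmE (lead_coef q).
    by apply: term_over_sub oa => z zY; apply: sub; rewrite inE zY orbT.
  move=> C g v /Hc[phi [Hto Htm qv inv]].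
  have := congr1 (fun p => (map_poly phi p).[v y]) defr.
  rewrite /= map_polyC hornerC rmorphD !rmorphM hornerD !hornerM qv mulr0 addr0.
  rewrite -(Hpb _ _ _ _ Hto) -(Htu _ _ _ _ Htm) /= => Er.
  by rewrite -Htm -[RHS]inv Er; ring.
have zero (p : {poly V}) : E p = 0 -> p = 0.
  by move=> Ep; apply: contra_notP trans => /eqP p0; exists p.
have pb0 : pb != 0 by apply: contraNneq b0 => ->; rewrite rmorph0.
(* At the roots of [pb - lead_coef pb] the polynomial [pb] equals its leading coefficient. If [pb]
   is constant, any equation will do and ['X] is taken. *)
have [q [r [sq r0 Hq]]] : exists (q : {poly V}) (r : V), [/\ (1 < size q)%N, r != 0 &
    forall (C : comNzRingType) (phi : {rmorphism V -> C}) (z : C),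
      (map_poly phi q).[z] = 0 ->
      (map_poly phi pb).[z] = phi (lead_coef q) * phi r].
  case: (ltnP 1 (size pb)) => spb; last first.
    have {spb} Epb1 := size1_polyC spb.
    exists 'X, pb`_0; rewrite size_polyX; split=> //.
      by apply: contraNneq pb0 => c0; rewrite Epb1 c0.
    by move=> C phi z _; rewrite lead_coefX rmorph1 mul1r Epb1 map_polyC hornerC coefC.
  have ltl : (size (- (lead_coef pb)%:P)%R < size pb)%N.
    by rewrite size_polyN (leq_ltn_trans (size_polyC_leq1 _)).
  exists (pb - (lead_coef pb)%:P), 1; rewrite size_polyDl // lead_coefDl //.
  split=> //; first exact: oner_neq0.
  move=> C phi z; rewrite rmorphB /= hornerD hornerN map_polyC hornerC => /eqP.
  by rewrite subr_eq0 rmorph1 mulr1 => /eqP.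
have [hs [st [wf EY [c [oc Hc]]]]] := extend_tower sq r0 domV.
exists hs, st; split=> //.
  move=> C g v /Hc[phi [Hto _ _ _]] t /term_polyP[p [Ep Hp]].
  rewrite Ep -EE => /zero p0.
  by rewrite (Hp _ _ _ _ Hto) p0 rmorph0 horner0.
exists c; split=> // C g v /Hc[phi [Hto _ qv inv]].
by rewrite (Hpb _ _ _ _ Hto) (Hq _ _ _ qv).
Qed.

End Step.

Lemma good_tower_exists Y : uniq Y -> 0%N \notin Y -> H \notin Y ->
  forall b, term_over (Y ++ [:: 0%N]) b -> evL b != 0 ->
  exists hs st, good_tower Y b hs st.
Proof.
elim: Y => [_ _ _ b ob b0|y Y IH /= /andP[yY uY]].
  by have [hs ?] := good_tower_nil ob b0; exists hs, [::].
rewrite !inE !negb_or => /andP[y0 Y0] /andP[yH YH].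
have [V [j [to [tm [j_inj toE tmE spec]]]]] := value_ring nameK f x (Y ++ [:: 0%N]).
apply: (good_tower_step _ (IH uY Y0 YH) j_inj toE tmE spec).
by rewrite mem_cat !inE !negb_or yY eq_sym yH eq_sym y0.
Qed.

End TowerConstruction.

Fixpoint term_vars (t : term) : seq nat :=
  match t with
  | TV x => [:: x]
  | TC _ => [::]
  | TA t u | TM t u => term_vars t ++ term_vars u
  end.

Lemma term_over_vars t : term_over (term_vars t) t.
Proof.
elim: t => [x|a|t IHt u IHu|t IHt u IHu] //=; first by rewrite inE.
  by apply/andP; split; [apply: term_over_sub IHt | apply: term_over_sub IHu] => z;
    rewrite mem_cat => ->; rewrite ?orbT.
by apply/andP; split; [apply: term_over_sub IHt | apply: term_over_sub IHu] => z;
  rewrite mem_cat => ->; rewrite ?orbT.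
Qed.

Theorem certificate_dichotomy (k : fieldType) (nu : nat -> k) (name : k -> nat)
    (S : seq term) : cancel name nu ->
  ~ finite_certificate nu name S -> infinite_certificate nu name S.
Proof.
move=> nameK /(generic_point nameK)[L [f [x [domL zero trans]]]].
pose Z := flatten (map term_vars S).
pose Y := [seq z <- undup Z | z != 0%N].
(* A variable that is nonzero and does not occur in [S]. *)
pose H := (\max_(z <- Z) z).+1.
have HZ z : z \in Z -> (z < H)%N by move=> zZ; rewrite ltnS; apply: leq_bigmax_seq.
have ZY t : t \in S -> term_over (Y ++ [:: 0%N]) t.
  move=> tS; apply: term_over_sub (term_over_vars t) => z zt.
  rewrite mem_cat mem_filter mem_undup inE orbC.
  case: eqP => //= _; apply/flattenP; exists (term_vars t) => //.
  exact: map_f.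
have [|||||hs [st [wf EY zero' _]]] :=
  @good_tower_exists k nu name nameK L f x domL trans H isT Y _ _ _ (Tconst name 1).
- by rewrite filter_uniq // undup_uniq.
- by rewrite mem_filter eqxx.
- by rewrite mem_filter mem_undup; apply/negP => /andP[_ /HZ]; rewrite ltnn.
- by [].
- by rewrite ev_const // rmorph1 oner_neq0.
(* The relations hold in every model of the tower; completeness converts this into the derivations
   that the certificate asks for. *)
exists ((H, hs), st); split=> // t tS; apply: (der_complete nameK) => C g v mod.
by apply: zero' mod _ (ZY _ tS) (zero _ tS).
Qed.

(** Some certificate always exists, and the two kinds exclude each other because both are sound over
    the same [K]. *)
Theorem decidable_finite_values (k : fieldType) (nu : nat -> k) (name : k -> nat)
    (K : closedFieldType) (f : {rmorphism k -> K}) :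
  cancel name nu -> computable_numbering nu ->
  exists2 b : seq term -> bool, decidable_pred b &
    forall S, b S <-> finite_set (values0 nu f S).
Proof.
move=> nameK nuC.
have [||b bdec bP] := @re_coRe_decidable _ _ (finite_certificate nu name).
- exact: re_finite_certificate.
- apply: eq_re (re_infinite_certificate name nuC) => S; split.
    by move=> H1 /(finite_certificate_sound nameK) H2; apply:
      (infinite_certificate_sound nameK H1 (H2 K f)).
  exact: certificate_dichotomy nameK.
exists b => // S; split=> [/bP H|fin]; first exact: finite_certificate_sound nameK _ _ _ H.
apply/bP; case: (EM (finite_certificate nu name S)) => // /(certificate_dichotomy nameK) H.
by case: (infinite_certificate_sound nameK H fin).
Qed.

(** * The equations of irreducible representations *)

Section System.
Variables (k : fieldType) (nu : nat -> k) (name : k -> nat).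
Hypothesis nameK : cancel name nu.
Variable n : nat.
Local Notation Tconst := (Tconst name).
Local Notation T0 := (Tconst 0).

(** Odd numbers denote the entries of the generators and positive even ones the coordinates of the
    elementary matrices, which leaves 0 for the distinguished variable. *)
Definition Xvar (l a b : nat) : nat := (enc (l, (a, b))).*2.+1.
Definition Yvar (a b i : nat) : nat := (enc (a, (b, i))).*2.+2.

Definition Tdelta (a b : nat) : term := TC (if a == b then name 1 else name 0).

Definition Tsum (m : nat) (F : nat -> term) : term :=
  foldr (fun i t => TA (F i) t) T0 (iota 0 m).

(** Proceeding by columns makes this a fold whose state is a list of terms, hence codable; a
    recursion on single entries would carry functions. *)
Definition word_col (w : seq nat) (b : nat) : seq term :=
  foldr (fun l col => [seq Tsum n (fun c => TM (TV (Xvar l a c))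
    (nth T0 col c)) | a <- iota 0 n])
    [seq Tdelta a b | a <- iota 0 n] w.

Definition word_entry (w : seq nat) (a b : nat) : term := nth T0 (word_col w b) a.

(* A monomial is the sequence of the name of its coefficient and the code of its word. *)
Definition poly_entry (p : seq (seq nat)) (a b : nat) : term :=
  foldr (fun m t => TA (TM (TC (nth 0%N m 0)) (word_entry (dec (nth 0%N m 1)) a b)) t) T0 p.

Definition iota2 (F : nat -> nat -> term) : seq term :=
  flatten [seq [seq F a b | b <- iota 0 n] | a <- iota 0 n].

Definition relation_eqs (P : seq (seq (seq nat))) : seq term :=
  flatten [seq iota2 (poly_entry p) | p <- P].

(** Spanning is expressed by new unknowns that write each elementary matrix in the words, so no
    determinant has to be inverted. As the words number [n * n], they form a basis and these
    unknowns are determined by the matrices. *)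
Definition spanning_eq (W : seq (seq nat)) (e g a b : nat) : term :=
  TA (Tsum (n * n) (fun i => TM (TV (Yvar e g i)) (word_entry (nth [::] W i) a b)))
     (TM (Tconst (-1)) (TM (Tdelta a e) (Tdelta b g))).

Definition spanning_eqs (W : seq (seq nat)) : seq term :=
  flatten (flatten [seq [seq iota2 (spanning_eq W e g) | g <- iota 0 n] | e <- iota 0 n]).

(** A matrix is the combination of the elementary matrices with its entries as coefficients, so its
    coordinates are obtained linearly from theirs. *)
Definition coordinate_eq (W : seq (seq nat)) (l j i : nat) : term :=
  TA (Tsum n (fun a => Tsum n (fun b =>
        TM (word_entry (l :: nth [::] W j) a b) (TV (Yvar a b i)))))
     (TM (Tconst (-1)) (TV 0)).

Definition irr_system (P : seq (seq (seq nat))) (W : seq (seq nat))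
  (l j i : nat) : seq term :=
  coordinate_eq W l j i :: relation_eqs P ++ spanning_eqs W.

Section SystemComputable.
Context (A : Type) {cA : coded A}.

Lemma computable_Xvar (l a b : A -> nat) : computable l -> computable a -> computable b ->
  computable (fun q => Xvar (l q) (a q) (b q)).
Proof. by move=> *; rewrite /Xvar; cpt. Qed.

Lemma computable_Yvar (l a b : A -> nat) : computable l -> computable a -> computable b ->
  computable (fun q => Yvar (l q) (a q) (b q)).
Proof. by move=> *; rewrite /Yvar; cpt. Qed.

Lemma computable_Tdelta (a b : A -> nat) : computable a -> computable b ->
  computable (fun q => Tdelta (a q) (b q)).
Proof.
move=> Ha Hb; apply: computable_TC; apply: computable_if; [|cpt|cpt].
exact: decidable_eq.
Qed.

Lemma computable_Tsum (m : A -> nat) (F : A -> nat -> term) :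
  computable m -> computable2 F -> computable (fun q => Tsum (m q) (F q)).
Proof.
move=> Hm HF; apply: (computable_foldr (g := fun q i t => TA (F q i) t) (b := fun=> T0));
  cpt.
Qed.

End SystemComputable.

Lemma computable_word_entry A {cA : coded A} (w : A -> seq nat) (a b : A -> nat) :
  computable w -> computable a -> computable b ->
  computable (fun q => word_entry (w q) (a q) (b q)).
Proof.
move=> Hw Ha Hb; apply: computable_nth => //.
apply: (computable_foldr
  (g := fun (q : A) l col => [seq Tsum n (fun c => TM (TV (Xvar l a c))
    (nth T0 col c)) | a <- iota 0 n])
  (b := fun q => [seq Tdelta a (b q) | a <- iota 0 n])) => //.
  apply: (computable_map (f := fun (q : A * (nat * seq term)) a =>
    Tsum n (fun c => TM (TV (Xvar q.2.1 a c)) (nth T0 q.2.2 c)))); last by cpt.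
  apply: (computable_Tsum (F := fun (q : A * (nat * seq term) * nat) c =>
    TM (TV (Xvar q.1.2.1 q.2 c)) (nth T0 q.1.2.2 c))); first by cpt.
  by apply: computable_TM; [apply: computable_TV; apply: computable_Xvar | ]; cpt.
apply: (computable_map (f := fun q a => Tdelta a (b q))); last by cpt.
by apply: computable_Tdelta; cpt.
Qed.

Lemma computable_poly_entry A {cA : coded A} (p : A -> seq (seq nat)) (a b : A -> nat) :
  computable p -> computable a -> computable b ->
  computable (fun q => poly_entry (p q) (a q) (b q)).
Proof.
move=> Hp Ha Hb.
apply: (computable_foldr (g := fun q (m : seq nat) t =>
  TA (TM (TC (nth 0%N m 0)) (word_entry (dec (nth 0%N m 1)) (a q) (b q))) t) (b := fun=>
    T0)); [|cpt|cpt].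
apply: computable_TA; last by cpt.
apply: computable_TM; first by cpt.
by apply: computable_word_entry; [apply: computable_dec|..]; cpt.
Qed.

Lemma computable_iota2 A {cA : coded A} (F : A -> nat -> nat -> term) :
  computable3 F -> computable (fun q => iota2 (F q)).
Proof.
move=> HF; apply: computable_flatten.
apply: (computable_map (f := fun q a => [seq F q a b | b <- iota 0 n])); last by cpt.
by apply: (computable_map (f := fun (q : A * nat) b => F q.1 q.2 b)); cpt.
Qed.

Lemma computable_irr_system A {cA : coded A} (P : A -> seq (seq (seq nat)))
    (W : A -> seq (seq nat)) (l j i : A -> nat) :
  computable P -> computable W -> computable l -> computable j -> computable i ->
  computable (fun q => irr_system (P q) (W q) (l q) (j q) (i q)).
Proof.
move=> HP HW Hl Hj Hi; apply: computable_cons; last apply: computable_cat.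
- apply: computable_TA; last by cpt.
  apply: (computable_Tsum (F := fun q a => Tsum n (fun b =>
    TM (word_entry (l q :: nth [::] (W q) (j q)) a b) (TV (Yvar a b (i q))))));
      first by cpt.
  apply: (computable_Tsum (F := fun (q : A * nat) b =>
    TM (word_entry (l q.1 :: nth [::] (W q.1) (j q.1)) q.2 b) (TV (Yvar q.2 b (i q.1)))));
      first by cpt.
  apply: computable_TM; first by apply: computable_word_entry; cpt.
  by apply: computable_TV; apply: computable_Yvar; cpt.
- apply: computable_flatten; apply: (computable_map (f := fun _ p => iota2
  (poly_entry p))); last by cpt.
  apply: (computable_iota2 (F := fun (q : A * seq (seq nat)) a b => poly_entry q.2 a b)).
  by apply: computable_poly_entry; cpt.
- do 2!apply: computable_flatten.
  apply: (computable_map (f := fun q e => [seq iota2 (spanning_eq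
    (W q) e g) | g <- iota 0 n])); last by cpt.
  apply: (computable_map (f := fun (q : A * nat) g => iota2 (spanning_eq (W q.1) q.2 g)));
    last by cpt.
  apply: (computable_iota2 (F := fun (q : A * nat * nat) a b => spanning_eq
    (W q.1.1) q.1.2 q.2 a b)).
  apply: computable_TA; last first.
    by apply: computable_TM; [cpt | apply: computable_TM; apply: computable_Tdelta; cpt].
  apply: (computable_Tsum (F := fun (q : A * nat * nat * (nat * nat)) i =>
    TM (TV (Yvar q.1.1.2 q.1.2 i)) (word_entry (nth [::] (W q.1.1.1) i) q.2.1 q.2.2)));
      first by cpt.
  apply: computable_TM; first by apply: computable_TV; apply: computable_Yvar; cpt.
  by apply: computable_word_entry; cpt.
Qed.

Definition words (s r : nat) : seq (seq nat) :=
  iteri r (fun _ ws => [::] :: flatten [seq [seq l :: w | w <- ws] | l <- iota 0 s]) [::].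

Definition word_tuples (s r : nat) : seq (seq (seq nat)) :=
  iteri r (fun _ Ws => flatten [seq [seq w :: V | V <- Ws] | w <- words s
    (n * n)]) [:: [::]].

Lemma mem_words s r w : (size w < r)%N -> all (fun l => (l < s)%N) w -> w \in words s r.
Proof.
elim: r w => // r IH [|l w] /=; first by rewrite inE.
rewrite ltnS => lt_w /andP[lt_l lt_s]; rewrite inE /=.
apply/flattenP; exists [seq l :: u | u <- words s r].
  by apply: (map_f (fun l => [seq l :: w | w <- words s r])); rewrite mem_iota.
exact/map_f/IH.
Qed.

Lemma mem_word_tuples s V : all (mem (words s (n * n))) V -> V \in word_tuples s (size V).
Proof.
elim: V => //= w V IH /andP[ww /IH VV]; apply/flattenP.
exists [seq w :: U | U <- word_tuples s (size V)]; last exact: map_f.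
exact: (map_f (fun w => [seq w :: V0 | V0 <- word_tuples s (size V)])).
Qed.

Lemma words_sub s r w : w \in words s r -> all (fun l => (l < s)%N) w.
Proof.
elim: r w => // r IH w /=; rewrite inE => /predU1P[->//|/flattenP[_ /mapP[l lS
  ->] /mapP[u uw ->]]] /=.
by rewrite IH // andbT; move: lS; rewrite mem_iota.
Qed.

Lemma words_size s r w : w \in words s r ->
  (size w < r)%N /\ all (fun l => (l < s)%N) w.
Proof.
move=> /[dup] /words_sub -> wr; split=> //.
elim: r w wr => // r IH w /=; rewrite inE => /predU1P[->//|].
by case/flattenP=> _ /mapP[l _ ->] /mapP[u /IH uw ->].
Qed.

Lemma words_subS s r w : w \in words s r -> w \in words s r.+1.
Proof. by case/words_size=> /ltnW; rewrite -ltnS; apply: mem_words. Qed.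

Lemma word_tuples_sub s r V : V \in word_tuples s r ->
  size V = r /\ all (mem (words s (n * n))) V.
Proof.
elim: r V => [|r IH] V /=; first by rewrite inE => /eqP ->.
case/flattenP=> _ /mapP[w ww ->] /mapP[U UU ->] /=.
by have [-> ->] := IH _ UU; rewrite ww.
Qed.

Lemma computable_words A {cA : coded A} (s : A -> nat) r : computable s ->
  computable (fun q => words (s q) r).
Proof.
move=> Hs; apply: (computable_iteri (e := fun=> r) (b := fun=> [::]) (g := fun q _ ws =>
  [::] :: flatten [seq [seq l :: w | w <- ws] | l <- iota 0 (s q)])); [cpt| |cpt].
apply: computable_cons; first by cpt.
apply: computable_flatten; apply: (computable_map (f := fun (q : A * (nat * seq
  (seq nat))) l =>
  [seq l :: w | w <- q.2.2])); last by cpt.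
by apply: (computable_map (f := fun (q : A * (nat * seq (seq nat)) * nat) w => q.2 :: w));
  cpt.
Qed.

Lemma computable_word_tuples A {cA : coded A} (s : A -> nat) r : computable s ->
  computable (fun q => word_tuples (s q) r).
Proof.
move=> Hs; apply: (computable_iteri (e := fun=> r) (b := fun=> [:: [::]])
  (g := fun q _ Ws =>
  flatten [seq [seq w :: V | V <- Ws] | w <- words (s q) (n * n)])); [cpt| |cpt].
apply: computable_flatten; apply: (computable_map (f := fun (q : A * (nat * seq (seq
  (seq nat)))) w =>
  [seq w :: V | V <- q.2.2])).
  by apply: (computable_map (f := fun (q : A * (nat * seq (seq (seq nat))) * seq nat) V =>
    q.2 :: V)); cpt.
by apply: (computable_words (s := fun q : A * (nat * seq (seq (seq nat))) => s q.1)); cpt.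
Qed.

Definition input_size (x : nat) : nat := nth 0%N (dec x : seq nat) 0.
Definition input_relations (x : nat) : seq (seq (seq nat)) :=
  dec (nth 0%N (dec x : seq nat) 1).

Definition decider (fin : seq term -> bool) (x : nat) : bool :=
  all (fun W => all (fun l => all (fun j => all (fun i =>
      fin (irr_system (input_relations x) W l j i))
    (iota 0 (n * n))) (iota 0 (n * n))) (iota 0 (input_size x)))
  (word_tuples (input_size x) (n * n)).

Lemma decidable_decider fin : decidable_pred fin -> decidable_pred (decider fin).
Proof.
move=> Hfin.
have Hx : computable (fun x : nat => dec x : seq nat) by apply: computable_dec; cpt.
have Hs : computable input_size by apply: computable_nth; cpt.
have HP : computable input_relations by apply: computable_dec; apply: computable_nth; cpt.
apply: (@decidable_all _ _ _ _ (fun x W => all (fun l => all (fun j => all (fun i =>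
  fin (irr_system (input_relations x) W l j i))
    (iota 0 (n * n))) (iota 0 (n * n))) (iota 0 (input_size x))));
      last exact: computable_word_tuples.
apply: (@decidable_all _ _ _ _ (fun (q : nat * seq (seq nat)) l => all (fun j => all
  (fun i =>
  fin (irr_system (input_relations q.1) q.2 l j i)) (iota 0 (n * n))) (iota 0 (n * n))));
    last by cpt.
apply: (@decidable_all _ _ _ _ (fun (q : nat * seq (seq nat) * nat) j => all (fun i =>
  fin (irr_system (input_relations q.1.1) q.1.2 q.2 j i)) (iota 0 (n * n)))); last by cpt.
apply: (@decidable_all _ _ _ _ (fun (q : nat * seq (seq nat) * nat * nat) i =>
  fin (irr_system (input_relations q.1.1.1) q.1.1.2 q.1.2 q.2 i))); last by cpt.
by apply: (decidable_comp Hfin); apply: computable_irr_system; cpt.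
Qed.

End System.

(** * Matrices given by words *)

Section WordMatrix.
Variables (K : fieldType) (n : nat).
Implicit Types (A : nat -> 'M[K]_n) (B : nat -> 'M[K]_n) (y : nat -> nat -> nat -> K).

Definition word_mx A (w : seq nat) : 'M[K]_n := foldr (fun l M => A l *m M) 1%:M w.

Definition spanning B y : Prop :=
  forall e g : 'I_n, \sum_(i < n * n) y e g i *: B i = delta_mx e g.

Definition coordinate y (M : 'M[K]_n) (i : nat) : K :=
  \sum_(a < n) \sum_(b < n) M a b * y a b i.

Lemma coord_sum y (I : Type) (r : seq I) (c : I -> K) (M : I -> 'M[K]_n) i :
  coordinate y (\sum_(t <- r) c t *: M t) i = \sum_(t <- r) c t * coordinate y (M t) i.
Proof.
rewrite /coordinate [RHS](eq_bigr (fun t => \sum_(a < n) \sum_(b < n) c t *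
  (M t a b * y a b i))); last first.
  by move=> t _; rewrite mulr_sumr; apply: eq_bigr => a _; rewrite mulr_sumr.
rewrite [RHS]exchange_big; apply: eq_bigr => a _.
rewrite [RHS]exchange_big; apply: eq_bigr => b _.
rewrite summxE mulr_suml; apply: eq_bigr => t _.
by rewrite mxE mulrA.
Qed.

Lemma coord_decomposition B y M : spanning B y ->
  M = \sum_(i < n * n) coordinate y M i *: B i.
Proof.
move=> span; rewrite [LHS]matrix_sum_delta.
under [LHS]eq_bigr => a _ do under eq_bigr => b _ do rewrite -span scaler_sumr.
under [LHS]eq_bigr => a _ do rewrite exchange_big.
rewrite exchange_big; apply: eq_bigr => i _.
rewrite /coordinate scaler_suml; apply: eq_bigr => a _.
rewrite scaler_suml; apply: eq_bigr => b _.
by rewrite scalerA.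
Qed.

(** Writing the [n * n] matrices as the rows of a square matrix, spanning gives a one-sided inverse,
    which is two-sided. *)
Lemma spanning_free B y (c d : nat -> K) : spanning B y ->
  \sum_(i < n * n) c i *: B i = \sum_(i < n * n) d i *: B i ->
  forall i, (i < n * n)%N -> c i = d i.
Proof.
move=> span E i lt_i.
pose BM : 'M[K]_(n * n) := \matrix_(i < n * n) mxvec (B i).
pose YM : 'M[K]_(n * n) := \matrix_(q < n * n) \row_(i < n * n)
  y (enum_val (cast_ord (esym (mxvec_cast n n)) q)).1 (enum_val (cast_ord (esym
    (mxvec_cast n n)) q)).2 i.
have YB : YM *m BM = 1%:M.
  apply/row_matrixP => q; rewrite row_mul row1 rowK.
  case/mxvec_indexP: q => e g; rewrite -mxvec_delta -span linear_sum mulmx_sum_row.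
  apply: eq_bigr => t _; rewrite linearZ mxE rowK /=.
  by rewrite /mxvec_index cast_ordK enum_rankK.
have BY := mulmx1C YB.
have row_of (u : nat -> K) : \row_(t < n * n) u t *m BM = mxvec
  (\sum_(t < n * n) u t *: B t).
  rewrite linear_sum mulmx_sum_row; apply: eq_bigr => t _.
  by rewrite linearZ mxE rowK.
have /(congr1 (mulmx^~ YM)) : \row_(t < n * n) c t *m BM = \row_(t < n * n) d t *m BM.
  by rewrite !row_of E.
rewrite -!mulmxA BY !mulmx1 => /rowP/(_ (Ordinal lt_i)).
by rewrite !mxE.
Qed.

Lemma coord_unique B y M (c : nat -> K) : spanning B y ->
  M = \sum_(i < n * n) c i *: B i -> forall i, (i < n * n)%N -> coordinate y M i = c i.
Proof.
move=> span E; apply: (spanning_free span).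
by rewrite -coord_decomposition.
Qed.

Lemma word_mx_conj A A' s (Q : 'M[K]_n) w :
  (forall l, (l < s)%N -> A' l *m Q = Q *m A l) -> all (fun l => (l < s)%N) w ->
  word_mx A' w *m Q = Q *m word_mx A w.
Proof.
move=> AA; elim: w => [|l w IH] /=; first by rewrite mulmx1 mul1mx.
by case/andP=> lt_l /IH E; rewrite -mulmxA E !mulmxA AA.
Qed.

(** Conjugation carries one word basis to the other and preserves linear combinations; coordinates
    are unique. *)
Lemma conj_coord A A' s (Q : 'M[K]_n) (W : nat -> seq nat) y y' l j i :
  Q \in unitmx -> (forall l, (l < s)%N -> A' l *m Q = Q *m A l) ->
  (forall i, (i < n * n)%N -> all (fun l => (l < s)%N) (W i)) ->
  spanning (word_mx A \o W) y -> spanning (word_mx A' \o W) y' ->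
  (l < s)%N -> (j < n * n)%N -> (i < n * n)%N ->
  coordinate y (word_mx A (l :: W j)) i = coordinate y' (word_mx A' (l :: W j)) i.
Proof.
move=> Qu AA Ws span span' lt_l lt_j lt_i; apply/esym/(coord_unique span') => //.
have conjE w : all (fun l => (l < s)%N) w -> word_mx A' w = Q *m word_mx A w *m invmx Q.
  by move=> ws; rewrite -(word_mx_conj AA ws) mulmxK.
rewrite conjE; last by rewrite /= lt_l Ws.
rewrite {1}(coord_decomposition (word_mx A (l :: W j)) span) mulmx_sumr mulmx_suml.
by apply: eq_bigr => t _; rewrite -scalemxAr -scalemxAl /= conjE ?Ws.
Qed.

(* The linear map sending one word basis to the other commutes with left
   multiplication; a nonzero column of it is the conjugating matrix. *)
Lemma same_coord_conj A A' s (W : nat -> seq nat) y y' :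
  (0 < n)%N ->
  (forall i, (i < n * n)%N -> all (fun l => (l < s)%N) (W i)) ->
  spanning (word_mx A \o W) y -> spanning (word_mx A' \o W) y' ->
  (forall l j i, (l < s)%N -> (j < n * n)%N -> (i < n * n)%N ->
    coordinate y (word_mx A (l :: W j)) i = coordinate y' (word_mx A' (l :: W j)) i) ->
  exists2 Q : 'M[K]_n, Q \in unitmx & forall l, (l < s)%N -> A' l *m Q = Q *m A l.
Proof.
move=> n_gt0 Ws span span' eqc.
pose phi (M : 'M[K]_n) : 'M[K]_n := \sum_(i < n * n) coordinate y M i *: word_mx A' (W i).
have phi_sum (I : Type) (r : seq I) (c : I -> K) (M : I -> 'M[K]_n) :
    phi (\sum_(t <- r) c t *: M t) = \sum_(t <- r) c t *: phi (M t).
  rewrite /phi; under eq_bigr => i _ do rewrite coord_sum scaler_suml.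
  rewrite exchange_big; apply: eq_bigr => t _; rewrite scaler_sumr.
  by apply: eq_bigr => i _; rewrite scalerA.
have phiA l M : (l < s)%N -> phi (A l *m M) = A' l *m phi M.
  move=> lt_l; rewrite {1}(coord_decomposition M span) mulmx_sumr.
  under eq_bigr => j _ do rewrite -scalemxAr.
  rewrite phi_sum /phi mulmx_sumr; apply: eq_bigr => j _; rewrite -scalemxAr; congr
    (_ *: _).
  rewrite [RHS](coord_decomposition (word_mx A' (l :: W j)) span').
  by apply: eq_bigr => i _; rewrite -eqc.
have phiB j : (j < n * n)%N -> phi (word_mx A (W j)) = word_mx A' (W j).
  move=> lt_j; rewrite /phi (bigD1 (Ordinal lt_j)) //= big1 ?addr0 => [|i ij].
    rewrite (coord_unique (c := fun i => (i == j)%:R) span) ?eqxx ?scale1r //.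
    rewrite (bigD1 (Ordinal lt_j)) //= eqxx scale1r big1 ?addr0 // => i ij.
    by rewrite (negPf (ij : i != j :> nat)) scale0r.
  rewrite (coord_unique (c := fun i => (i == j)%:R) span) //.
    by rewrite (negPf (ij : i != j :> nat)) scale0r.
  rewrite (bigD1 (Ordinal lt_j)) //= eqxx scale1r big1 ?addr0 // => t tj.
  by rewrite (negPf (tj : t != j :> nat)) scale0r.
have [c [b [a [d phi0]]]] : exists c b a d : 'I_n, phi (delta_mx c b) a d != 0.
  apply: contrapT => H.
  have zero M : phi M = 0.
    have phid c b : phi (delta_mx c b) = 0.
      apply/matrixP => a d; rewrite mxE; apply/eqP; apply: contra_notT H => ne.
      by exists c, b, a, d.
    rewrite [M]matrix_sum_delta pair_big /= phi_sum big1 // => t _.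
    by rewrite phid scaler0.
  pose o := Ordinal n_gt0.
  have := span' o o; rewrite big1 => [/matrixP/(_ o o)/eqP|i _].
    by rewrite !mxE !eqxx eq_sym oner_eq0.
  by rewrite /= -phiB // zero scaler0.
(* The matrices supported on column [b] form a copy of the natural module; composing [phi] with the
   extraction of column [d] gives an intertwiner from it. *)
pose Q : 'M[K]_n := \matrix_(a, c) phi (delta_mx c b) a d.
have QA l : (l < s)%N -> A' l *m Q = Q *m A l.
  move=> lt_l; apply/matrixP => a' c'; rewrite !mxE.
  transitivity (phi (A l *m delta_mx c' b) a' d).
    by rewrite phiA // mxE; apply: eq_bigr => e _; rewrite mxE.
  have -> : A l *m delta_mx c' b = \sum_(e < n) A l e c' *: delta_mx e b.
    apply/matrixP => x z; rewrite summxE mxE (bigD1 c') //= !mxE eqxx /=.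
    rewrite big1 ?addr0 => [|e ec]; last by rewrite !mxE (negPf ec) mulr0.
    rewrite (bigD1 x) //= !mxE eqxx /= big1 ?addr0 // => e ex.
    by rewrite !mxE eq_sym (negPf ex) mulr0.
  rewrite phi_sum summxE; apply: eq_bigr => e _.
  by rewrite !mxE mulrC.
(* Schur's argument: a vector killed by [Q] is killed by [Q] times any word, hence by [Q] times any
   matrix. If it were nonzero, [Q] would vanish at the chosen entry. *)
exists Q => //; rewrite -unitmx_tr -row_free_unit -kermx_eq0.
apply: contraTT phi0 => /rowV0Pn[u /sub_kermxP uQ u0]; rewrite negbK.
have {}uQ : Q *m u^T = 0 by rewrite -[LHS]trmxK trmx_mul trmxK uQ trmx0.
have [e ue] : exists e, u 0 e != 0 by apply/rV0Pn.
have QM M : Q *m M *m u^T = 0.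
  rewrite (coord_decomposition M span) mulmx_sumr mulmx_suml big1 // => i _.
  by rewrite -scalemxAr -scalemxAl -(word_mx_conj QA (Ws _
    (ltn_ord i))) -mulmxA uQ mulmx0 scaler0.
have := QM (delta_mx c e); move/matrixP/(_ a 0).
rewrite mxE (bigD1 e) //= big1 ?addr0 => [|z ze].
  rewrite !mxE (bigD1 c) //= big1 ?addr0 => [|z zc].
    rewrite !mxE !eqxx mulr1 => /eqP; rewrite mulf_eq0 (negPf ue) orbF.
    by [].
  by rewrite !mxE (negPf zc) mulr0.
by rewrite !mxE big1 ?mul0r // => x _; rewrite !mxE (negPf ze) andbF mulr0.
Qed.

End WordMatrix.

(** * Bases consisting of words *)

Section WordBasis.
Variables (K : fieldType) (n s : nat) (A : nat -> 'M[K]_n).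
Hypothesis n_gt0 : (0 < n)%N.
Hypothesis generate : forall M : 'M[K]_n, exists2 r : seq (K * seq nat),
  all (fun t => all (fun l => (l < s)%N) t.2) r & M = \sum_(t <- r) t.1 *: word_mx A t.2.

(** Starting from the empty word, a letter is put in front of a word already chosen. If this never
    left the span, the span would contain the identity and be stable under the generators, hence be
    everything. Lengths grow by at most one per step, which is the origin of the length bound. *)
Lemma free_words r : (0 < r <= n * n)%N -> exists V : seq (seq nat),
  [/\ size V = r, [::] \in V, all (mem (words s r)) V &
      free [seq word_mx A w | w <- V]].
Proof.
elim: r => // -[_ _|r IH /andP[_ le_r]].
  exists [:: [::]]; split=> //=; rewrite /free span_seq1 dim_vline eqb1.
  apply/eqP => /matrixP/(_ (Ordinal n_gt0) (Ordinal n_gt0))/eqP.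
  by rewrite !mxE eqxx oner_eq0.
have [V [sV V0 wV fV]] := IH (ltnW le_r).
set X := [seq word_mx A w | w <- V] in fV.
have [l [w [lt_l wV' nin]]] : exists l w, [/\ (l < s)%N,
  w \in V & A l *m word_mx A w \notin <<X>>%VS].
  apply: contrapT => H.
  have stable l M : (l < s)%N -> M \in <<X>>%VS -> A l *m M \in <<X>>%VS.
    move=> lt_l /(@coord_span _ _ _ (in_tuple X)) ->; rewrite mulmx_sumr.
    apply: rpred_sum => i _; rewrite -scalemxAr; apply: rpredZ.
    have /mapP[w wV' ->] : X`_i \in X by apply: mem_nth.
    by apply: contra_notT H => nin; exists l, w.
  have word_in w : all (fun l => (l < s)%N) w -> word_mx A w \in <<X>>%VS.
    elim: w => [_|l w IHw /= /andP[lt_l /IHw]]; last exact: stable.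
    by apply/memv_span/mapP; exists [::].
  have full : (fullv <= <<X>>)%VS.
    apply/subvP => M _; have [q /allP qs ->] := generate M.
    by rewrite big_seq; apply: rpred_sum => t /qs ts; apply/rpredZ/word_in.
  have := leq_trans (dimvS full) (dim_span X).
  by rewrite dimvf dim_matrix size_map sV leqNgt le_r.
exists ((l :: w) :: V); split.
- by rewrite /= sV.
- by rewrite inE V0 orbT.
- apply/allP => u; rewrite inE => /predU1P[->|/(allP wV)]; last exact: words_subS.
  have [sw sl] := words_size (allP wV _ wV').
  by apply: mem_words; rewrite /= ?ltnS ?lt_l.
- by rewrite map_cons free_cons nin.
Qed.

Lemma word_basis : exists V y, V \in word_tuples n s (n * n) /\
  spanning (word_mx A \o nth [::] V) y.
Proof.
have [|V [sV _ wV fV]] := @free_words (n * n); first by rewrite muln_gt0 n_gt0 leqnn.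
set X := [seq word_mx A w | w <- V] in fV.
have sX : size X = (n * n)%N by rewrite size_map.
have full : <<X>>%VS = fullv.
  apply/eqP; rewrite eqEdim subvf dimvf dim_matrix; move: fV; rewrite /free => /eqP ->.
  by rewrite sX; apply: leqnn.
have /choice[y Hy] (q : nat * nat) : exists c : nat -> K, forall e g : 'I_n, q = (val e,
  val g) ->
    \sum_(i < n * n) c i *: word_mx A (nth [::] V i) = delta_mx e g.
  case: (EM (exists e g : 'I_n, q = (val e, val g))) => [[e [g ->]]|H]; last first.
    by exists (fun=> 0) => e g E; case: H; exists e, g.
  have : delta_mx e g \in <<X>>%VS by rewrite full memvf.
  move/(@coord_span _ _ _ (in_tuple X)) => E.
  exists (fun i => if insub i is Some j then vector.coord (in_tuple X) j
    (delta_mx e g) else 0).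
  move=> e' g' [/val_inj <- /val_inj <-]; rewrite [RHS]E.
  rewrite -(big_mkord xpredT (fun i => (if insub i is Some j then vector.coord
    (in_tuple X) j (delta_mx e g) else 0) *: word_mx A (nth [::] V i))).
  rewrite -sX big_mkord; apply: eq_bigr => i _; rewrite valK; congr (_ *: _).
  by rewrite (nth_map [::]) // -(size_map (word_mx A)) -/X.
exists V, (fun a b i => y (a, b) i); split; last by move=> e g; apply: Hy.
by rewrite -sV; apply: mem_word_tuples.
Qed.

End WordBasis.

Section SystemSolutions.
Variables (k : fieldType) (nu : nat -> k) (name : k -> nat).
Hypothesis nameK : cancel name nu.
Variables (K : closedFieldType) (f : {rmorphism k -> K}) (n : nat).
Implicit Types (v : nat -> K) (A : nat -> 'M[K]_n).

Definition sol_mx v (l : nat) : 'M[K]_n := \matrix_(a, b) v (Xvar l a b).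

Definition poly_mx A (p : seq (seq nat)) : 'M[K]_n :=
  \sum_(m <- p) f (nu (nth 0%N m 0)) *: word_mx A (dec (nth 0%N m 1)).

Section Evaluation.
Variable v : nat -> K.
Local Notation evv := (ev (f \o nu) v).

Lemma ev_Tsum m F : evv (Tsum name m F) = \sum_(i < m) evv (F i).
Proof.
rewrite -(big_mkord xpredT (fun i => evv (F i))) /index_iota subn0 /Tsum.
elim: (iota 0 m) => [|i s IH] /=; first by rewrite big_nil nameK rmorph0.
by rewrite big_cons IH.
Qed.

Lemma ev_Tdelta a b : evv (Tdelta name a b) = (a == b)%:R.
Proof. by rewrite /Tdelta /=; case: eqP => _; rewrite nameK ?rmorph1 ?rmorph0. Qed.

Lemma nth_iota_map (F : nat -> term) (a : 'I_n) d : nth d [seq F b | b <- iota 0 n] a = F a.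
Proof. by rewrite (nth_map 0%N) ?size_iota // nth_iota. Qed.

Lemma ev_word_entry w (a b : 'I_n) :
  evv (word_entry name n w a b) = word_mx (sol_mx v) w a b.
Proof.
rewrite /word_entry; elim: w a => [|l w IH] a /=; rewrite nth_iota_map.
  by rewrite ev_Tdelta mxE.
rewrite ev_Tsum mxE; apply: eq_bigr => c _.
by rewrite [LHS]/= IH mxE.
Qed.

Lemma ev_poly_entry p (a b : 'I_n) :
  evv (poly_entry name n p a b) = poly_mx (sol_mx v) p a b.
Proof.
rewrite /poly_mx; elim: p => [|m p IH] /=; first by rewrite big_nil mxE nameK rmorph0.
by rewrite big_cons IH mxE mxE ev_word_entry.
Qed.

End Evaluation.

Lemma mem_iota2 (F : nat -> nat -> term) t :
  reflect (exists a b : 'I_n, t = F a b) (t \in iota2 n F).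
Proof.
apply: (iffP flattenP) => [[_ /mapP[a aI ->] /mapP[b bI ->]]|[a [b ->]]].
  rewrite !mem_iota /= in aI bI.
  by exists (Ordinal aI), (Ordinal bI).
exists [seq F a b | b <- iota 0 n]; first by apply/mapP; exists (val a);
  rewrite ?mem_iota /=.
by apply/mapP; exists (val b); rewrite ?mem_iota /=.
Qed.

Lemma irr_solutionP P W l j i v :
  solutions nu f (irr_system name n P W l j i) v <->
  [/\ forall p, p \in P -> poly_mx (sol_mx v) p = 0,
      spanning (word_mx (sol_mx v) \o nth [::] W) (fun a b i => v (Yvar a b i)) &
      v 0%N = coordinate (fun a b i => v (Yvar a b i))
                    (word_mx (sol_mx v) (l :: nth [::] W j)) i].
Proof.
have ecoord : ev (f \o nu) v (coordinate_eq name n W l j i) =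
    coordinate (fun a b i => v (Yvar a b i)) (word_mx (sol_mx v)
      (l :: nth [::] W j)) i - v 0%N.
  rewrite [LHS]/= nameK rmorphN1 mulN1r ev_Tsum; congr (_ - _).
  apply: eq_bigr => a _; rewrite ev_Tsum; apply: eq_bigr => b _.
  by rewrite [LHS]/= ev_word_entry.
have espan (e g a b : 'I_n) : ev (f \o nu) v (spanning_eq name n W e g a b) =
    (\sum_(t < n * n) v (Yvar e g t) *: word_mx (sol_mx v)
      (nth [::] W t) - delta_mx e g) a b.
  transitivity (ev (f \o nu) v (Tsum name (n * n) (fun i => TM (TV (Yvar e g i))
      (word_entry name n (nth [::] W i) a b))) + ev (f \o nu) v (Tconst name (-1)) *
      (ev (f \o nu) v (Tdelta name a e) * ev (f \o nu) v (Tdelta name b g))); first by [].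
  rewrite ev_const // rmorphN1 mulN1r !ev_Tdelta ev_Tsum mxE summxE !mxE.
  rewrite -natrM mulnb; congr (_ - _).
  by apply: eq_bigr => t _; rewrite mxE -ev_word_entry.
split=> [sol|[HP HS HT] t].
  split=> [p pP||].
  - apply/matrixP => a b; rewrite -ev_poly_entry mxE; apply: sol.
    rewrite inE mem_cat; apply/orP; right; apply/orP; left.
    apply/flattenP; exists (iota2 n (poly_entry name n p)); first exact: map_f.
    by apply/mem_iota2; exists a, b.
  - move=> e g; apply/eqP; rewrite -subr_eq0; apply/eqP/matrixP => a b.
    rewrite -espan [RHS]mxE; apply: sol.
    rewrite inE mem_cat; apply/orP; right; apply/orP; right.
    apply/flattenP; exists (iota2 n (spanning_eq name n W e g)); last first.
      by apply/mem_iota2; exists a, b.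
    apply/flattenP; exists [seq iota2 n (spanning_eq name n W e g) | g <- iota 0 n].
      by apply/mapP; exists (val e); rewrite ?mem_iota /=.
    by apply/mapP; exists (val g); rewrite ?mem_iota /=.
  - apply/esym/eqP; rewrite -subr_eq0 -ecoord; apply/eqP/sol.
    exact: mem_head.
rewrite inE mem_cat => /predU1P[->|/orP[|]].
- by rewrite ecoord HT subrr.
- case/flattenP=> _ /mapP[p pP ->] /mem_iota2[a [b ->]].
  by rewrite ev_poly_entry HP // mxE.
- case/flattenP=> _ /flattenP[_ /mapP[e eI ->] /mapP[g gI ->]] /mem_iota2[a [b ->]].
  rewrite !mem_iota /= in eI gI.
  have := HS (Ordinal eI) (Ordinal gI); rewrite [LHS]/= => E.
  by have := espan (Ordinal eI) (Ordinal gI) a b; rewrite E subrr mxE.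
Qed.

End SystemSolutions.

(** * Representations and their matrices *)

Section RepresentationMatrices.
Variables (k : fieldType) (nu : nat -> k) (K : closedFieldType) (iota : {rmorphism k -> K}).
Variables (s n : nat).
Local Notation A := (free_alg k s).

Definition free_word (w : seq 'I_s) : A := << 1 *g FMonom w >>.

Lemma free_word_nil : free_word [::] = 1.
Proof.
rewrite /free_word; have -> : FMonom [::] = @mone {fmonom 'I_s}.
  by apply: val_inj; rewrite /= fm1.
by [].
Qed.

Lemma free_word_cons i w : free_word (i :: w) = free_word [:: i] * free_word w.
Proof.
rewrite /free_word -[_ * _]/((<< 1 *g FMonom [:: i] >> : {malg k[_]}) * << 1 *g FMonom w >>).
rewrite malgM_def fgmulUU mulr1; congr << _ *g _ >>.
by apply: val_inj; rewrite /= fmM.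
Qed.

Lemma free_monomial c w : << c *g FMonom w >> = c *: free_word w :> A.
Proof.
by apply/malgP => m; rewrite mcoeffZ !mcoeffU mulrnAr mulr1.
Qed.

Lemma decode_polyE (p : poly_data s) :
  decode_poly nu p = \sum_(t <- p) nu t.1 *: free_word t.2.
Proof. by apply: eq_bigr => t _; apply: free_monomial. Qed.

Lemma free_algE (x : A) : exists r : seq (k * seq 'I_s),
  x = \sum_(t <- r) t.1 *: free_word t.2.
Proof.
exists [seq (x@_m, fmonom_val m) | m <- finmap.enum_fset (msupp x)].
rewrite big_map [LHS]monalgE; apply: eq_bigr => m _.
by rewrite -free_monomial /= fmK.
Qed.

Section Matrices.
Variable fs : seq A.
Implicit Types rho : representation iota fs n.

Definition rep_mx rho (l : nat) : 'M[K]_n :=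
  if insub l is Some i then rho (\pi_(fp_alg fs) (free_word [:: i])) else 0.

Lemma rep_mxE rho (i : 'I_s) : rep_mx rho i = rho (\pi_(fp_alg fs) (free_word [:: i])).
Proof. by rewrite /rep_mx valK. Qed.

Lemma rep_free_word rho w :
  rho (\pi_(fp_alg fs) (free_word w)) = word_mx (rep_mx rho) (map val w).
Proof.
elim: w => [|i w IH] /=.
  by rewrite free_word_nil pi_fp_one -[fp_one fs]/(1 : fp_alg fs) rmorph1.
rewrite free_word_cons pi_fp_mul -[fp_mul _ _]/((_ : fp_alg fs) * _) rmorphM IH.
by rewrite rep_mxE.
Qed.

Lemma rep_pi_sum rho (r : seq (k * seq 'I_s)) :
  rho (\pi_(fp_alg fs) (\sum_(t <- r) t.1 *: free_word t.2)) =
  \sum_(t <- r) iota t.1 *: word_mx (rep_mx rho) (map val t.2).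
Proof.
rewrite raddf_sum raddf_sum; apply: eq_bigr => t _.
transitivity (rho (t.1 *: (\pi_(fp_alg fs) (free_word t.2) : fp_alg fs))).
  by congr (rho _); apply: (pi_fp_scale fs).
by rewrite rep_scalable rep_free_word.
Qed.

(** One expression in words serves all representations at once, so that they can be compared on the
    generators. *)
Lemma fp_alg_words (x : fp_alg fs) : exists r : seq (k * seq 'I_s),
  forall rho, rho x = \sum_(t <- r) iota t.1 *: word_mx (rep_mx rho) (map val t.2).
Proof.
have [r E] := free_algE (repr x); exists r => rho.
by rewrite -rep_pi_sum -E reprK.
Qed.

Lemma all_val_lt (w : seq 'I_s) : all (fun l => (l < s)%N) (map val w).
Proof. by rewrite all_map; apply/allP => i _ /=. Qed.

Lemma rep_equivP rho rho' : rep_equiv rho rho' <->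
  exists2 Q : 'M[K]_n, Q \in unitmx &
    forall l, (l < s)%N -> rep_mx rho' l *m Q = Q *m rep_mx rho l.
Proof.
split=> [] [Q Qu QE]; exists Q => //.
  move=> l lt_l; rewrite -[l]/(val (Ordinal lt_l)) !rep_mxE QE.
  by rewrite mulmxKV.
move=> x; have [r E] := fp_alg_words x; rewrite !E mulmx_sumr mulmx_suml.
apply: eq_bigr => t _; rewrite -scalemxAr -scalemxAl; congr (_ *: _).
by rewrite -(word_mx_conj QE (all_val_lt _)) mulmxK.
Qed.

Lemma rep_irreducibleP rho : rep_irreducible rho <->
  forall M : 'M[K]_n, exists2 r : seq (K * seq nat),
    all (fun t => all (fun l => (l < s)%N) t.2) r &
    M = \sum_(t <- r) t.1 *: word_mx (rep_mx rho) t.2.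
Proof.
split=> H M; have [r] := H M.
  move=> ->; have /choice[d Hd] := fp_alg_words.
  exists (flatten [seq [seq (t.1 * iota q.1, map val q.2) | q <- d t.2] | t <- r]).
    apply/allP => _ /flattenP[_ /mapP[t _ ->] /mapP[q _ ->]].
    exact: all_val_lt.
  rewrite big_flatten big_map; apply: eq_bigr => t _.
  rewrite big_map [in LHS]Hd scaler_sumr; apply: eq_bigr => q _.
  by rewrite scalerA.
move=> rs ->; elim: r rs => [_|[c w] r IH /= /andP[ws /IH[q Eq]]].
  by exists [::]; rewrite !big_nil.
exists ((c, \pi_(fp_alg fs) (free_word (pmap insub w))) :: q).
rewrite !big_cons Eq rep_free_word /=; congr (_ *: word_mx _ _ + _).
elim: w ws => //= l w IHw /andP[lt_l /IHw {1}->].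
by rewrite insubT.
Qed.

End Matrices.
End RepresentationMatrices.

Section RepresentationOfMatrices.
Variables (k : fieldType) (nu : nat -> k) (K : closedFieldType) (iota : {rmorphism k -> K}).
Variables (s n : nat) (B : nat -> 'M[K]_n.+1).
Local Notation A := (free_alg k s).

Definition fmonom_mx (m : {fmonom 'I_s}) : 'M[K]_n.+1 := word_mx B (map val (fmonom_val m)).

Lemma fmonom_mx_mmorphism : mmorphism fmonom_mx.
Proof.
split=> [m1 m2|]; rewrite /fmonom_mx; last by rewrite fm1.
rewrite fmM map_cat; elim: (fmonom_val m1) => [|i w IH] /=; first by rewrite mul1r.
by rewrite IH; apply: mulmxA.
Qed.

HB.instance Definition _ := monalg.isMultiplicative.Build {fmonom 'I_s} 'M[K]_n.+1 fmonom_mx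
  fmonom_mx_mmorphism.

Local Notation scal := (scalar_mx \o iota : {rmorphism k -> 'M[K]_n.+1}).

Definition free_eval (x : A) : 'M[K]_n.+1 := mmap scal fmonom_mx x.

Lemma free_evalB x y : free_eval (x - y) = free_eval x - free_eval y.
Proof. exact: (raddfB (mmap scal fmonom_mx)). Qed.

(** Evaluation in a noncommutative ring is multiplicative when the images of the coefficients
    commute with those of the monomials, as scalar matrices do. *)
Lemma free_evalM x y : free_eval (x * y) = free_eval x * free_eval y.
Proof.
have comm (g : {malg k[{fmonom 'I_s}]}) m m' : GRing.comm (scal g@_m) (fmonom_mx m').
  exact/esym/scalar_mxC.
exact: (commr_mmap_is_multiplicative comm).1.
Qed.

Lemma free_eval1 : free_eval 1 = 1.
Proof. exact: mmap1. Qed.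

Lemma free_evalZ c x : free_eval (c *: x) = iota c *: free_eval x.
Proof.
have E : free_eval (c *: x) = (iota c)%:M * free_eval x by apply: mmapZ.
by rewrite E; apply: mul_scalar_mx.
Qed.

Lemma free_eval_word w : free_eval (free_word k w) = word_mx B (map val w).
Proof.
transitivity (scal 1 * fmonom_mx (FMonom w)); first exact: mmapU.
by rewrite (rmorph1 scal) mul1r.
Qed.

Lemma free_eval0 : free_eval 0 = 0.
Proof. by rewrite -(subrr 0) free_evalB subrr. Qed.

Lemma free_evalD x y : free_eval (x + y) = free_eval x + free_eval y.
Proof. by rewrite -[y in LHS]opprK free_evalB -[- y]sub0r free_evalB free_eval0 sub0r opprK. Qed.

Lemma free_eval_sum (I : Type) (r : seq I) (F : I -> A) :
  free_eval (\sum_(t <- r) F t) = \sum_(t <- r) free_eval (F t).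
Proof. exact: (big_morph free_eval free_evalD free_eval0). Qed.

Section Quotient.
Variable fs : seq A.
Hypothesis fs0 : forall x, x \in fs -> free_eval x = 0.

Lemma free_eval_ideal x : x \in gen_ideal fs -> free_eval x = 0.
Proof.
move=> /asboolP[r rP ->]; rewrite free_eval_sum big_seq big1 // => t /rP tfs.
by rewrite !free_evalM (fs0 tfs) mulr0 mul0r.
Qed.

Definition fp_eval (x : fp_alg fs) : 'M[K]_n.+1 := free_eval (repr x).

Lemma fp_eval_pi x : fp_eval (\pi_(fp_alg fs) x) = free_eval x.
Proof.
apply/eqP; rewrite -subr_eq0 -free_evalB; apply/eqP/free_eval_ideal.
by apply/fp_algP; rewrite reprK.
Qed.

Lemma fp_eval_zmod : zmod_morphism fp_eval.
Proof.
move=> x y; rewrite -[x]reprK -[y]reprK !fp_eval_pi -free_evalB -fp_eval_pi.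
by congr fp_eval; rewrite raddfB.
Qed.

Lemma fp_eval_monoid : monoid_morphism fp_eval.
Proof.
split=> [|x y].
  by rewrite -[1]/(fp_one fs) -pi_fp_one fp_eval_pi free_eval1.
rewrite -[x]reprK -[y]reprK !fp_eval_pi -free_evalM -fp_eval_pi.
by congr fp_eval; rewrite pi_fp_mul.
Qed.

Lemma representation_of_mx : exists rho : representation iota fs n.+1,
  forall l, (l < s)%N -> rep_mx rho l = B l.
Proof.
pose f : {rmorphism fp_alg fs -> 'M[K]_n.+1} := HB.pack fp_eval
  (GRing.isZmodMorphism.Build (fp_alg fs) 'M[K]_n.+1 fp_eval fp_eval_zmod)
  (GRing.isMonoidMorphism.Build (fp_alg fs) 'M[K]_n.+1 fp_eval fp_eval_monoid).
have fZ (a : k) x : f (a *: x) = iota a *: f x.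
  rewrite -[x]reprK -[LHS]/(fp_eval (fp_scale a _)) -pi_fp_scale.
  by rewrite [LHS]fp_eval_pi free_evalZ -fp_eval_pi.
exists (Representation fZ) => l lt_l.
rewrite -[l]/(val (Ordinal lt_l)) rep_mxE [LHS]fp_eval_pi free_eval_word /=.
exact: mulmx1.
Qed.

End Quotient.
End RepresentationOfMatrices.

(** * Finiteness of the set of classes *)

Definition seq_product (T : eqType) (rs : seq (seq T)) : seq (seq T) :=
  foldr (fun r acc => flatten [seq [seq z :: t | t <- acc] | z <- r]) [:: [::]] rs.

Lemma mem_seq_product (I : eqType) (T : eqType) (c : I -> T) (r : I -> seq T) (l : seq I) :
  (forall q, q \in l -> c q \in r q) -> map c l \in seq_product (map r l).
Proof.
elim: l => //= q l IH H; apply/flattenP.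
exists [seq c q :: t | t <- seq_product (map r l)].
  by apply: (map_f (fun z => [seq z :: t | t <- seq_product (map r l)])); apply: H;
    rewrite mem_head.
by apply/map_f/IH => q' q'l; apply: H; rewrite inE q'l orbT.
Qed.

Lemma eq_word_mx (K : fieldType) n s (A A' : nat -> 'M[K]_n) w :
  (forall l, (l < s)%N -> A l = A' l) -> all (fun l => (l < s)%N) w ->
  word_mx A w = word_mx A' w.
Proof. by move=> AA; elim: w => //= l w IH /andP[/AA -> /IH ->]. Qed.

Definition dec_triple (c : nat) : nat * (nat * nat) := dec c.

Lemma dec_tripleK a b c : dec_triple (enc (a, (b, c))) = (a, (b, c)).
Proof. exact: encK. Qed.

Section Classes.
Variables (k : fieldType) (nu : nat -> k) (name : k -> nat).
Hypothesis nameK : cancel name nu.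
Variables (K : closedFieldType) (iota : {rmorphism k -> K}) (s n : nat).
Variable ps : seq (poly_data s).
Local Notation N := (n.+1 * n.+1)%N.
Local Notation fs := (map (decode_poly nu) ps).
Local Notation rep := (representation iota fs n.+1).

Definition relation_codes : seq (seq (seq nat)) :=
  [seq [seq [:: t.1; CodeSeq.code
    (map val t.2)] | t : nat * seq 'I_s <- p] | p : poly_data s <- ps].

Lemma code_presentationE : code_presentation ps = enc [:: s; enc relation_codes].
Proof.
rewrite /code_presentation /enc /= /enc_seq /=; congr (CodeSeq.code [:: s; CodeSeq.code _]).
rewrite /relation_codes -map_comp; apply: eq_map => p /=.
rewrite /code_poly /enc_seq; congr CodeSeq.code; rewrite -map_comp.
exact: eq_map.
Qed.

Lemma input_sizeE : input_size (code_presentation ps) = s.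
Proof. by rewrite /input_size code_presentationE encK. Qed.

Lemma input_relationsE : input_relations (code_presentation ps) = relation_codes.
Proof. rewrite /input_relations code_presentationE encK; exact: encK. Qed.

Lemma poly_mx_codes (A : nat -> 'M[K]_n.+1) (p : poly_data s) :
  poly_mx nu iota A [seq [:: t.1; CodeSeq.code (map val t.2)] | t : nat * seq 'I_s <- p] =
  \sum_(t <- p) iota (nu t.1) *: word_mx A (map val t.2).
Proof.
rewrite /poly_mx big_map; apply: eq_bigr => t _ /=; congr (_ *: word_mx _ _).
by rewrite /dec_seq /= CodeSeq.codeK map_id.
Qed.

Lemma rep_relations (rho : rep) p : p \in relation_codes -> poly_mx nu iota
  (rep_mx rho) p = 0.
Proof.
case/mapP=> q qps ->; rewrite poly_mx_codes.
have := rep_pi_sum rho [seq (nu t.1, t.2) | t <- q]; rewrite !big_map -decode_polyE /= =>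
  <-.
have -> : \pi_(fp_alg fs) (decode_poly nu q) = 0.
  rewrite -(raddf0 \pi_(fp_alg fs)); apply/fp_algP; rewrite subr0; apply/asboolP.
  exists [:: (1, decode_poly nu q, 1)]; last by rewrite big_seq1 mul1r mulr1.
  by move=> t; rewrite inE => /eqP -> /=; apply: map_f.
by rewrite rmorph0.
Qed.

Section FixedWords.
Variable W : seq (seq nat).
Hypothesis WT : W \in word_tuples n.+1 s N.

Lemma fixed_words i : (i < N)%N -> all (fun l => (l < s)%N) (nth [::] W i).
Proof.
have [sW /allP wW] := word_tuples_sub WT.
by move=> lt_i; apply/words_sub/wW/mem_nth; rewrite sW.
Qed.

(** A relation rather than a function, since the words of [W] need not span for a given [rho]. *)
Definition has_value (rho : rep) (l j i : nat) (t : K) : Prop :=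
  exists2 y, spanning (word_mx (rep_mx rho) \o nth [::] W) y &
    t = coordinate y (word_mx (rep_mx rho) (l :: nth [::] W j)) i.

Lemma has_value_equiv rho rho' l j i t t' :
  (l < s)%N -> (j < N)%N -> (i < N)%N -> rep_equiv rho rho' ->
  has_value rho l j i t -> has_value rho' l j i t' -> t = t'.
Proof.
move=> lt_l lt_j lt_i /rep_equivP[Q Qu QE] [y span ->] [y' span' ->].
exact: (conj_coord Qu QE fixed_words span span').
Qed.

(** The spanning equations alone make the representation irreducible, since the words are images of
    elements of the algebra. *)
Lemma solution_rep l j i v : (l < s)%N -> (j < N)%N ->
  solutions nu iota (irr_system name n.+1 relation_codes W l j i) v ->
  exists2 rho : rep, rep_irreducible rho & has_value rho l j i (v 0%N).
Proof.
move=> lt_l lt_j /(irr_solutionP nameK)[rel span val0].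
have [|rho Hrho] := @representation_of_mx k K iota s n (sol_mx n.+1 v) fs.
  move=> _ /mapP[p pps ->]; rewrite decode_polyE free_eval_sum.
  have := rel _ (map_f (fun p : poly_data s =>
    [seq [:: t.1; CodeSeq.code (map \val t.2)] | t : nat * seq 'I_s <- p]) pps).
  rewrite poly_mx_codes => E; rewrite -[RHS]E.
  by apply: eq_bigr => t _; rewrite free_evalZ free_eval_word.
have wE w : all (fun l => (l < s)%N) w -> word_mx (rep_mx rho) w = word_mx
  (sol_mx n.+1 v) w.
  by move=> ws; apply: eq_word_mx Hrho ws.
have span' : spanning (word_mx (rep_mx rho) \o nth [::] W) (fun a b i => v (Yvar a b i)).
  move=> e g; rewrite -span; apply: eq_bigr => t _.
  by rewrite /= wE // fixed_words.
exists rho; last first.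
  exists (fun a b i => v (Yvar a b i)) => //.
  by rewrite wE //= lt_l fixed_words.
apply/rep_irreducibleP => M.
exists [seq (coordinate (fun a b i => v (Yvar a b i)) M i, nth [::] W
  (val i)) | i : 'I_N <- enum 'I_N].
  by rewrite all_map; apply/allP => t _ /=; apply: fixed_words.
by rewrite big_map big_enum /= {1}(coord_decomposition M span').
Qed.

Lemma rep_solution rho l j i t : has_value rho l j i t ->
  exists2 v, solutions nu iota (irr_system name n.+1 relation_codes W l j i) v & v 0%N = t.
Proof.
move=> [y span ->]; set t0 := coordinate _ _ _.
(* The parity of a variable tells which family it belongs to, and its code is then decoded. The
   default of [inord] on indices out of range never matters, as only entries indexed by ordinals are
   used. *)
pose v (x : nat) : K :=
  if x is 0 then t0 else if odd x then
    let q := dec_triple x./2 in rep_mx rho q.1 (inord q.2.1) (inord q.2.2)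
  else let q := dec_triple x.-2./2 in y q.1 q.2.1 q.2.2.
have v_odd e : v e.*2.+1 = rep_mx rho (dec_triple e).1
    (inord (dec_triple e).2.1) (inord (dec_triple e).2.2).
  by rewrite /v /= odd_double /= uphalf_double.
have v_even e : v e.*2.+2 = y (dec_triple e).1 (dec_triple e).2.1 (dec_triple e).2.2.
  by rewrite /v /= odd_double /= doubleK.
have vX l' : sol_mx n.+1 v l' = rep_mx rho l'.
  apply/matrixP => a b; rewrite mxE /Xvar v_odd dec_tripleK.
  by rewrite [(_, _).1]/= [(_, _).2.1]/= [(_, _).2.2]/= !inord_val.
have vY a b c : v (Yvar a b c) = y a b c.
  by rewrite /Yvar v_even dec_tripleK.
have wE w : word_mx (sol_mx n.+1 v) w = word_mx (rep_mx rho) w.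
  by elim: w => //= l' w ->; rewrite vX.
exists v => //; apply/(irr_solutionP nameK); split.
- move=> p /(rep_relations rho) <-; rewrite /poly_mx.
  by apply: eq_bigr => m _; rewrite wE.
- move=> e g; rewrite -span; apply: eq_bigr => c _.
  by rewrite vY /= wE.
- rewrite wE -[LHS]/t0 /t0; apply: eq_bigr => a _; apply: eq_bigr => b _.
  by rewrite vY.
Qed.

End FixedWords.

Lemma rep_equiv_refl (rho : rep) : rep_equiv rho rho.
Proof.
exists 1%:M; first exact: unitmx1.
by move=> x; rewrite mul1mx invmx1 mulmx1.
Qed.

Lemma rep_equiv_sym (rho rho' : rep) : rep_equiv rho rho' -> rep_equiv rho' rho.
Proof.
case=> Q Qu QE; exists (invmx Q); rewrite ?unitmx_inv // => x.
by rewrite QE invmxK !mulmxA mulVmx // mul1mx mulmxKV.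
Qed.

Lemma rep_equiv_trans (r1 r2 r3 : rep) : rep_equiv r1 r2 -> rep_equiv r2 r3
  -> rep_equiv r1 r3.
Proof.
move=> /rep_equivP[Q Qu QE] /rep_equivP[P Pu PE]; apply/rep_equivP.
exists (P *m Q); first by rewrite unitmx_mul Pu.
by move=> l lt_l; rewrite mulmxA PE // -mulmxA QE // mulmxA.
Qed.

Lemma rep_class_eq (rho rho' : rep) : rep_class rho = rep_class rho' <-> rep_equiv rho rho'.
Proof.
split=> [E|e].
  have : rep_class rho' rho' by exact: rep_equiv_refl.
  by rewrite -E.
apply/seteqP; split=> r /= H; first exact: rep_equiv_trans (rep_equiv_sym e) H.
exact: rep_equiv_trans e H.
Qed.

(** The value is a class invariant, so the set of values lies in the image of the set of classes
    under a choice of values. *)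
Lemma finite_values_of_finite_classes W l j i :
  W \in word_tuples n.+1 s N -> (l < s)%N -> (j < N)%N -> (i < N)%N ->
  finite_set (irreducible_classes iota fs n.+1) ->
  finite_set (values0 nu iota (irr_system name n.+1 relation_codes W l j i)).
Proof.
move=> WT lt_l lt_j lt_i fin.
pose R (C : set rep) (t : K) := exists2 rho, C = rep_class rho & has_value W rho l j i t.
have /choice[h Hh] (C : set rep) : exists t, (exists t', R C t') -> R C t.
  by case: (EM (exists t', R C t')) => [[t' Rt]|nR]; [exists t' | exists 0].
apply: (sub_finite_set _ (finite_image h fin)) => _ [v sol <-].
have [rho irr val_v] := solution_rep WT lt_l lt_j sol.
exists (rep_class rho); first by exists rho.
have [|rho' /rep_class_eq e val'] := Hh (rep_class rho); first by exists (v 0%N), rho.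
by rewrite (has_value_equiv WT lt_l lt_j lt_i e val_v val').
Qed.

(** Irreducibility supplies a word basis, and this basis with its tuple of coordinates determines
    the class. Both come from finite lists, so the classes lie in the image of a finite set. *)
Lemma finite_classes_of_finite_values :
  (forall W l j i, W \in word_tuples n.+1 s N -> (l < s)%N -> (j < N)%N -> (i < N)%N ->
    finite_set (values0 nu iota (irr_system name n.+1 relation_codes W l j i))) ->
  finite_set (irreducible_classes iota fs n.+1).
Proof.
move=> fin.
pose I := [seq (l, q) | l <- seq.iota 0 s,
  q <- [seq (j, i) | j <- seq.iota 0 N, i <- seq.iota 0 N]].
have memI l j i : ((l, (j, i)) \in I) = [&& (l < s)%N, (j < N)%N & (i < N)%N].
  apply/allpairsP/and3P => [[[l' q] [lI /allpairsP[[j' i'] [jI iI ->]] [-> ->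
    ->]]]|[lt_l lt_j lt_i]].
    by move: lI jI iI; rewrite !mem_iota.
  exists (l, (j, i)); rewrite mem_iota; split=> //.
  by apply/allpairsP; exists (j, i); rewrite !mem_iota.
have /choice[r Hr] (q : seq (seq nat) * (nat * (nat * nat))) : exists r : seq K,
    q.1 \in word_tuples n.+1 s N -> q.2 \in I ->
    forall rho t, has_value q.1 rho q.2.1 q.2.2.1 q.2.2.2 t -> t \in r.
  case: q => W [l [j i]] /=; case: (boolP (W \in word_tuples n.+1 s N)) => [WT|_];
    last by exists [::].
  rewrite memI; case: and3P => [[lt_l lt_j lt_i]|_]; last by exists [::].
  have /finite_seqP[r Er] := fin W l j i WT lt_l lt_j lt_i.
  exists r => _ _ rho t /rep_solution[v sol <-].
  have : values0 nu iota (irr_system name n.+1 relation_codes W l j i) (v 0%N) by exists v.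
  by rewrite Er.
(* All pairs of a choice of words and a tuple whose component at [q] is one of the finitely many
   values of the coordinate [q]. *)
pose D := flatten [seq [seq (W, c) | c <- seq_product [seq r (W, q) | q <- I]]
  | W <- word_tuples n.+1 s N].
pose R (d : seq (seq nat) * seq K) (C : set rep) := exists2 rho, C = rep_class rho &
  d.1 \in word_tuples n.+1 s N /\ exists2 y, spanning (word_mx
    (rep_mx rho) \o nth [::] d.1) y &
    d.2 = [seq coordinate y (word_mx (rep_mx rho)
      (q.1 :: nth [::] d.1 q.2.1)) q.2.2 | q <- I].
have Runiq d C C' : R d C -> R d C' -> C = C'.
  move=> [rho -> [WT [y span dE]]] [rho' -> [_ [y' span' dE']]].
  apply/rep_class_eq/rep_equivP.
  apply: (same_coord_conj _ (fixed_words WT) span span') => // l j i lt_l lt_j lt_i.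
  have qI : (l, (j, i)) \in I by rewrite memI lt_l lt_j.
  by have /eq_in_map/(_ _ qI) := etrans (esym dE) dE'.
have /choice[G HG] (d : seq (seq nat) * seq K) : exists C, (exists C', R d C') -> R d C.
  case: (EM (exists C', R d C')) => [[C' RC]|nR]; first by exists C'.
  by exists set0.
apply: (sub_finite_set _ (finite_image G (finite_seq D))) => C [rho irr <-].
have [V [y [VT span]]] := word_basis (ltn0Sn n) (iffLR (rep_irreducibleP rho) irr).
pose c q := coordinate y (word_mx (rep_mx rho) (q.1 :: nth [::] V q.2.1)) q.2.2.
have RV : R (V, map c I) (rep_class rho) by exists rho => //; split=> //; exists y.
exists (V, map c I); last exact: (Runiq _ _ _ (HG _ (ex_intro _ _ RV)) RV).
apply/flattenP; exists [seq (V, c) | c <- seq_product [seq r (V, q) | q <- I]].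
  exact: (map_f (fun W => [seq (W, c) | c <- seq_product [seq r (W, q) | q <- I]])).
apply/map_f/(mem_seq_product (r := fun q => r (V, q))) => q qI.
by apply: (Hr (V, q) VT qI rho); exists y.
Qed.

Lemma decider_correct (fin : seq term -> bool) :
  (forall S, fin S <-> finite_set (values0 nu iota S)) ->
  decider name n.+1 fin (code_presentation ps) <->
  finite_set (irreducible_classes iota fs n.+1).
Proof.
move=> finE; rewrite /decider input_sizeE input_relationsE; split=> [/allP H|H].
  apply: finite_classes_of_finite_values => W l j i WT lt_l lt_j lt_i; apply/finE.
  have /allP/(_ l) := H W WT; rewrite mem_iota lt_l => /(_ isT)/allP/(_ j).
  rewrite mem_iota lt_j => /(_ isT)/allP/(_ i).
  by rewrite mem_iota lt_i => /(_ isT).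
apply/allP => W WT; apply/allP => l; rewrite mem_iota => /andP[_ lt_l].
apply/allP => j; rewrite mem_iota => /andP[_ lt_j].
apply/allP => i; rewrite mem_iota => /andP[_ lt_i].
by apply/finE/finite_values_of_finite_classes.
Qed.

End Classes.

Theorem mainTheorem1 (n : nat) (n_gt0 : (0 < n)%N)
    (k : fieldType) (k_char0 : [pchar k] =i pred0)
    (nu : nat -> k) (k_computable : computable_numbering nu)
    (K : closedFieldType) (iota : {rmorphism k -> K})
    (K_closure : is_algebraic_closure iota) :
  exists c : recfun 1, forall (s : nat) (ps : seq (poly_data s)),
    exists2 b : bool,
      eval c [tuple code_presentation ps] b &
      b <-> finite_set
              (irreducible_classes iota (map (decode_poly nu) ps) n).
Proof.
have [name nameK] := choice (numbering_surj k_computable).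
(* Matrices of size a successor form a nonzero ring, as the evaluation of the free algebra
   requires. *)
case: n n_gt0 => // n _.
have [fin fin_dec finE] := decidable_finite_values iota nameK k_computable.
have [c Hc] := decidable_decider name n.+1 fin_dec.
exists c => s ps; exists (decider name n.+1 fin (code_presentation ps)).
  exact: (Hc [tuple code_presentation ps]).
exact: decider_correct.
Qed.
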